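(* Let $1<p<\infty$ and $f\in L^{p/(p-1)}(\omega_2)$. Let $u_\ell\in W^{1,p}_0(\Omega_\ell)$ be the weak solution of $-\mathrm{div}(H^{p-1}(\nabla u_\ell)\nabla H(\nabla u_\ell))=f(X_2)$ in $\Omega_\ell$ (equivalently, the minimizer of $J_\ell$ on $W^{1,p}_0(\Omega_\ell)$), and let $u_\infty\in W^{1,p}_0(\omega_2)$ be the weak solution of $-\mathrm{div}(H^{p-1}(\nabla_2u_\infty)\nabla_{Z_2}H(\nabla_2u_\infty))=f(X_2)$ in $\omega_2$ (equivalently, the minimizer of $J_\infty$ on $W^{1,p}_0(\omega_2)$). Then $$\lim_{\ell\to\infty}\frac{J_\ell(u_\ell)}{|\ell\omega_1|}=J_\infty(u_\infty).$$ Moreover, there is a constant $C>0$ independent of $\ell$ such that $$J_\infty(u_\infty)\le\frac{J_\ell(u_\ell)}{|\ell\omega_1|}\le J_\infty(u_\infty)+\frac{C}{\ell}.$$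
   Context: Let $1\le m<n$, let $\omega_1\subset\mathbb{R}^m$ be open, bounded and convex with $0\in\omega_1$, and let $\omega_2\subset\mathbb{R}^{n-m}$ be open and bounded. For $\ell>0$ set $\Omega_\ell=\ell\omega_1\times\omega_2\subset\mathbb{R}^n$. Points are written $x=(X_1,X_2)$ with $X_1\in\mathbb{R}^m$, $X_2\in\mathbb{R}^{n-m}$; $\nabla_{Z_2}H$ is the gradient of $H$ in its last $n-m$ variables; $\nabla_2:=(0,\dots,0,\partial_{x_{m+1}},\dots,\partial_{x_n})\in\mathbb{R}^n$. $|\ell\omega_1|$ is the $m$-dimensional Lebesgue measure of $\ell\omega_1$. The energies are $$J_\ell(v)=\int_{\Omega_\ell}\left\{\frac{H^p(\nabla v)}{p}-f(X_2)v\right\}dx,\quad v\in W^{1,p}_0(\Omega_\ell),\qquad J_\infty(w)=\int_{\omega_2}\left\{\frac{H^p(\nabla_2w)}{p}-f(X_2)w\right\}dX_2,\quad w\in W^{1,p}_0(\omega_2).$$ $H:\mathbb{R}^n\to[0,+\infty)$ satisfies: $H(x)>0$ for $x\neq0$; $H$ is convex; $H(tx)=|t|H(x)$ for all $t\in\mathbb{R}$, $x\in\mathbb{R}^n$; $H\in C^1(\mathbb{R}^n\setminus\{0\})$. The field $H^{p-1}(z)\nabla H(z)$ is understood to be $0$ at $z=0$. Standing assumptions: there are constants $c_1,c_2,c_3>0$ such that for all $z_1,z_2\in\mathbb{R}^n$: (i) if $p\ge2$, $\langle H^{p-1}(z_1)\nabla H(z_1)-H^{p-1}(z_2)\nabla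 H(z_2),\,z_1-z_2\rangle\ge c_1|z_1-z_2|^p$; (ii) if $1<p<2$, $\langle H^{p-1}(z_1)\nabla H(z_1)-H^{p-1}(z_2)\nabla H(z_2),\,z_1-z_2\rangle\ge c_2|z_1-z_2|^2(|z_1|+|z_2|)^{p-2}$; (iii) if $1<p<2$, $|H^{p-1}(z_1)\nabla H(z_1)-H^{p-1}(z_2)\nabla H(z_2)|\le c_3|z_1-z_2|(|z_1|+|z_2|)^{p-2}$ (in (ii) and (iii) the right-hand side is read as $0$ when $z_1=z_2=0$). Weak solution: $u\in W^{1,p}_0(\Omega_\ell)$ with $\int_{\Omega_\ell}H^{p-1}(\nabla u)\langle\nabla H(\nabla u),\nabla\phi\rangle\,dx=\int_{\Omega_\ell}f(X_2)\phi\,dx$ for all $\phi\in W^{1,p}_0(\Omega_\ell)$; respectively $w\in W^{1,p}_0(\omega_2)$ with $\int_{\omega_2}H^{p-1}(0,\nabla_{X_2}w)\langle\nabla_{Z_2}H(0,\nabla_{X_2}w),\nabla_{X_2}\phi\rangle\,dX_2=\int_{\omega_2}f\phi\,dX_2$ for all $\phi\in W^{1,p}_0(\omega_2)$. *)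

(* Defs.v *)
From HB Require Import structures.
From mathcomp Require Import all_boot all_order all_algebra.
From mathcomp Require Import all_classical all_reals all_analysis.

Set Implicit Arguments.
Unset Strict Implicit.
Unset Printing Implicit Defensive.
Import Order.TTheory GRing.Theory Num.Theory.
Import numFieldNormedType.Exports.

Local Open Scope classical_set_scope.
Local Open Scope ring_scope.

(* The sigma-algebra on 'rV[R]_n is generated by the coordinates, as the library
   does for n.-tuple T; it is the Borel sigma-algebra. *)
Definition rV_display : measure_display.
Proof. exact: default_measure_display. Qed.

Section measurable_rV.
Context {R : realType} (n : nat).

Let coors : 'I_n -> 'rV[R]_n -> measurableTypeR R := fun i x => x ord0 i.

Let rV_set0 : g_sigma_preimage coors set0.
Proof. exact: sigma_algebra0. Qed.

Let rV_setC A : g_sigma_preimage coors A -> g_sigma_preimage coors (~` A).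
Proof. exact: sigma_algebraC. Qed.

Let rV_bigcup (F : _^nat) : (forall i, g_sigma_preimage coors (F i)) ->
  g_sigma_preimage coors (\bigcup_i (F i)).
Proof. exact: sigma_algebra_bigcup. Qed.

HB.instance Definition _ := @isMeasurable.Build rV_display
  'rV[R]_n (g_sigma_preimage coors) rV_set0 rV_setC rV_bigcup.

End measurable_rV.

Section lebesgue_rV.
Context {R : realType}.

Lemma measurable_rV_coord n (i : 'I_n) :
  measurable_fun [set: 'rV[R]_n] (fun x => x ord0 i : measurableTypeR R).
Proof.
move=> _ Y mY; rewrite setTI; apply: sub_sigma_algebra => /=.
rewrite -bigcup_seq/=; exists i => /=; first by rewrite mem_index_enum.
by exists Y => //; rewrite setTI.
Qed.

Lemma measurable_fun_rVP d (T : measurableType d) n (f : T -> 'rV[R]_n) :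
  (forall i, measurable_fun [set: T] (fun x => f x ord0 i : measurableTypeR R)) ->
  measurable_fun [set: T] f.
Proof.
move=> mf; have mT : sigma_algebra [set: 'rV[R]_n]
    [set A | measurable (f @^-1` A)].
  split => /=.
  - by rewrite preimage_set0.
  - by move=> A mA; rewrite setTD preimage_setC; exact: measurableC.
  - by move=> F mF; rewrite preimage_bigcup; exact: bigcup_measurable.
move=> _ A mA; rewrite setTI.
suff : (@measurable _ 'rV[R]_n) `<=` [set A | measurable (f @^-1` A)] by exact.
apply: smallest_sub => //.
elim/big_ind : _ => [//|B C sB sC D [/sB//|/sC//]|i _ B [C mC <-] /=].
by rewrite setTI -[X in measurable X]setTI; exact: mf.
Qed.

Definition rV_cons n (p : measurableTypeR R * 'rV[R]_n) : 'rV[R]_n.+1 :=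
  row_mx (const_mx p.1 : 'rV[R]_1) p.2.

Lemma measurable_rV_cons n : measurable_fun setT (@rV_cons n).
Proof.
apply: measurable_fun_rVP => i; rewrite /rV_cons.
case: (split_ordP (i : 'I_(1 + n))) => j -> /=.
- apply: (eq_measurable_fun fst); last exact: measurable_fst.
  by move=> p _; rewrite [RHS](row_mxEl (const_mx p.1 : 'rV[R]_1) p.2) mxE.
- apply: (eq_measurable_fun
    (fun p : measurableTypeR R * 'rV[R]_n => p.2 ord0 j : measurableTypeR R)).
    by move=> p _; rewrite (row_mxEr (const_mx p.1 : 'rV[R]_1) p.2).
  exact: (measurableT_comp (measurable_rV_coord j) measurable_snd).
Qed.

Section step.
Context n (mu : {measure set 'rV[R]_n -> \bar R}).

Definition leb_cons : set 'rV[R]_n.+1 -> \bar R :=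
  pushforward (@lebesgue_measure R \x^ mu)%E (@rV_cons n).

Let mT A : measurable A -> measurable (@rV_cons n @^-1` A).
Proof. by move=> mA; rewrite -[X in measurable X]setTI; exact: measurable_rV_cons. Qed.

Let leb_cons0 : leb_cons set0 = 0%E.
Proof. by rewrite /leb_cons /pushforward preimage_set0 measure0. Qed.

Let leb_cons_ge0 A : (0 <= leb_cons A)%E.
Proof. by rewrite /leb_cons /pushforward measure_ge0. Qed.

Let leb_cons_sigma_additive : semi_sigma_additive leb_cons.
Proof.
move=> F mF tF mUF; rewrite /leb_cons /pushforward preimage_bigcup.
apply: measure_semi_sigma_additive.
- by move=> k; exact: mT.
- apply/trivIsetP => /= i j _ _ ij; rewrite -preimage_setI.
  by move/trivIsetP : tF => /(_ _ _ _ _ ij) ->//; rewrite preimage_set0.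
- by rewrite -preimage_bigcup; exact: mT.
Qed.

HB.instance Definition _ := isMeasure.Build _ _ _ leb_cons
  leb_cons0 leb_cons_ge0 leb_cons_sigma_additive.

End step.

Fixpoint leb n : {measure set 'rV[R]_n -> \bar R} :=
  if n is k.+1 then leb_cons (leb k) else dirac (0 : 'rV[R]_0).

End lebesgue_rV.

Section euclidean.
Context {R : realType} (n : nat).
Implicit Types u v : 'rV[R]_n.

Definition dotp u v : R := \sum_(i < n) u ord0 i * v ord0 i.

(* The library's norm `|u| on 'rV[R]_n is the sup norm. *)
Definition enorm u : R := Num.sqrt (dotp u u).

Definition partial (i : 'I_n) (phi : 'rV[R]_n -> R) : 'rV[R]_n -> R :=
  fun x => 'D_(delta_mx ord0 i) phi x.

Definition grad (phi : 'rV[R]_n -> R) (x : 'rV[R]_n) : 'rV[R]_n :=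
  \row_i partial i phi x.

Fixpoint Ck (k : nat) (phi : 'rV[R]_n -> R) : Prop :=
  continuous phi /\
  if k is j.+1 then
    forall i : 'I_n, (forall x, derivable phi x (delta_mx ord0 i)) /\
      Ck j (partial i phi)
  else True.

(* C_c^oo(Omega), its elements being extended by 0 to R^n *)
Definition test_function (Omega : set 'rV[R]_n) (phi : 'rV[R]_n -> R) : Prop :=
  [/\ forall k, Ck k phi,
      compact (closure [set x | phi x != 0]) &
      closure [set x | phi x != 0] `<=` Omega].

End euclidean.

(* Functions on Omega are total functions on R^n whose values outside Omega are
   irrelevant. *)
Section sobolev.
Context {R : realType} (n : nat) (p : R) (Omega : set 'rV[R]_n).
Implicit Types (u : 'rV[R]_n -> R) (g : 'rV[R]_n -> 'rV[R]_n).

Definition Lp u : Prop := u \_ Omega \in Lfun (leb n) p%:E.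

Definition weak_gradient u g : Prop :=
  (forall i, Lp (fun x => g x ord0 i)) /\
  forall phi, test_function Omega phi -> forall i,
    \int[leb n]_(x in Omega) (u x * partial i phi x) =
    - \int[leb n]_(x in Omega) (g x ord0 i * phi x).

Definition W1p u : Prop := Lp u /\ exists g, weak_gradient u g.

(* A weak gradient of u, chosen arbitrarily among those (they are almost
   everywhere equal); meaningful when u is in W^{1,p}(Omega). *)
Definition wgrad u : 'rV[R]_n -> 'rV[R]_n := get [set g | weak_gradient u g].

Definition W1p_norm u : \bar R :=
  ('N[leb n]_p%:E [EFin \o (u \_ Omega)] +
   \sum_(i < n) 'N[leb n]_p%:E [EFin \o ((fun x => wgrad u x ord0 i) \_ Omega)])%E.

Definition W1p0 u : Prop :=
  W1p u /\ forall eps : R, 0 < eps ->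
    exists2 phi, test_function Omega phi & (W1p_norm (fun x => u x - phi x)%R < eps%:E)%E.

(* - div (A (nabla u)) = rhs in Omega, u = 0 on the boundary *)
Definition weak_solution (A : 'rV[R]_n -> 'rV[R]_n) (rhs u : 'rV[R]_n -> R) :
    Prop :=
  W1p0 u /\ forall phi, W1p0 phi ->
    \int[leb n]_(x in Omega) dotp (A (wgrad u x)) (wgrad phi x) =
    \int[leb n]_(x in Omega) (rhs x * phi x).

Definition energy (G rhs u : 'rV[R]_n -> R) : R :=
  \int[leb n]_(x in Omega) (G (wgrad u x) `^ p / p - rhs x * u x).

End sobolev.

Section finsler.
Context {R : realType}.

Record finsler_norm n (H : 'rV[R]_n -> R) : Prop := FinslerNorm {
  finsler_ge0 : forall x, 0 <= H x;
  finsler_gt0 : forall x, x != 0 -> 0 < H x;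
  finsler_convex : convex_function [set: 'rV[R]_n] H;
  finsler_homogeneous : forall (t : R) x, H (t *: x) = `|t| * H x;
  finsler_differentiable : forall x, x != 0 -> differentiable H x;
  finsler_grad_continuous : forall x, x != 0 -> {for x, continuous (grad H)} }.

Definition flux n (p : R) (H : 'rV[R]_n -> R) (z : 'rV[R]_n) : 'rV[R]_n :=
  if z == 0 then 0 else H z `^ (p - 1) *: grad H z.

(* Since 0 `^ r = 0 for r != 0, the right-hand sides of (ii) and (iii) are 0 at
   z1 = z2 = 0. *)
Definition flux_bounds n (p : R) (H : 'rV[R]_n -> R) : Prop :=
  exists c1 c2 c3 : R, [/\ 0 < c1, 0 < c2, 0 < c3 &
  forall z1 z2 : 'rV[R]_n,
    [/\ 2 <= p ->
          c1 * enorm (z1 - z2) `^ p <=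
          dotp (flux p H z1 - flux p H z2) (z1 - z2),
        1 < p < 2 ->
          c2 * enorm (z1 - z2) ^+ 2 * (enorm z1 + enorm z2) `^ (p - 2) <=
          dotp (flux p H z1 - flux p H z2) (z1 - z2) &
        1 < p < 2 ->
          enorm (flux p H z1 - flux p H z2) <=
          c3 * enorm (z1 - z2) * (enorm z1 + enorm z2) `^ (p - 2)]].

End finsler.

Section cylinder.
Context {R : realType} (m k : nat).

(* R^n = R^m x R^(n-m) with k = n - m; X1 = lsubmx x and X2 = rsubmx x. *)

Definition dilate (l : R) (A : set 'rV[R]_m) : set 'rV[R]_m :=
  [set l *: X1 | X1 in A].

Definition cylinder (l : R) (omega1 : set 'rV[R]_m) (omega2 : set 'rV[R]_k) :
    set 'rV[R]_(m + k) :=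
  [set x | dilate l omega1 (lsubmx x) /\ omega2 (rsubmx x)].

(* The restriction of H to {0} x R^k, through which J_oo and the limit problem
   see H: nabla_2 w is (0, nabla w). *)
Definition crossH (H : 'rV[R]_(m + k) -> R) (z : 'rV[R]_k) : R :=
  H (row_mx 0 z).

(* H^(p-1)(0, z) nabla_{Z2} H(0, z) *)
Definition cross_flux (p : R) (H : 'rV[R]_(m + k) -> R) (z : 'rV[R]_k) :
    'rV[R]_k :=
  rsubmx (flux p H (row_mx 0 z)).

End cylinder.

(* Main.v *)
(* Lower bound. Convexity of z |-> H(z)^p / p bounds the energy of u_l from below
   by its tangent at the field (0, grad uoo). The flux of that field depends on X2
   only and, slice by slice, weakly solves the problem on the cylinder; testing it
   with u_l turns the tangent inequality into |l omega1| J_oo(uoo) <= J_l(u_l).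

   Upper bound. By minimality J_l(u_l) is at most the energy of rho(X1) phi(X2),
   where phi is a test function close to uoo and rho is a cutoff of l omega1, equal
   to 1 on (l-2) omega1, whose gradient is bounded independently of l. On
   (l-2) omega1 the energy density is that of phi; on the layer that remains, a
   fraction O(1/l) of l omega1 by Bernoulli's inequality, it is bounded by a
   function of X2 alone. For l <= 2 it suffices that J_l(u_l) <= 0. *)
Require Import Defs.
From HB Require Import structures.
From mathcomp Require Import all_boot all_order all_algebra ring lra.
From mathcomp Require Import all_classical all_reals all_analysis.
From mathcomp Require Import measurable_realfun.
Set Implicit Arguments.
Unset Strict Implicit.
Unset Printing Implicit Defensive.
Import Order.TTheory GRing.Theory Num.Theory.
Import numFieldNormedType.Exports.
Local Open Scope classical_set_scope.
Local Open Scope ring_scope.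

(** * Lebesgue measure on row vectors *)

Section rV_measure.
Context {R : realType}.

(** [W1p0] is a closure and [wgrad] an almost everywhere defined choice, so the competitor is built
    from a test function, whose product with the cutoff is differentiated classically. The price is
    an error of order e in the cross-sectional energy. The rate C/l survives because the constant
    controlling the layer does not depend on e: at fixed l, e is sent to 0. The tangent inequality
    for H^p/p combines the tangent inequality of H with Young's inequality for H(z) H(w)^(p-1). The
    transition layer of the cutoff must keep a bounded width: a rescaled profile rho(X1/l) would
    leave a layer filling a fixed fraction of l omega1. As the boundary of omega1 may have corners,
    the cutoff is a sum of lattice bumps; convexity, in the form s A + t A inside (s + t) A, keeps
    them between two dilates. *)

Lemma rV_consE0 n (t : R) (y : 'rV[R]_n) : rV_cons (t, y) ord0 ord0 = t.
Proof.
rewrite /rV_cons /= (_ : ord0 = lshift n ord0 :> 'I_(1 + n)); last exact/val_inj.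
by rewrite (row_mxEl (const_mx t : 'rV[R]_1) y) mxE.
Qed.

Lemma rV_consES n (t : R) (y : 'rV[R]_n) i :
  rV_cons (t, y) ord0 (lift ord0 i) = y ord0 i.
Proof.
rewrite /rV_cons /= (_ : lift ord0 i = rshift 1 i :> 'I_(1 + n)); last exact/val_inj.
by rewrite (row_mxEr (const_mx t : 'rV[R]_1) y).
Qed.

Definition rprod n (A : 'I_n -> set R) : set 'rV[R]_n :=
  [set x | forall i, A i (x ord0 i)].

Lemma measurable_rprod n (A : 'I_n -> set R) :
  (forall i, measurable (A i : set (measurableTypeR R))) -> measurable (rprod A).
Proof.
move=> mA; rewrite (_ : rprod A = \bigcap_(i in setT) ((fun x => x ord0 i) @^-1` A i)).
  apply: fin_bigcap_measurable => //.
  move=> i _; rewrite -[X in measurable X]setTI; exact: measurable_rV_coord.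
by apply/seteqP; split => [x Ax i _|x Ax i] /=; [exact: Ax|exact: (Ax i)].
Qed.

Lemma leb_consE n (A : set 'rV[R]_n.+1) :
  leb n.+1 A = (\int[leb n]_y lebesgue_measure (ysection (@rV_cons R n @^-1` A) y))%E.
Proof. by []. Qed.

(** Induction on n: over a tail y, the section of the preimage under [rV_cons] is [A ord0] if y lies
    in the product of the remaining factors and is empty otherwise, so the integral defining
    [leb n.+1] factors. *)
Lemma leb_rprod n (A : 'I_n -> set R) :
  (forall i, measurable (A i : set (measurableTypeR R))) ->
  leb n (rprod A) = (\prod_(i < n) lebesgue_measure (A i))%E.
Proof.
elim: n A => [|n IH] A mA.
  rewrite big_ord0 /= diracE (_ : _ \in _) //.
  by rewrite inE /rprod/= => -[].
rewrite big_ord_recl.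
rewrite -(IH (fun i => A (lift ord0 i))); last by move=> i; exact: mA.
rewrite [LHS]leb_consE.
have mB : measurable (rprod (fun i => A (lift ord0 i))) by exact: measurable_rprod.
transitivity (\int[leb n]_y (lebesgue_measure (A ord0) * (\1_(rprod (fun i => A (lift ord0 i))) y)%:E))%E.
  apply: eq_integral => y _.
  rewrite indicE /ysection; have [yB|yB] := boolP (y \in rprod _).
    rewrite mule1; congr lebesgue_measure; apply/seteqP; split => t /=.
      by rewrite inE /= => /(_ ord0); rewrite rV_consE0.
    move=> At; rewrite inE /= => i; case: (unliftP ord0 i) => [j ->|->].
      by rewrite rV_consES; move: yB; rewrite inE; apply.
    by rewrite rV_consE0.
  rewrite mule0 (_ : [set _ | _] = set0) ?measure0//.
  apply/seteqP; split => t //=; rewrite inE /= => tA.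
  move/negP : yB; apply; rewrite inE => i.
  by have := tA (lift ord0 i); rewrite rV_consES.
rewrite ge0_integralZl//=; first by rewrite integral_indic// setIT.
  by apply/measurable_EFinP; exact: measurable_indic.
Qed.

Definition obox n (a b : 'rV[R]_n) : set 'rV[R]_n :=
  rprod (fun i => `]a ord0 i, b ord0 i[%classic).

Lemma oboxP n (a b x : 'rV[R]_n) :
  obox a b x <-> forall i, a ord0 i < x ord0 i < b ord0 i.
Proof. by split => H i; move: (H i) => /=; rewrite in_itv. Qed.

Lemma measurable_obox n (a b : 'rV[R]_n) : measurable (obox a b).
Proof. by apply: measurable_rprod => i; exact: measurable_itv. Qed.

Lemma leb_obox n (a b : 'rV[R]_n) :
  leb n (obox a b) = (\prod_(i < n) Num.max 0 (b ord0 i - a ord0 i))%:E.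
Proof.
rewrite leb_rprod; last by move=> i; exact: measurable_itv.
rewrite -prodEFin; apply: eq_bigr => i _.
rewrite lebesgue_measure_itv/= lte_fin; case: ltP => ab.
  by rewrite -EFinB max_r// subr_ge0 ltW.
by rewrite max_l// subr_le0.
Qed.

Lemma leb_obox_lty n (a b : 'rV[R]_n) : (leb n (obox a b) < +oo)%E.
Proof. by rewrite leb_obox ltry. Qed.

Lemma obox_cover n :
  \bigcup_k obox (const_mx (- k%:R)) (const_mx k%:R) = [set: 'rV[R]_n].
Proof.
apply/seteqP; split => // x _.
exists (Num.trunc (\sum_i `|x ord0 i|)).+1 => //; apply/oboxP => i; rewrite !mxE -ltr_norml.
apply: le_lt_trans (truncnS_gt _).
by rewrite (bigD1 i)//= lerDl sumr_ge0.
Qed.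

Lemma leb_sigma_finite n : sigma_finite [set: 'rV[R]_n] (leb n).
Proof.
exists (fun k => obox (const_mx (- k%:R)) (const_mx k%:R)); first by rewrite obox_cover.
by move=> k; split; [exact: measurable_obox|exact: leb_obox_lty].
Qed.

Lemma obox_setI n (a1 b1 a2 b2 : 'rV[R]_n) : obox a1 b1 `&` obox a2 b2 =
  obox (\row_i Num.max (a1 ord0 i) (a2 ord0 i)) (\row_i Num.min (b1 ord0 i) (b2 ord0 i)).
Proof.
apply/seteqP; split => x.
  move=> [/oboxP h1 /oboxP h2]; apply/oboxP => i; rewrite !mxE gt_max lt_min.
  by move: (h1 i) (h2 i) => /andP[-> ->] /andP[-> ->].
move=> /oboxP h; split; apply/oboxP => i; move: (h i);
by rewrite !mxE gt_max lt_min => /andP[/andP[h1 h2] /andP[h3 h4]]; exact/andP.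
Qed.

Lemma obox_setI_closed n : setI_closed [set A | exists a b : 'rV[R]_n, A = obox a b].
Proof.
move=> _ _ [a1 [b1 ->]] [a2 [b2 ->]].
exists (\row_i Num.max (a1 ord0 i) (a2 ord0 i)), (\row_i Num.min (b1 ord0 i) (b2 ord0 i)).
exact: obox_setI.
Qed.

(** Uniqueness of measures needs a generating class stable under intersection. A coordinate
    half-space is a countable union of boxes: one lower face sits at t while all other faces recede
    to infinity. *)
Lemma measurable_rV_obox n :
  (@measurable _ 'rV[R]_n) = <<s [set A | exists a b : 'rV[R]_n, A = obox a b] >>.
Proof.
apply/seteqP; split; last first.
  apply: smallest_sub; first exact: sigma_algebra_measurable.
  by move=> _ [a [b ->]]; exact: measurable_obox.
set S := <<s _ >>.
have sS : sigma_algebra setT S by exact: smallest_sigma_algebra.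
apply: smallest_sub => //.
elim/big_ind : _ => [//|B C sB sC D [/sB//|/sC//]|i _ B [C mC <-] /=].
rewrite setTI.
pose T := [set C : set R | S ((fun x : 'rV[R]_n => x ord0 i) @^-1` C)].
suff : (@measurable _ (measurableTypeR R)) `<=` T by apply.
rewrite (_ : (@measurable _ (measurableTypeR R)) = <<s (@RGenOInfty.G R) >>); last exact: RGenOInfty.measurableE.
apply: smallest_sub.
  case: sS => S0 SC SU; split => /=.
  - by rewrite /T /= preimage_set0.
  - by move=> A; rewrite /T /= setTD preimage_setC -setTD => /SC.
  - by move=> F FT; rewrite /T /= preimage_bigcup; exact: SU.
move=> _ [t ->]; rewrite /T /=.
rewrite (_ : _ @^-1` _ = \bigcup_k obox (\row_j if j == i then t else - k%:R) (const_mx k%:R)).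
  case: (sS) => _ _; apply => k; apply: sub_sigma_algebra.
  by exists (\row_j if j == i then t else - k%:R), (const_mx k%:R).
apply/seteqP; split => x /=.
  rewrite in_itv /= andbT => tx.
  have : [set: 'rV[R]_n] x by [].
  rewrite -obox_cover => -[k _ /oboxP kx]; exists k => //; apply/oboxP => j.
  rewrite !mxE; move: (kx j); rewrite !mxE => /andP[h1 h2].
  by case: eqP => [ji|_]; rewrite ?h1 h2 // ji tx.
move=> [k _ /oboxP /(_ i)]; rewrite !mxE eqxx => /andP[tx _].
by rewrite in_itv /= andbT.
Qed.

(** It reduces the splitting of [leb] along [row_mx] and its scaling under dilation to volumes of
    boxes. *)
Lemma leb_obox_unique n (m1 m2 : {measure set 'rV[R]_n -> \bar R}) :
  (forall a b, m1 (obox a b) = m2 (obox a b)) ->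
  (forall a b, (m1 (obox a b) < +oo)%E) ->
  forall A, measurable A -> m1 A = m2 A.
Proof.
move=> m12 m1y; apply: (@measure_unique _ _ _ [set A | exists a b : 'rV[R]_n, A = obox a b]
  (fun k => obox (const_mx (- k%:R)) (const_mx k%:R))).
- exact: measurable_rV_obox.
- exact: obox_setI_closed.
- by move=> k; exists (const_mx (- k%:R)), (const_mx k%:R).
- exact: obox_cover.
- by move=> _ [a [b ->]].
- by move=> k.
Qed.

(** The closed box lies in [U], so that bumps supported in it will be test functions on [U];
    rational corners keep the family of boxes countable. *)
Lemma open_rational_obox n (U : set 'rV[R]_n) (x : 'rV[R]_n) : open U -> U x ->
  exists q : 'rV[rat]_n * 'rV[rat]_n,
   obox (map_mx ratr q.1) (map_mx ratr q.2) x /\ 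
   (forall y : 'rV[R]_n, (forall i, ratr (q.1 ord0 i) <= y ord0 i <= ratr (q.2 ord0 i)) -> U y).
Proof.
rewrite openE => oU /oU /nbhs_ballP[e /= e0 eU].
have lt1 i : x ord0 i - e / 2 < x ord0 i by rewrite ltrBlDr ltrDl divr_gt0.
have lt2 i : x ord0 i < x ord0 i + e / 2 by rewrite ltrDl divr_gt0.
exists (\row_i xchoose (rat_in_itvoo (lt1 i)), \row_i xchoose (rat_in_itvoo (lt2 i))); split.
  apply/oboxP => i; rewrite !mxE.
  have := xchooseP (rat_in_itvoo (lt1 i)); rewrite in_itv /= => /andP[_ ->].
  by have := xchooseP (rat_in_itvoo (lt2 i)); rewrite in_itv /= => /andP[-> _].
move=> y yq; apply: eU; split => // a i.
rewrite ord1 -ball_normE /=; move: (yq i); rewrite !mxE.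
have := xchooseP (rat_in_itvoo (lt1 i)); rewrite in_itv /= => /andP[].
have := xchooseP (rat_in_itvoo (lt2 i)); rewrite in_itv /= => /andP[].
move: (ratr _) (ratr _) => s t h1 h2 h3 h4 /andP[h5 h6].
rewrite ltr_norml; apply/andP; split; lra.
Qed.

Lemma open_bigcup_obox n (U : set 'rV[R]_n) : open U ->
  U = \bigcup_(q in [set q : 'rV[rat]_n * 'rV[rat]_n |
    (forall y : 'rV[R]_n, (forall i, ratr (q.1 ord0 i) <= y ord0 i <= ratr (q.2 ord0 i)) -> U y)])
   obox (map_mx ratr q.1) (map_mx ratr q.2).
Proof.
move=> oU; apply/seteqP; split => [x Ux|x [q /= qU /oboxP qx]].
  by have [q [qx qU]] := open_rational_obox oU Ux; exists q.
by apply: qU => i; have := qx i; rewrite !mxE => /andP[/ltW -> /ltW ->].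
Qed.

Lemma open_measurable_rV n (U : set 'rV[R]_n) : open U -> measurable U.
Proof.
move=> /open_bigcup_obox ->; rewrite bigcup_mkcond.
apply: countable_bigcupT_measurable; first exact: countableP.
by move=> q; case: ifPn => // _; exact: measurable_obox.
Qed.

(** Continuity is asked on an open set only, because the gradient of a Finsler norm is controlled
    away from the origin. *)
Lemma continuous_in_measurable_fun_rV n (D : set 'rV[R]_n) (f : 'rV[R]_n -> R) :
  open D -> (forall x, D x -> {for x, continuous f}) -> 
  measurable_fun D (f : _ -> measurableTypeR R).
Proof.
move=> oD cf; apply: (measurability _ (RGenOpens.measurableE R)).
move=> _ [_ [a [b ->] <-]]; apply: open_measurable_rV.
rewrite openE => x [Dx fx].
have h : nbhs (f x) `]a, b[%classic by apply: open_nbhs_nbhs; split => //; exact: interval_open.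
have := cf x Dx _ h.
move: oD; rewrite openE => /(_ _ Dx) oD h2.
exact: filterI.
Qed.

Lemma continuous_measurable_fun_rV n (f : 'rV[R]_n -> R) :
  continuous f -> measurable_fun setT (f : _ -> measurableTypeR R).
Proof.
move=> cf; apply: (@continuous_in_measurable_fun_rV n setT f) => [|x _]; last exact: cf.
exact: (@openT 'rV[R]_n).
Qed.


(** A copy of [leb n] under a name of its own, which carries the sigma-finite structure required by
    product measures and Fubini. *)
Definition sleb n : set 'rV[R]_n -> \bar R := leb n.
HB.instance Definition _ n := Measure.copy (@sleb n) (leb n).
HB.instance Definition _ n := @Measure_isSigmaFinite.Build _ _ _ (@sleb n) (@leb_sigma_finite n).

Lemma measurable_row_mx m k : measurable_fun setT (fun z : 'rV[R]_m * 'rV[R]_k => row_mx z.1 z.2).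
Proof.
apply: measurable_fun_rVP => i; case: (split_ordP i) => j ->.
- apply: (eq_measurable_fun (fun z : 'rV[R]_m * 'rV[R]_k => z.1 ord0 j)).
    by move=> z _; exact: (esym (row_mxEl z.1 z.2 _ _)).
  exact: (measurableT_comp (measurable_rV_coord j) measurable_fst).
- apply: (eq_measurable_fun (fun z : 'rV[R]_m * 'rV[R]_k => z.2 ord0 j)).
    by move=> z _; exact: (esym (row_mxEr z.1 z.2 _ _)).
  exact: (measurableT_comp (measurable_rV_coord j) measurable_snd).
Qed.

Lemma obox_row_mx m k (a b : 'rV[R]_(m + k)) :
  (fun z : 'rV[R]_m * 'rV[R]_k => row_mx z.1 z.2) @^-1` obox a b =
  obox (lsubmx a) (lsubmx b) `*` obox (rsubmx a) (rsubmx b).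
Proof.
apply/seteqP; split => -[x y] /=.
  move=> /oboxP h; split; apply/oboxP => i; rewrite !mxE.
    by have := h (lshift k i); rewrite row_mxEl.
  by have := h (rshift m i); rewrite row_mxEr.
move=> [/oboxP h1 /oboxP h2]; apply/oboxP => i; case: (split_ordP i) => j ->.
  by have := h1 j; rewrite row_mxEl !mxE.
by have := h2 j; rewrite row_mxEr !mxE.
Qed.

(** The preimage of a box under [row_mx] is a product of two boxes and the volume splits
    accordingly; [leb_obox_unique] passes from boxes to measurable sets. *)
Lemma leb_row_mx m k (A : set 'rV[R]_(m + k)) : measurable A ->
  leb (m + k) A = pushforward (@sleb m \x @sleb k)%E (fun z : 'rV[R]_m * 'rV[R]_k => row_mx z.1 z.2) A.
Proof.
have mr := @measurable_row_mx m k.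
move: A; apply: (@leb_obox_unique _ (leb (m + k)) _ _ (fun a b => leb_obox_lty a b)).
move=> a b; transitivity (leb m (obox (lsubmx a) (lsubmx b)) * leb k (obox (rsubmx a) (rsubmx b)))%E; last first.
  rewrite -[LHS](@product_measure1E _ _ _ _ R (@sleb m) (@sleb k)); try exact: measurable_obox.
  by rewrite -obox_row_mx.
rewrite !leb_obox -EFinM big_split_ord /=; congr (_ * _)%:E; 
  by apply: eq_bigr => i _; rewrite !mxE.
Qed.

(** Dilation by l is the preimage under x |-> l^-1 x, so both sides are measures in [A]; on boxes
    every side length is multiplied by l. *)
Lemma leb_dilate n (l : R) (A : set 'rV[R]_n) : 0 < l -> measurable A ->
  leb n (dilate l A) = ((l ^+ n)%:E * leb n A)%E.
Proof.
move=> l0 mA.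
have ms : measurable_fun setT (fun x : 'rV[R]_n => l^-1 *: x).
  apply: measurable_fun_rVP => i.
  apply: (eq_measurable_fun (fun x : 'rV[R]_n => l^-1 * x ord0 i)).
    by move=> x _; rewrite mxE.
  by apply: measurable_funM => //; exact: measurable_rV_coord.
have dE B : dilate l B = (fun x : 'rV[R]_n => l^-1 *: x) @^-1` B.
  apply/seteqP; split => x /=.
    by move=> [y By <-]; rewrite scalerA mulVf ?gt_eqF// scale1r.
  by move=> Bx; exists (l^-1 *: x) => //; rewrite scalerA mulfV ?gt_eqF// scale1r.
have ln0 : 0 <= l ^+ n by rewrite exprn_ge0// ltW.
rewrite dE.
apply/esym.
apply: (@leb_obox_unique n (mscale (NngNum ln0) (leb n)) (measure_function_pushforward__canonical__measure_function_Measure (leb n) ms)) => //.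
  move=> a b. rewrite /= /pushforward /mscale /=.
  rewrite (_ : _ @^-1` _ = obox (l *: a) (l *: b)).
    rewrite !leb_obox -EFinM; congr EFin.
    rewrite -[in l ^+ n](card_ord n) -prodr_const -big_split /=; apply: eq_bigr => i _.
    by rewrite !mxE -mulrBr maxr_pMr ?mulr0// ltW.
  apply/seteqP; split => x /= /oboxP h; apply/oboxP => i; move: (h i); rewrite !mxE;
    by rewrite ltr_pdivlMl// ltr_pdivrMl.
move=> a b. rewrite /= /mscale /=.
by rewrite leb_obox -EFinM ltry.
Qed.

End rV_measure.

(** * Smooth functions *)

Section smooth.
Context {R : realType} {n : nat}.
Implicit Types f g : 'rV[R]_n -> R.

Lemma Ck_continuous k f : Ck k f -> continuous f.
Proof. by case: k => [|k] []. Qed.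

Lemma Ck_prev k f : Ck k.+1 f -> Ck k f.
Proof.
elim: k f => [|k IH] f [cf df]; split => // i.
by have [d c] := df i; split => //; exact: IH.
Qed.

Lemma partial_cst i (c : R) : partial i (fun _ : 'rV[R]_n => c) = fun=> 0.
Proof. by apply/funext => x; rewrite /partial derive_cst. Qed.

Lemma Ck_cst k (c : R) : Ck k (fun _ : 'rV[R]_n => c).
Proof.
elim: k c => [|k IH] c; split => //; try exact: cst_continuous.
by move=> i; split; [move=> x; exact: derivable_cst|rewrite partial_cst; exact: IH].
Qed.

Lemma partialD i f g x : derivable f x (delta_mx ord0 i) -> derivable g x (delta_mx ord0 i) ->
  partial i (fun x => f x + g x) x = partial i f x + partial i g x.
Proof. exact: deriveD. Qed.

Lemma partialM i f g x : derivable f x (delta_mx ord0 i) -> derivable g x (delta_mx ord0 i) ->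
  partial i (fun x => f x * g x) x = f x * partial i g x + g x * partial i f x.
Proof. exact: deriveM. Qed.

Lemma Ck_derivable k f : Ck k.+1 f -> forall x i, derivable f x (delta_mx ord0 i).
Proof. by move=> [_ df] x i; have [] := df i. Qed.

Lemma Ck_partial k f i : Ck k.+1 f -> Ck k (partial i f).
Proof. by move=> [_ /(_ i)[]]. Qed.

Lemma CkD k f g : Ck k f -> Ck k g -> Ck k (fun x => f x + g x).
Proof.
elim: k f g => [|k IH] f g Cf Cg; split => //; try by
  move=> x; apply: (@continuousD _ _ _ f g x); [exact: (Ck_continuous Cf)|exact: (Ck_continuous Cg)].
move=> i; split; first by move=> x; apply: derivableD; [exact: (Ck_derivable Cf)|exact: (Ck_derivable Cg)].
rewrite (_ : partial i _ = fun x => partial i f x + partial i g x).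
  by apply: IH; exact: Ck_partial.
by apply/funext => x; rewrite partialD//; [exact: (Ck_derivable Cf)|exact: (Ck_derivable Cg)].
Qed.

Lemma CkM k f g : Ck k f -> Ck k g -> Ck k (fun x => f x * g x).
Proof.
elim: k f g => [|k IH] f g Cf Cg; split => //; try by
  move=> x; apply: (@continuousM _ _ f g x); [exact: (Ck_continuous Cf)|exact: (Ck_continuous Cg)].
move=> i; split; first by move=> x; apply: derivableM; [exact: (Ck_derivable Cf)|exact: (Ck_derivable Cg)].
rewrite (_ : partial i _ = fun x => f x * partial i g x + g x * partial i f x).
  by apply: CkD; apply: IH; first [exact: Ck_partial|exact: Ck_prev].
by apply/funext => x; rewrite partialM//; [exact: (Ck_derivable Cf)|exact: (Ck_derivable Cg)].
Qed.

Lemma CkV k f : (forall x, f x != 0) -> Ck k f -> Ck k (fun x => (f x)^-1).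
Proof.
elim: k f => [|k IH] f f0 Cf; split => //; try by
  move=> x; apply: (@continuousV _ _ f x) => //; exact: (Ck_continuous Cf).
move=> i; split; first by move=> x; apply: derivableV => //; exact: (Ck_derivable Cf).
rewrite (_ : partial i _ = fun x => (-1) * ((f x)^-1 * (f x)^-1) * partial i f x).
  apply: CkM; last exact: Ck_partial.
  by apply: CkM; [exact: Ck_cst|apply: CkM; apply: IH => //; exact: Ck_prev].
apply/funext => x; rewrite /partial deriveV//; last exact: (Ck_derivable Cf).
by rewrite /GRing.scale /= expr2 invfM mulN1r.
Qed.

Lemma Ck_sum (I : Type) (r : seq I) (P : pred I) k (F : I -> 'rV[R]_n -> R) :
  (forall i, P i -> Ck k (F i)) -> Ck k (fun x => \sum_(i <- r | P i) F i x).
Proof.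
move=> CF; elim: r => [|a r IH].
  rewrite (_ : (fun x => _) = fun=> 0); first exact: Ck_cst.
  by apply/funext => x; rewrite big_nil.
have [Pa|Pa] := boolP (P a); last first.
  rewrite (_ : (fun x => _) = fun x => \sum_(i <- r | P i) F i x)//.
  by apply/funext => x; rewrite big_cons (negPf Pa).
rewrite (_ : (fun x => _) = fun x => F a x + \sum_(i <- r | P i) F i x).
  by apply: CkD => //; exact: CF.
by apply/funext => x; rewrite big_cons Pa.
Qed.

Lemma Ck_prod (I : Type) (r : seq I) (P : pred I) k (F : I -> 'rV[R]_n -> R) :
  (forall i, P i -> Ck k (F i)) -> Ck k (fun x => \prod_(i <- r | P i) F i x).
Proof.
move=> CF; elim: r => [|a r IH].
  rewrite (_ : (fun x => _) = fun=> 1); first exact: Ck_cst.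
  by apply/funext => x; rewrite big_nil.
have [Pa|Pa] := boolP (P a); last first.
  rewrite (_ : (fun x => _) = fun x => \prod_(i <- r | P i) F i x)//.
  by apply/funext => x; rewrite big_cons (negPf Pa).
rewrite (_ : (fun x => _) = fun x => F a x * \prod_(i <- r | P i) F i x).
  by apply: CkM => //; exact: CF.
by apply/funext => x; rewrite big_cons Pa.
Qed.

(** For i != j the difference quotients along [delta_mx ord0 j] vanish identically; for i = j they
    are literally those of the one-variable function [g]. *)
Lemma is_derive_coord (g : R -> R) (i j : 'I_n) (x : 'rV[R]_n) (dg : R) :
  is_derive (x ord0 i) 1 g dg ->
  is_derive x (delta_mx ord0 j) (fun x => g (x ord0 i)) ((i == j)%:R * dg).
Proof.
move=> gd; have [ij|ij] := eqVneq i j; last first.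
  rewrite mul0r.
  have E : (fun h : R => h^-1 *: (((fun x : 'rV[R]_n => g (x ord0 i)) \o shift x) (h *: delta_mx ord0 j) - g (x ord0 i))) = fun=> 0.
    apply/funext => h /=; rewrite !mxE eqxx/= (negPf ij)/= mulr0 add0r subrr.
    exact: scaler0.
  apply: DeriveDef; first by rewrite /derivable E; exact: is_cvg_cst.
  by rewrite /derive E; exact: lim_cst.
rewrite mul1r.
have E : (fun h : R => h^-1 *: (((fun x : 'rV[R]_n => g (x ord0 i)) \o shift x) (h *: delta_mx ord0 j) - g (x ord0 i))) =
  (fun h : R => h^-1 *: ((g \o shift (x ord0 i)) (h *: 1) - g (x ord0 i))).
  by apply/funext => h /=; rewrite !mxE eqxx ij eqxx.
apply: DeriveDef; first by rewrite /derivable E; exact: (@ex_derive _ _ _ _ _ _ _ gd).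
rewrite -(@derive_val _ _ _ _ _ _ _ gd).
by rewrite /derive E.
Qed.
End smooth.

(** * A smooth step function built from exp(-1/t) *)

Section step.
Context {R : realType}.

(* The span of the functions t |-> p(1/t) exp(-1/t), extended by 0 to t <= 0,
   is stable under differentiation. *)
Definition flat (p : {poly R}) (t : R) : R :=
  if 0 < t then p.[t^-1] * expR (- t^-1) else 0.

(** exp y is the (N+1)-st power of exp(y/(N+1)), which is at least 1 + y/(N+1). *)
Lemma expR_ge_exprn (N : nat) (y : R) : 0 <= y -> (y / N.+1%:R) ^+ N.+1 <= expR y.
Proof.
move=> y0; have -> : expR y = expR (y / N.+1%:R) ^+ N.+1.
  by rewrite -expRM_natl mulrC divfK.
apply: lerXn2r; rewrite ?nnegrE ?expR_ge0 ?divr_ge0//.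
by apply: le_trans (expR_ge1Dx _); rewrite lerDr.
Qed.

Lemma horner_bound (p : {poly R}) : exists2 C, 0 <= C &
  forall y, 1 <= y -> `|p.[y]| <= C * y ^+ (size p).
Proof.
exists (\sum_(i < size p) `|p`_i|); first by rewrite sumr_ge0.
move=> y y1; rewrite horner_coef mulr_suml.
apply: le_trans (ler_norm_sum _ _ _) _; apply: ler_sum => i _.
rewrite normrM normrX (ger0_norm (le_trans ler01 y1)); apply: ler_wpM2l => //.
by apply: ler_weXn2l => //; exact: ltnW.
Qed.

(** With N = [size p], p(1/t) is O(t^-N) while exp(1/t) dominates a multiple of t^-(N+2). The two
    spare powers of t give differentiability at 0, with derivative 0. *)
Lemma flat_bound (p : {poly R}) : exists2 C, 0 <= C &
  forall t, t <= 1 -> `|flat p t| <= C * t ^+ 2.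
Proof.
have [C C0 pC] := horner_bound p; set N := size p in pC *.
exists (C * N.+2%:R ^+ N.+2) => [|t t1]; first by rewrite mulr_ge0.
rewrite /flat; case: ltP => [t0|_]; last first.
  by rewrite normr0 mulr_ge0// ?sqr_ge0// mulr_ge0.
have y1 : 1 <= t^-1 by rewrite invf_ge1.
have y0 : 0 < t^-1 by rewrite invr_gt0.
rewrite normrM (ger0_norm (expR_ge0 _)) expRN.
apply: (@le_trans _ _ (C * t^-1 ^+ N * (expR t^-1)^-1)).
  by apply: ler_wpM2r; rewrite ?invr_ge0 ?expR_ge0 ?pC.
rewrite ler_pdivrMr ?expR_gt0//.
apply: (@le_trans _ _ (C * N.+2%:R ^+ N.+2 * t ^+ 2 * (t^-1 / N.+2%:R) ^+ N.+2)); last first.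
  apply: ler_wpM2l; first by rewrite mulr_ge0// ?sqr_ge0// mulr_ge0.
  exact: expR_ge_exprn (ltW y0).
have tN : t ^+ N != 0 by rewrite expf_neq0// gt_eqF.
have t2 : t ^+ 2 != 0 by rewrite expf_neq0// gt_eqF.
have nN : (N.+2%:R : R) ^+ N.+2 != 0 by rewrite expf_neq0.
have tE : t ^+ N.+2 = t ^+ N * t ^+ 2 by rewrite -exprD addn2.
rewrite expr_div_n !exprVn tE.
move: (t ^+ N) (t ^+ 2) (_ ^+ N.+2) tN t2 nN => a b c a0 b0 c0.
by rewrite le_eqVlt; apply/orP; left; apply/eqP; field; rewrite a0 b0 c0.
Qed.

Lemma flat_le0 (p : {poly R}) (t : R) : t <= 0 -> flat p t = 0.
Proof. by rewrite /flat ltNge => ->. Qed.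

(** For t > 0 the chain rule gives t^-2 (p(1/t) - p'(1/t)) exp(-1/t), whose polynomial is X^2 (p -
    p'). At 0 the difference quotients are O(|h|) by [flat_bound]. *)
Lemma is_derive_flat (p : {poly R}) (t : R) :
  is_derive t 1 (flat p) (flat ('X^2 * (p - p^`())) t).
Proof.
have [t0|t0|->] := ltgtP t 0.
- rewrite flat_le0; last exact: ltW.
  apply: (@near_eq_is_derive _ _ _ (cst 0) (flat p) t 1 0 _ (is_derive_cst _ _ _)).
  near=> s; rewrite flat_le0//.
  by near: s; exact: lt_le_nbhsl.
- pose g := fun s : R => p.[s^-1] * expR (- s^-1).
  apply: (@near_eq_is_derive _ _ _ g).
    near=> s; rewrite /flat ifT//.
    by near: s; exact: lt_nbhsr.
  have t_neq0 : t != 0 by rewrite gt_eqF.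
  have dV : is_derive t 1 (fun s : R => s^-1) (- t ^- 2).
    by apply: is_derive_eq; first exact: is_deriveV; rewrite /GRing.scale/= mulr1.
  have d1 : is_derive t 1 (fun s : R => p.[s^-1]) (p^`().[t^-1] * (- t ^- 2)).
    exact: (@is_derive1_comp _ (horner p) (fun s => s^-1)).
  have d2 : is_derive t 1 (fun s : R => expR (- s^-1)) (expR (- t^-1) * t ^- 2).
    have dN : is_derive t 1 (fun s : R => - s^-1) (t ^- 2).
      by rewrite -[X in is_derive _ _ _ X]opprK; exact: (@is_deriveN _ _ _ (fun s : R => s^-1)).
    exact: (@is_derive1_comp _ expR (fun s => - s^-1) t _ _ (is_derive_expR _) dN).
  have := @is_deriveM _ _ (fun s : R => p.[s^-1]) (fun s : R => expR (- s^-1)) t 1 _ _ d1 d2.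
  move/is_derive_eq; apply.
  rewrite /flat t0 !hornerE /GRing.scale /= exprVn.
  ring.
- rewrite flat_le0//.
  have [C C0 pC] := flat_bound p.
  have E : (fun h : R => h^-1 *: ((flat p \o shift 0) (h *: 1) - flat p 0)) @ 0^' --> 0.
    apply/cvgrPdist_lt => e e0; near=> h.
    rewrite sub0r normrN /= addr0 [h *: 1]mulr1 (flat_le0 p (lexx 0)) subr0 /GRing.scale /=.
    have h0 : h != 0 by near: h; exact: nbhs_dnbhs_neq.
    have he : `|h| < e / (C + 1) by near: h; apply: dnbhs0_lt; rewrite divr_gt0// ltr_wpDl.
    have h1 : h <= 1 by apply: le_trans (ler_norm _) _; near: h; apply: dnbhs0_le.
    rewrite normrM normfV -ltr_pdivlMl ?invrK ?invr_gt0 ?normr_gt0//.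
    apply: le_lt_trans (pC h h1) _; rewrite -real_normK ?num_real// expr2 mulrCA.
    rewrite ltr_pM2l ?normr_gt0//.
    move: he; rewrite ltr_pdivlMr ?ltr_wpDl// mulrDr mulr1 mulrC => he.
    by apply: le_lt_trans he; rewrite lerDl.
  apply: DeriveDef; first by apply/cvg_ex; exists 0.
  by apply/cvg_lim.
Unshelve. all: by end_near.
Qed.

Lemma continuous_flat (p : {poly R}) : continuous (flat p).
Proof.
move=> t; apply: differentiable_continuous; apply/derivable1_diffP.
exact: (@ex_derive _ _ _ _ _ _ _ (is_derive_flat p t)).
Qed.

Lemma flat1_gt0 (t : R) : 0 < t -> 0 < flat 1 t.
Proof. by move=> t0; rewrite /flat t0 hornerC mul1r expR_gt0. Qed.

Lemma flat1_ge0 (t : R) : 0 <= flat 1 t.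
Proof. by rewrite /flat; case: ifPn => // _; rewrite hornerC mul1r expR_ge0. Qed.

Lemma flat1_homo (s t : R) : s <= t -> flat 1 s <= flat 1 t.
Proof.
move=> st; have [s0|s0] := leP s 0; first by rewrite flat_le0// flat1_ge0.
have t0 := lt_le_trans s0 st.
by rewrite /flat s0 t0 !hornerC !mul1r ler_expR lerN2 lef_pV2.
Qed.

Definition smoothstep (t : R) : R := flat 1 t / (flat 1 t + flat 1 (1 - t)).

(** t and 1 - t are never both nonpositive. *)
Lemma smoothstep_den (t : R) : 0 < flat 1 t + flat 1 (1 - t).
Proof.
have [t0|t0] := ltP 0 t; first by apply: ltr_pwDl; [exact: flat1_gt0|exact: flat1_ge0].
apply: ltr_wpDl; [exact: flat1_ge0|apply: flat1_gt0].
by rewrite subr_gt0 (le_lt_trans t0).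
Qed.

Lemma smoothstep_le0 (t : R) : t <= 0 -> smoothstep t = 0.
Proof. by move=> t0; rewrite /smoothstep flat_le0// mul0r. Qed.

Lemma smoothstep_ge1 (t : R) : 1 <= t -> smoothstep t = 1.
Proof.
move=> t1; rewrite /smoothstep (@flat_le0 _ (1 - t)) ?subr_le0// addr0 divff//.
by rewrite gt_eqF// flat1_gt0// (lt_le_trans ltr01).
Qed.

Lemma smoothstep_homo (s t : R) : s <= t -> smoothstep s <= smoothstep t.
Proof.
move=> st; rewrite /smoothstep ler_pdivrMr ?smoothstep_den// mulrAC ler_pdivlMr ?smoothstep_den//.
rewrite !mulrDr [flat 1 t * _]mulrC lerD2l.
by apply: ler_pM; rewrite ?flat1_ge0 ?flat1_homo// lerD2l lerN2.
Qed.

Lemma smoothstep_ge0 (t : R) : 0 <= smoothstep t.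
Proof. by rewrite /smoothstep divr_ge0 ?flat1_ge0// ltW// smoothstep_den. Qed.

Lemma smoothstep_le1 (t : R) : smoothstep t <= 1.
Proof. by rewrite /smoothstep ler_pdivrMr ?smoothstep_den// mul1r lerDl flat1_ge0. Qed.

(** A continuous derivative that vanishes outside ]0, 1[ is bounded; this bound is the source of the
    gradient bound of the cutoffs. *)
Lemma smoothstep_derive : exists S' : R -> R, [/\ continuous S',
  forall t : R, is_derive t 1 smoothstep (S' t) & forall t, t <= 0 \/ 1 <= t -> S' t = 0].
Proof.
pose A := flat (1 : {poly R}); pose B := fun t : R => flat 1 (1 - t).
pose A' := flat ('X^2 * (1 - (1 : {poly R})^`())); pose B' := fun t : R => - A' (1 - t).
have dA (t : R) : is_derive t 1 A (A' t) by exact: is_derive_flat.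
have dB (t : R) : is_derive t 1 B (B' t).
  have d1 : is_derive t 1 (fun s : R => 1 - s) (- 1).
    have := @is_deriveB R R R (cst 1) id t 1 _ _ (is_derive_cst _ _ _) (is_derive_id _ _).
    by move/is_derive_eq; apply; rewrite sub0r.
  have := @is_derive1_comp _ A (fun s => 1 - s) t _ _ (dA _) d1.
  by move/is_derive_eq; apply; rewrite mulrN1.
have cA : continuous A by exact: continuous_flat.
have c1 (g : R -> R) : continuous g -> continuous (fun t : R => g (1 - t)).
  move=> cg t; apply: (@continuous_comp _ _ _ (fun t : R => 1 - t) g); last exact: cg.
  by apply: (@continuousB R R R (cst 1) id t); [exact: cst_continuous|exact: cvg_id].
have cB : continuous B by exact: c1.
have cA' : continuous A' by exact: continuous_flat.
have cB' : continuous B'.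
  by move=> t; apply: (@continuousN _ _ _ (fun t : R => A' (1 - t)) t); exact: c1.
exists (fun t : R => A t * - ((A t + B t) ^- 2 * (A' t + B' t)) + (A t + B t)^-1 * A' t); split.
- have cAB t : {for t, continuous (fun t : R => (A t + B t)^-1)}.
    apply: (@continuousV _ _ (fun t : R => A t + B t) t); first by rewrite gt_eqF// smoothstep_den.
    exact: (@continuousD _ _ _ A B t (cA t) (cB t)).
  move=> t.
  apply: (@continuousD _ _ _ (fun t : R => A t * - ((A t + B t) ^- 2 * (A' t + B' t))) (fun t : R => (A t + B t)^-1 * A' t) t); last first.
    by apply: (@continuousM _ _ (fun t : R => (A t + B t)^-1) A' t) => //; exact: cA'.
  apply: (@continuousM _ _ A (fun t : R => - ((A t + B t) ^- 2 * (A' t + B' t))) t); first exact: cA.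
  apply: (@continuousN _ _ _ (fun t : R => (A t + B t) ^- 2 * (A' t + B' t)) t).
  apply: (@continuousM _ _ (fun t : R => (A t + B t) ^- 2) (fun t : R => A' t + B' t) t); last first.
    exact: (@continuousD _ _ _ A' B' t (cA' t) (cB' t)).
  rewrite (_ : (fun t : R => _ ^- 2) = (fun t : R => (A t + B t)^-1 * (A t + B t)^-1)).
    exact: (@continuousM _ _ (fun t : R => (A t + B t)^-1) (fun t : R => (A t + B t)^-1) t).
  by apply/funext => s; rewrite expr2 invfM.
- move=> t.
have AB0 : A t + B t != 0 by rewrite gt_eqF// smoothstep_den.
have dV := @is_deriveV _ (fun t : R => A t + B t) t _ 1 AB0 (@is_deriveD _ _ _ A B t 1 _ _ (dA t) (dB t)).
have := @is_deriveM _ _ A (fun t : R => (A t + B t)^-1) t 1 _ _ (dA t) dV.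
move/is_derive_eq; apply.
  by rewrite /GRing.scale /= mulNr.
- move=> t [t0|t1].
    by rewrite /A /A' !(flat_le0 _ t0) mul0r mulr0 addr0.
  have Bt : B t = 0 by rewrite /B flat_le0// subr_le0.
  have B't : B' t = 0 by rewrite /B' /A' flat_le0 ?oppr0// subr_le0.
  have At : A t != 0 by rewrite gt_eqF// /A flat1_gt0// (lt_le_trans ltr01).
  by rewrite Bt B't !addr0; field.
Qed.

(** The induction on k runs over all polynomials at once, since differentiation replaces p by X^2 (p
    - p'). *)
Lemma Ck_flat_coord n (p : {poly R}) (a b : R) (i : 'I_n) k :
  Ck k (fun x : 'rV[R]_n => flat p (a * x ord0 i + b)).
Proof.
have ax (t : R) : is_derive t 1 (fun t : R => a * t + b) a.
  have dM := @is_deriveM _ _ (cst a) id t 1 _ _ (is_derive_cst _ _ _) (is_derive_id _ _).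
  have := @is_deriveD _ _ _ _ (cst b) t 1 _ _ dM (is_derive_cst _ _ _).
  by move/is_derive_eq; apply; rewrite addr0 /GRing.scale /= mulr0 addr0 mulr1.
have cF q : continuous (fun x : 'rV[R]_n => flat q (a * x ord0 i + b)).
  move=> x; apply: (@continuous_comp _ _ _ (fun x : 'rV[R]_n => a * x ord0 i + b) (flat q)); last exact: continuous_flat.
  apply: (@continuousD _ _ _ (fun x : 'rV[R]_n => a * x ord0 i) (cst b)); last exact: cst_continuous.
  apply: (@continuousM _ _ (cst a) (fun x : 'rV[R]_n => x ord0 i)); first exact: cst_continuous.
  exact: coord_continuous.
elim: k p => [|k IH] p; split => //; try exact: cF.
move=> j.
have d (x : 'rV[R]_n) := @is_derive_coord R n (fun t : R => flat p (a * t + b)) i j x _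
  (@is_derive1_comp _ (flat p) (fun t : R => a * t + b) (x ord0 i) _ _ (is_derive_flat p _) (ax _)).
split; first by move=> x; exact: (@ex_derive _ _ _ _ _ _ _ (d x)).
rewrite (_ : partial j _ = fun x => (i == j)%:R * (flat ('X^2 * (p - p^`())) (a * x ord0 i + b) * a)).
  by apply: CkM; [exact: Ck_cst|apply: CkM; [exact: IH|exact: Ck_cst]].
by apply/funext => x; exact: (@derive_val _ _ _ _ _ _ _ (d x)).
Qed.

Lemma Ck_smoothstep_coord n (a b : R) (i : 'I_n) k :
  Ck k (fun x : 'rV[R]_n => smoothstep (a * x ord0 i + b)).
Proof.
rewrite /smoothstep; apply: CkM; first exact: Ck_flat_coord.
apply: CkV; first by move=> x; rewrite gt_eqF// smoothstep_den.
apply: CkD; first exact: Ck_flat_coord.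
rewrite (_ : (fun x => _) = fun x : 'rV[R]_n => flat 1 (- a * x ord0 i + (1 - b))).
  exact: Ck_flat_coord.
by apply/funext => x; congr flat; ring.
Qed.

End step.

(** * Fubini and integration by parts *)

Section fubini_image.
Context {R : realType} d1 d2 d (T1 : measurableType d1) (T2 : measurableType d2)
  (T : measurableType d).
Variables (m1 : {sigma_finite_measure set T1 -> \bar R})
  (m2 : {sigma_finite_measure set T2 -> \bar R}) (mu : {measure set T -> \bar R}).
Variables (phi : T1 * T2 -> T) (mphi : measurable_fun setT phi).
Hypothesis muE : forall A, measurable A -> mu A = (m1 \x m2)%E (phi @^-1` A).

(** The measure is any image of a product measure, so that the section serves both [rV_cons], which
    peels off one coordinate, and [row_mx], which separates X1 from X2. *)
Lemma ge0_integral_prod_image (f : T -> \bar R) :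
  measurable_fun setT f -> (forall x, 0 <= f x)%E ->
  (\int[mu]_z f z = \int[m1]_x \int[m2]_y f (phi (x, y)))%E.
Proof.
move=> mf f0.
rewrite (eq_measure_integral (measure_function_pushforward__canonical__measure_function_Measure
  (m1 \x m2)%E mphi)); last by move=> A mA _; exact: muE.
rewrite (ge0_integral_pushforward mphi)// preimage_setT.
rewrite (@fubini_tonelli1 _ _ _ _ R m1 m2 (f \o phi))//.
  by apply: measurableT_comp.
by move=> x; exact: f0.
Qed.

Lemma integral_prod_image (f : T -> \bar R) : mu.-integrable setT f ->
  [/\ (\int[mu]_z f z = \int[m1]_x \int[m2]_y f (phi (x, y)))%E,
   (\int[mu]_z f z = \int[m2]_y \int[m1]_x f (phi (x, y)))%E &
   (m1 \x m2)%E.-integrable setT (f \o phi)].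
Proof.
move=> fi; have mf := measurable_int _ fi.
have fphi : (m1 \x m2)%E.-integrable setT (f \o phi).
  apply/integrableP; split; first exact: measurableT_comp.
  have /integrableP[_] := fi.
  rewrite ge0_integral_prod_image//; last exact: measurableT_comp.
  rewrite (@fubini_tonelli1 _ _ _ _ R m1 m2 (fun z => `|(f \o phi) z|)%E)//.
  by apply: measurableT_comp => //; exact: measurableT_comp.
have E : (\int[mu]_z f z = \int[(m1 \x m2)%E]_z (f \o phi) z)%E.
  rewrite (eq_measure_integral (measure_function_pushforward__canonical__measure_function_Measure
    (m1 \x m2)%E mphi)); last by move=> A mA _; exact: muE.
  by rewrite (integral_pushforward mphi)// preimage_setT.
split => //; rewrite E; first by rewrite -integral12_prod_meas1.
by rewrite -integral21_prod_meas1.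
Qed.
End fubini_image.

Section integrals.
Context {R : realType}.

Lemma leb_row_mxE m k (A : set 'rV[R]_(m + k)) : measurable A ->
  leb (m + k) A = (@sleb R m \x @sleb R k)%E ((fun z : 'rV[R]_m * 'rV[R]_k => row_mx z.1 z.2) @^-1` A).
Proof. exact: leb_row_mx. Qed.

Lemma leb_consE' n (A : set 'rV[R]_n.+1) : measurable A ->
  leb n.+1 A = (@lebesgue_measure R \x @sleb R n)%E (@rV_cons R n @^-1` A).
Proof.
move=> mA; apply/esym; apply: product_measure_unique; last first.
  by rewrite -[X in measurable X]setTI; exact: measurable_rV_cons.
move=> B C mB mC; exact: product_measure2E.
Qed.

(** The two difference quotients are the same function of h. Derivatives of slices and of functions
    of X1 or X2 alone are read off from this. *)
Lemma derive_affine (V W : normedModType R) (f : W -> R) (a : V -> W) (v : V) (w : W) (y : V) :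
  (forall (h : R), a (h *: v + y) = h *: w + a y) ->
  'D_v (f \o a) y = 'D_w f (a y) /\ (derivable f (a y) w -> derivable (f \o a) y v).
Proof.
move=> aE.
have E : (fun h : R => h^-1 *: (((f \o a) \o shift y) (h *: v) - (f \o a) y)) =
  (fun h : R => h^-1 *: ((f \o shift (a y)) (h *: w) - f (a y))).
  by apply/funext => h /=; rewrite aE.
by split; [rewrite /derive E|rewrite /derivable E].
Qed.

Lemma rV_cons_shift0 n (t h : R) (y : 'rV[R]_n) :
  rV_cons (h *: 1 + t, y) = h *: delta_mx ord0 ord0 + rV_cons (t, y).
Proof.
apply/rowP => i; rewrite [RHS]mxE [X in _ = X + _]mxE.
case: (unliftP ord0 i) => [j ->|->].
  by rewrite !rV_consES mxE mulr0 add0r.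
by rewrite !rV_consE0 mxE mulr1 /GRing.scale /= mulr1.
Qed.

Lemma rV_cons_shiftS n (t h : R) (y : 'rV[R]_n) j :
  rV_cons (t, h *: delta_mx ord0 j + y) = h *: delta_mx ord0 (lift ord0 j) + rV_cons (t, y).
Proof.
apply/rowP => i; rewrite [RHS]mxE [X in _ = X + _]mxE.
case: (unliftP ord0 i) => [l ->|->].
  by rewrite !rV_consES !mxE eqxx /= (inj_eq lift_inj).
by rewrite !rV_consE0 mxE /= mulr0 add0r.
Qed.

Lemma row_mx_shiftl m k (h : R) (x : 'rV[R]_m) (y : 'rV[R]_k) j :
  row_mx (h *: delta_mx ord0 j + x) y = h *: delta_mx ord0 (lshift k j) + row_mx x y.
Proof.
apply/rowP => i; rewrite [RHS]mxE [X in _ = X + _]mxE; case: (split_ordP i) => l ->.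
  by rewrite !row_mxEl !mxE (inj_eq (@lshift_inj _ _)).
by rewrite !row_mxEr !mxE eq_rlshift andbF mulr0 add0r.
Qed.

Lemma row_mx_shiftr m k (h : R) (x : 'rV[R]_m) (y : 'rV[R]_k) j :
  row_mx x (h *: delta_mx ord0 j + y) = h *: delta_mx ord0 (rshift m j) + row_mx x y.
Proof.
apply/rowP => i; rewrite [RHS]mxE [X in _ = X + _]mxE; case: (split_ordP i) => l ->.
  by rewrite !row_mxEl !mxE eq_lrshift andbF mulr0 add0r.
by rewrite !row_mxEr !mxE (inj_eq (@rshift_inj _ _)).
Qed.

Lemma continuous_rV (T : topologicalType) n (a : T -> 'rV[R]_n) :
  (forall i, continuous (fun x => a x ord0 i)) -> continuous a.
Proof.
move=> ca x B /nbhs_ballP[e /= e0 eB].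
have h := @filter_forall _ _ (fun i => [set y | `|a x ord0 i - a y ord0 i| < e]) (nbhs x) _
  (fun i => @cvgr_dist_lt _ _ _ _ _ _ _ (ca i x) e e0).
have sB : [set y | forall i, `|a x ord0 i - a y ord0 i| < e] `<=` a @^-1` B; last first.
  exact: (@filterS _ (nbhs x) _ _ _ sB (h (nbhs_filter x) (nbhs_filter x))).
move=> y ya; apply: eB; split => // l i; rewrite ord1 -ball_normE /=; exact: ya.
Qed.

Lemma continuous_rV_consl n (y : 'rV[R]_n) : continuous (fun t : R => rV_cons (t, y)).
Proof.
apply: continuous_rV => i; case: (unliftP ord0 i) => [j ->|->].
  rewrite (_ : (fun t => _) = cst (y ord0 j)); first exact: cst_continuous.
  by apply/funext => t; rewrite rV_consES.
rewrite (_ : (fun t => _) = (id : R -> R)); first by move=> t; exact: cvg_id.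
by apply/funext => t; rewrite rV_consE0.
Qed.

Lemma continuous_rV_consr n (t : R) : continuous (fun y : 'rV[R]_n => rV_cons (t, y)).
Proof.
apply: continuous_rV => i; case: (unliftP ord0 i) => [j ->|->].
  rewrite (_ : (fun y => _) = fun y : 'rV[R]_n => y ord0 j); first exact: coord_continuous.
  by apply/funext => y; rewrite rV_consES.
rewrite (_ : (fun t => _) = cst t); first exact: cst_continuous.
by apply/funext => y; rewrite rV_consE0.
Qed.

Lemma continuous_row_mxl m k (y : 'rV[R]_k) : continuous (fun x : 'rV[R]_m => row_mx x y).
Proof.
apply: continuous_rV => i; case: (split_ordP i) => j ->.
  rewrite (_ : (fun x => _) = fun x : 'rV[R]_m => x ord0 j); first exact: coord_continuous.
  by apply/funext => x; rewrite row_mxEl.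
rewrite (_ : (fun t => _) = cst (y ord0 j)); first exact: cst_continuous.
by apply/funext => x; rewrite row_mxEr.
Qed.

Lemma continuous_row_mxr m k (x : 'rV[R]_m) : continuous (fun y : 'rV[R]_k => row_mx x y).
Proof.
apply: continuous_rV => i; case: (split_ordP i) => j ->.
  rewrite (_ : (fun t => _) = cst (x ord0 j)); first exact: cst_continuous.
  by apply/funext => y; rewrite row_mxEl.
rewrite (_ : (fun y => _) = fun y : 'rV[R]_k => y ord0 j); first exact: coord_continuous.
by apply/funext => y; rewrite row_mxEr.
Qed.

Lemma continuous_lsubmx m k : continuous (fun x : 'rV[R]_(m + k) => lsubmx x).
Proof.
apply: continuous_rV => i.
rewrite (_ : (fun x => _) = fun x : 'rV[R]_(m + k) => x ord0 (lshift k i)).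
  exact: coord_continuous.
by apply/funext => x; rewrite mxE.
Qed.

Lemma continuous_rsubmx m k : continuous (fun x : 'rV[R]_(m + k) => rsubmx x).
Proof.
apply: continuous_rV => i.
rewrite (_ : (fun x => _) = fun x : 'rV[R]_(m + k) => x ord0 (rshift m i)).
  exact: coord_continuous.
by apply/funext => x; rewrite mxE.
Qed.

Lemma ler_coord n (x : 'rV[R]_n) i : `|x ord0 i| <= `|x|.
Proof.
rewrite [leRHS]/Num.Def.normr /= mx_normrE.
exact: (@le_bigmax _ _ _ 0 (fun ij : 'I_1 * 'I_n => `|x ij.1 ij.2|) (ord0, i)).
Qed.

Lemma bounded_rV n (A : set 'rV[R]_n) : bounded_set A ->
  exists2 M, 0 < M & forall x, A x -> forall i, `|x ord0 i| < M.
Proof.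
case=> M [_ /(_ (`|M| + 1)) AM]; exists (`|M| + 2); first by rewrite ltr_wpDl.
move=> x Ax i; have /AM/(_ x Ax) /= : M < `|M| + 1.
  by rewrite (le_lt_trans (ler_norm _))// ltrDl.
move=> h; apply: le_lt_trans (ler_coord _ _) _; apply: le_lt_trans h _.
by rewrite ltrD2l ltrDr.
Qed.

Definition cbox n (M : R) : set 'rV[R]_n := [set x | forall i, - M <= x ord0 i <= M].

Lemma compact_cbox n M : compact (@cbox n M).
Proof.
have := @rV_compact R n (fun=> `[- M, M]%classic) (fun=> @segment_compact R _ _).
by congr compact; apply/seteqP; split => x xM i; have := xM i; rewrite /= in_itv.
Qed.

Lemma continuous_bounded_cbox n (f : 'rV[R]_n -> R) (M : R) : continuous f ->
  exists2 C, 0 <= C & forall x, cbox M x -> `|f x| <= C.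
Proof.
move=> cf; have := @continuous_compact _ _ f (cbox M) _ (@compact_cbox n M).
move=> /(_ (continuous_subspaceT cf)) /compact_bounded[C [_ /(_ (`|C| + 1)) fC]].
exists (`|C| + 1) => [|x Mx]; first by rewrite addr_ge0.
apply: fC; last by exists x.
by rewrite (le_lt_trans (ler_norm _))// ltrDl.
Qed.

Lemma continuous_bounded_support n (f : 'rV[R]_n -> R) (M : R) : continuous f ->
  (forall (x : 'rV[R]_n) i, M <= `|x ord0 i| -> f x = 0) -> exists2 C, 0 <= C & forall x, `|f x| <= C.
Proof.
move=> cf f0; have [C C0 fC] := @continuous_bounded_cbox n f M cf.
exists C => // x; have [Mx|] := pselect (cbox M x); first exact: fC.
move=> /existsNP[i /negP]; rewrite -ler_norml -ltNge => /ltW /f0 ->.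
by rewrite normr0.
Qed.

Lemma compact_support_integrable n (f : 'rV[R]_n -> R) (M : R) : continuous f ->
  (forall (x : 'rV[R]_n) i, M <= `|x ord0 i| -> f x = 0) -> (leb n).-integrable setT (EFin \o f).
Proof.
move=> cf f0; have [C C0 fC] := continuous_bounded_support cf f0.
have mB : measurable (obox (const_mx (- M)) (const_mx M : 'rV[R]_n)) by exact: measurable_obox.
apply: (@le_integrable _ _ _ _ _ measurableT _ (EFin \o (fun x => C * \1_(obox (const_mx (- M)) (const_mx M)) x))).
- by apply/measurable_EFinP; exact: continuous_measurable_fun_rV.
- move=> x _ /=; rewrite lee_fin indicE; case: (boolP (x \in _)) => [_|].
    by rewrite mulr1 (ger0_norm C0).
  rewrite mulr0 normr0 notin_setE => /oboxP /existsNP[i].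
  by rewrite !mxE => /negP; rewrite -ltr_norml -leNgt => /f0 ->; rewrite normr0.
- apply: (@integrableZl _ _ _ _ _ _ C (EFin \o \1_(obox (const_mx (- M)) (const_mx M)))) => //.
  apply/integrableP; split; first by apply/measurable_EFinP; exact: measurable_indic.
  rewrite (eq_integral (EFin \o \1_(obox (const_mx (- M)) (const_mx M)))).
    by rewrite integral_indic// setIT leb_obox_lty.
  by move=> x _ /=; rewrite ger0_norm.
Qed.

(** The fundamental theorem of calculus on an interval outside which [F] and [F'] vanish. *)
Lemma integral_derive0 (F F' : R -> R) (M : R) : continuous F' ->
  (forall t : R, is_derive t 1 F (F' t)) -> (forall t, M <= `|t| -> F t = 0) ->
  (forall t, M <= `|t| -> F' t = 0) ->
  (\int[lebesgue_measure]_t (F' t)%:E = 0)%E.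
Proof.
move=> cF' dF F0 F'0.
pose K : R := `|M| + 1.
have K0 : 0 < K by rewrite ltr_wpDl.
have MK (t : R) : K <= `|t| -> M <= `|t|.
  by apply: le_trans; apply: le_trans (ler_norm _) _; rewrite lerDl.
have -> : (\int[lebesgue_measure]_t (F' t)%:E = \int[lebesgue_measure]_(t in `[(- K)%R, K]) (F' t)%:E)%E.
  rewrite [RHS]integral_mkcond; apply: eq_integral => t _; rewrite patchE; case: ifPn => //.
  rewrite notin_setE /= in_itv /= => /negP; rewrite -ler_norml -ltNge => /ltW Kt.
  by rewrite F'0//; exact: MK.
have cF : continuous F.
  move=> t; apply: differentiable_continuous; apply/derivable1_diffP.
  exact: (@ex_derive _ _ _ _ _ _ _ (dF t)).
rewrite (@continuous_FTC2 R F' F).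
- have -> : F K = 0 by apply: F0; apply: MK; rewrite (ger0_norm (ltW K0)).
  have -> : F (- K) = 0 by apply: F0; apply: MK; rewrite normrN (ger0_norm (ltW K0)).
  by rewrite subee.
- by rewrite -subr_gt0 opprK addr_gt0.
- exact: continuous_subspaceT.
- split.
  + by move=> t _; exact: (@ex_derive _ _ _ _ _ _ _ (dF t)).
  + apply: cvg_at_right_filter; exact: cF.
  + apply: cvg_at_left_filter; exact: cF.
- by move=> t _; rewrite derive1E; exact: (@derive_val _ _ _ _ _ _ _ (dF t)).
Qed.

(** Induction on n through Fubini: if the differentiation is in coordinate 0, that variable is
    integrated first; otherwise coordinate 0 is frozen and the slice falls under the induction
    hypothesis. *)
Lemma integral_partial0 n (f : 'rV[R]_n -> R) (i : 'I_n) (M : R) :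
  (forall x, derivable f x (delta_mx ord0 i)) -> continuous (partial i f) ->
  (forall (x : 'rV[R]_n) i, M <= `|x ord0 i| -> f x = 0) ->
  (forall (x : 'rV[R]_n) l, M <= `|x ord0 l| -> partial i f x = 0) ->
  (\int[leb n]_x (partial i f x)%:E = 0)%E.
Proof.
elim: n f i => [f []//|n IH] f i df cf f0 pf0.
have [E1 E2 _] := integral_prod_image (@measurable_rV_cons R n) (@leb_consE' n)
  (compact_support_integrable cf pf0).
case: (unliftP ord0 i) => [j ij|i0]; last first.
  rewrite E2; apply: integral0_eq => y _ /=; subst i.
  pose F := f \o (fun t : R => rV_cons (t, y)).
  have h t := @derive_affine R 'rV[R]_n.+1 f (fun t : R => rV_cons (t, y)) 1 _ t (fun h => rV_cons_shift0 t h y).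
  apply: (@integral_derive0 F _ M).
  - move=> t; apply: (@continuous_comp _ _ _ (fun t : R => rV_cons (t, y)) (partial ord0 f)); last exact: cf.
    exact: continuous_rV_consl.
  - move=> t; have [h1 h2] := h t; rewrite /partial -h1; apply: derivableP; exact: h2.
  - by move=> t Mt; apply: (f0 _ ord0); rewrite rV_consE0.
  - by move=> t Mt; apply: (pf0 _ ord0); rewrite rV_consE0.
rewrite E1; apply: integral0_eq => t _ /=; subst i.
have h y := @derive_affine 'rV[R]_n 'rV[R]_n.+1 f (fun y => rV_cons (t, y)) _ _ y (fun h => rV_cons_shiftS t h y j).
have pE : partial j (fun y => f (rV_cons (t, y))) = fun y => partial (lift ord0 j) f (rV_cons (t, y)).
  by apply/funext => y; have [] := h y.
transitivity (\int[leb n]_y (partial j (fun y : 'rV[R]_n => f (rV_cons (t, y))) y)%:E)%E; first by rewrite pE.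
apply: IH.
- by move=> y; apply: (h y).2.
- rewrite pE => y; apply: (@continuous_comp _ _ _ (fun y => rV_cons (t, y)) (partial (lift ord0 j) f)); last exact: cf.
  exact: continuous_rV_consr.
- by move=> y l My; apply: (f0 _ (lift ord0 l)); rewrite rV_consES.
- by move=> y l My; rewrite pE; apply: (pf0 _ (lift ord0 l)); rewrite rV_consES.
Qed.
End integrals.

(** * Lebesgue and Sobolev spaces *)

Section Lp_theory.
Context {R : realType} {n : nat} (D : set 'rV[R]_n) (mD : measurable D).
Implicit Types (u v : 'rV[R]_n -> R) (p q : R).
Notation mu := (leb n).

Definition Lp_norm p u : R := fine 'N[mu]_p%:E[EFin \o (u \_ D)].

Lemma Lp_measurable p u : Lp p D u -> measurable_fun D u.
Proof.
rewrite /Lp inE => /andP[]; rewrite inE /= => mu' _.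
exact/(measurable_restrictT _ mD).
Qed.

Lemma Lp_lty p u : Lp p D u -> ('N[mu]_p%:E[EFin \o (u \_ D)] < +oo)%E.
Proof. by rewrite /Lp inE => /andP[_]; rewrite inE. Qed.

Lemma Lp_intro p u : measurable_fun D u -> ('N[mu]_p%:E[EFin \o (u \_ D)] < +oo)%E -> Lp p D u.
Proof.
move=> mu' fu; rewrite /Lp inE; apply/andP; split; rewrite inE //=.
exact/(measurable_restrictT _ mD).
Qed.

Lemma Lp_normE p u : Lp p D u -> ('N[mu]_p%:E[EFin \o (u \_ D)] = (Lp_norm p u)%:E)%E.
Proof. by move=> Lu; rewrite /Lp_norm fineK// ge0_fin_numE ?Lnorm_ge0// Lp_lty. Qed.

Lemma Lp_norm_ge0 p u : 0 <= Lp_norm p u.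
Proof. by rewrite /Lp_norm fine_ge0// Lnorm_ge0. Qed.

Lemma Lnorm_pow p u : 0 < p ->
  ('N[mu]_p%:E[EFin \o (u \_ D)] `^ p = \int[mu]_(x in D) (`|u x| `^ p)%:E)%E.
Proof.
move=> p0; rewrite (powR_Lnorm _ _ (lt0r_neq0 p0)) [RHS]integral_mkcond; apply: eq_integral => x _.
by rewrite /= !patchE; case: ifP => // _; rewrite normr0 powR0 ?gt_eqF.
Qed.

Lemma measurable_normr_powR p u : measurable_fun D u -> measurable_fun D (fun x => `|u x| `^ p).
Proof.
move=> mu'; apply: (measurableT_comp (measurable_powR _)) => //.
exact: measurableT_comp.
Qed.

(** The working form of [Lp], on the domain itself instead of the extension by 0. *)
Lemma LpP p u : 0 < p -> Lp p D u <->
  measurable_fun D u /\ mu.-integrable D (fun x => (`|u x| `^ p)%:E).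
Proof.
move=> p0; split => [Lu|[mu' iu]].
  have mu' := Lp_measurable Lu; split => //; apply/integrableP; split.
    by apply/measurable_EFinP; exact: measurable_normr_powR.
  under eq_integral do rewrite gee0_abs ?lee_fin ?powR_ge0//.
  by rewrite -Lnorm_pow// poweR_lty// Lp_lty.
apply: Lp_intro => //.
move/integrableP : iu => [_].
under eq_integral do rewrite gee0_abs ?lee_fin ?powR_ge0//.
by rewrite -Lnorm_pow// => /lty_poweRy; apply; rewrite gt_eqF.
Qed.

Lemma Lp_norm_pow p u : 0 < p -> Lp p D u ->
  \int[mu]_(x in D) (`|u x| `^ p) = Lp_norm p u `^ p.
Proof.
by move=> p0 Lu; rewrite /Rintegral -Lnorm_pow// Lp_normE.
Qed.

Lemma Lp_le p u v : 0 < p -> measurable_fun D v -> Lp p D u ->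
  (forall x, D x -> `|v x| <= `|u x|) -> Lp p D v /\ Lp_norm p v <= Lp_norm p u.
Proof.
move=> p0 mv Lu vu; have [mu' iu] := (LpP u p0).1 Lu.
have vup x : D x -> `|v x| `^ p <= `|u x| `^ p.
  by move=> Dx; apply: (ge0_ler_powR (ltW p0)); rewrite ?nnegrE//; exact: vu.
have iv : mu.-integrable D (fun x => (`|v x| `^ p)%:E).
  apply: (le_integrable mD _ _ iu) => [|x Dx /=].
    by apply/measurable_EFinP; exact: measurable_normr_powR.
  by rewrite lee_fin !(ger0_norm (powR_ge0 _ _)) vup.
have Lv : Lp p D v by apply/LpP.
split => //; rewrite leNgt; apply/negP => uv.
have := gt0_ltr_powR p0; move/(_ (Lp_norm p u) (Lp_norm p v)).
rewrite !nnegrE !Lp_norm_ge0 => /(_ isT isT uv); rewrite -!Lp_norm_pow// ltNge => /negP; apply.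
exact: le_Rintegral.
Qed.

Lemma LpD p u v : 1 <= p -> Lp p D u -> Lp p D v ->
  Lp p D (fun x => u x + v x) /\
  Lp_norm p (fun x => u x + v x) <= Lp_norm p u + Lp_norm p v.
Proof.
move=> p1 Lu Lv.
have E : EFin \o ((fun x => u x + v x) \_ D) = EFin \o ((u \_ D) \+ (v \_ D))%R.
  by apply/funext => x /=; rewrite !patchE; case: ifP => // _; rewrite addr0.
have mu' := (measurable_restrictT u mD).1 (Lp_measurable Lu).
have mv' := (measurable_restrictT v mD).1 (Lp_measurable Lv).
have := minkowski_EFin mu mu' mv' p1; rewrite -E (Lp_normE Lu) (Lp_normE Lv) -EFinD => h.
have Luv : Lp p D (fun x => u x + v x).
  apply: Lp_intro; last by apply: le_lt_trans h _; rewrite ltry.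
  by exact: measurable_funD (Lp_measurable Lu) (Lp_measurable Lv).
by split => //; rewrite -lee_fin -Lp_normE.
Qed.

Lemma hoelder_Lp p q u v : 0 < p -> 0 < q -> p^-1 + q^-1 = 1 -> Lp p D u -> Lp q D v ->
  mu.-integrable D (EFin \o (fun x => u x * v x)) /\
  \int[mu]_(x in D) `|u x * v x| <= Lp_norm p u * Lp_norm q v.
Proof.
move=> p0 q0 pq Lu Lv.
have mu' := (measurable_restrictT u mD).1 (Lp_measurable Lu).
have mv' := (measurable_restrictT v mD).1 (Lp_measurable Lv).
have := hoelder mu mu' mv' p0 q0 pq; rewrite (Lp_normE Lu) (Lp_normE Lv) -EFinM Lnorm1 => h.
have E : (\int[mu]_x `|(EFin \o ((u \_ D) \* (v \_ D))%R) x| = \int[mu]_(x in D) `|u x * v x|%:E)%E.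
  rewrite [RHS]integral_mkcond; apply: eq_integral => x _ /=; rewrite !patchE.
  by case: ifP => // _; rewrite mulr0 normr0.
rewrite E in h.
split.
  apply/integrableP; split; last by apply: le_lt_trans h _; rewrite ltry.
  by apply/measurable_EFinP; exact: measurable_funM (Lp_measurable Lu) (Lp_measurable Lv).
rewrite -lee_fin; apply: le_trans (h); rewrite /Rintegral fineK//.
rewrite ge0_fin_numE; first by apply: le_lt_trans h _; rewrite ltry.
exact: integral_ge0.
Qed.

Lemma LpZ p u (c : R) : 0 < p -> Lp p D u -> Lp p D (fun x => c * u x).
Proof.
move=> p0 Lu; apply/LpP => //; have [mu' iu] := (LpP u p0).1 Lu; split.
  by apply: measurable_funM.
rewrite (_ : (fun x => _) = fun x => ((`|c| `^ p)%:E * (`|u x| `^ p)%:E)%E).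
  exact: integrableZl.
by apply/funext => x; rewrite normrM powRM.
Qed.

Lemma LpN p u : 0 < p -> Lp p D u -> Lp p D (fun x => - u x).
Proof.
move=> p0 Lu; rewrite (_ : (fun x => - u x) = fun x => -1 * u x); first exact: LpZ.
by apply/funext => x; rewrite mulN1r.
Qed.

Lemma LpB p u v : 1 <= p -> Lp p D u -> Lp p D v -> Lp p D (fun x => u x - v x).
Proof.
move=> p1 Lu Lv; have p0 := lt_le_trans ltr01 p1.
exact: (LpD p1 Lu (LpN p0 Lv)).1.
Qed.

Lemma Lp0 p : 0 < p -> Lp p D (fun _ => 0).
Proof.
move=> p0; apply/LpP => //; split => //.
rewrite (_ : (fun x => _) = cst 0%E); first exact: integrable0.
by apply/funext => x; rewrite normr0 powR0// gt_eqF.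
Qed.

Lemma Lp_normr p u : 0 < p -> Lp p D u -> Lp p D (fun x => `|u x|) /\ Lp_norm p (fun x => `|u x|) = Lp_norm p u.
Proof.
move=> p0 Lu; have mu' := Lp_measurable Lu.
have [L1 h1] : Lp p D (fun x => `|u x|) /\ Lp_norm p (fun x => `|u x|) <= Lp_norm p u.
  by apply: Lp_le => // [|x _]; [exact: measurableT_comp|rewrite normr_id].
split => //; apply/eqP; rewrite eq_le h1/=.
by have [//|] := Lp_le p0 mu' L1 => // x _; rewrite normr_id.
Qed.

Lemma Lp_sum p (I : Type) (r : seq I) (F : I -> 'rV[R]_n -> R) : 1 <= p ->
  (forall i, Lp p D (F i)) -> Lp p D (fun x => \sum_(i <- r) F i x) /\
  Lp_norm p (fun x => \sum_(i <- r) F i x) <= \sum_(i <- r) Lp_norm p (F i).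
Proof.
move=> p1 LF; have p0 := lt_le_trans ltr01 p1; elim: r => [|a r [IH1 IH2]].
  rewrite (_ : (fun x => _) = fun=> 0); last by apply/funext => x; rewrite big_nil.
  split; first exact: Lp0.
  rewrite big_nil /Lp_norm (_ : EFin \o _ = cst 0%E) ?Lnorm0 ?eqe ?gt_eqF//.
  by apply/funext => x /=; rewrite patchE; case: ifP.
rewrite (_ : (fun x => _) = fun x => F a x + \sum_(i <- r) F i x); last first.
  by apply/funext => x; rewrite big_cons.
have [h1 h2] := LpD p1 (LF a) IH1; split => //.
by rewrite big_cons; apply: le_trans h2 _; rewrite lerD2l.
Qed.

End Lp_theory.

(** * Test functions and the fundamental lemma of the calculus of variations *)

Section test_functions.
Context {R : realType} {n : nat}.
Implicit Types (Omega : set 'rV[R]_n) (phi psi : 'rV[R]_n -> R).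

Lemma test_continuous Omega phi : test_function Omega phi -> continuous phi.
Proof. by move=> [/(_ 0%N)[]]. Qed.

Lemma test_outside Omega phi x : test_function Omega phi -> ~ Omega x -> phi x = 0.
Proof.
move=> [_ _ sO] Ox; apply: contra_notP Ox => /eqP px; apply: sO.
exact: subset_closure.
Qed.

Lemma rV_hausdorff : hausdorff_space 'rV[R]_n.
Proof. exact: norm_hausdorff. Qed.

(** [K] is closed, being compact in a Hausdorff space, so it contains the support of [phi]. *)
Lemma test_intro Omega (K : set 'rV[R]_n) phi : (forall k, Ck k phi) -> compact K -> K `<=` Omega ->
  (forall x, phi x != 0 -> K x) -> test_function Omega phi.
Proof.
move=> Cp cK KO pK.
have sK : closure [set x | phi x != 0] `<=` K.
  have -> : K = closure K by apply/closure_id; exact: compact_closed rV_hausdorff _.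
  by apply: closure_subset.
split => //; last exact: subset_trans KO.
by apply: subclosed_compact cK sK; exact: closed_closure.
Qed.

Lemma test_sub Omega phi psi : test_function Omega phi -> (forall k, Ck k psi) ->
  (forall x, psi x != 0 -> closure [set x | phi x != 0] x) -> test_function Omega psi.
Proof. by move=> [_ cK KO] Cp pK; exact: test_intro Cp cK KO pK. Qed.

Lemma test_cst0 Omega : test_function Omega (fun=> 0).
Proof.
apply: (@test_intro _ set0) => //; [by move=> k; exact: Ck_cst|exact: compact0|].
by move=> x; rewrite eqxx.
Qed.

Lemma test_mulr Omega phi psi : test_function Omega phi -> (forall k, Ck k psi) ->
  test_function Omega (fun x => phi x * psi x).
Proof.
move=> tp Cp; apply: (test_sub tp) => [k|x].
  by apply: CkM => //; case: tp.
by rewrite mulf_eq0 negb_or => /andP[px _]; exact: subset_closure.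
Qed.

Lemma partial_near0 phi x i : nbhs x [set y | phi y = 0] -> partial i phi x = 0.
Proof.
move=> h; rewrite /partial (@near_eq_derive _ _ _ phi (cst 0) x).
  by rewrite derive_cst.
exact: h.
Qed.

Lemma partial_support phi x i : partial i phi x != 0 -> closure [set x | phi x != 0] x.
Proof.
apply: contra_neqP => xc; apply: partial_near0.
have : nbhs x (~` closure [set x | phi x != 0]).
  by apply: open_nbhs_nbhs; split => //; apply: closed_openC; exact: closed_closure.
apply: (@filterS _ (nbhs x)) => y; apply: contra_notP => /eqP py; exact: subset_closure.
Qed.

Lemma test_partial Omega phi i : test_function Omega phi -> test_function Omega (partial i phi).
Proof.
move=> tp; apply: (test_sub tp) => [k|x]; last exact: partial_support.
by case: tp => /(_ k.+1) /Ck_partial.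
Qed.

Lemma test_support_bound Omega phi : test_function Omega phi ->
  exists2 M, 0 < M & forall (x : 'rV[R]_n) i, M <= `|x ord0 i| -> phi x = 0.
Proof.
move=> [_ /compact_bounded /bounded_rV[M M0 cM] _]; exists M => // x i Mx.
apply/eqP; apply: contraTT Mx => px; rewrite -ltNge; apply: cM; exact: subset_closure.
Qed.

Lemma test_integrable Omega phi : test_function Omega phi -> (leb n).-integrable setT (EFin \o phi).
Proof.
move=> tp; have [M _ pM] := test_support_bound tp.
exact: compact_support_integrable (test_continuous tp) pM.
Qed.

Lemma integral_partial_test Omega phi i : test_function Omega phi ->
  \int[leb n]_(x in Omega) partial i phi x = 0.
Proof.
move=> tp; rewrite Rintegral_mkcond.
have -> : (partial i phi) \_ Omega = partial i phi.
  apply/funext => x; rewrite patchE; case: ifPn => //; rewrite notin_setE => xO.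
  by rewrite (test_outside (test_partial i tp) xO).
have [M1 _ pM1] := test_support_bound tp.
have [M2 _ pM2] := test_support_bound (test_partial i tp).
rewrite /Rintegral (@integral_partial0 _ n phi i (Num.max M1 M2)) //.
- by move=> x; case: tp => /(_ 1%N) /Ck_derivable.
- exact: test_continuous (test_partial i tp).
- by move=> x l; rewrite ge_max => /andP[/pM1 ->].
- by move=> x l; rewrite ge_max => /andP[_ /pM2 ->].
Qed.

(** For c > 0, a smooth approximation from below of the indicator of [obox a b], equal to 1 where
    the distance to every face is at least 1/c. *)
Definition boxbump (a b : 'rV[R]_n) (c : R) (x : 'rV[R]_n) : R :=
  \prod_(i < n) (smoothstep (c * (x ord0 i - a ord0 i)) * smoothstep (c * (b ord0 i - x ord0 i))).

Lemma boxbump_outside a b c x : 0 <= c -> ~ obox a b x -> boxbump a b c x = 0.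
Proof.
move=> c0 /oboxP /existsNP[i /negP]; rewrite negb_and -!leNgt => h.
rewrite /boxbump (bigD1 i)//=; case/orP : h => h.
  by rewrite smoothstep_le0 ?mul0r// mulr_ge0_le0// subr_le0.
by rewrite (@smoothstep_le0 _ (c * (b ord0 i - _))) ?mulr0 ?mul0r// mulr_ge0_le0// subr_le0.
Qed.

Lemma boxbump_ge0 a b c x : 0 <= boxbump a b c x.
Proof. by apply: prodr_ge0 => i _; rewrite mulr_ge0 ?smoothstep_ge0. Qed.

Lemma boxbump_le1 a b c x : boxbump a b c x <= 1.
Proof.
apply: prodr_ile1 => i _; rewrite mulr_ge0 ?smoothstep_ge0//=.
by rewrite mulr_ile1 ?smoothstep_ge0 ?smoothstep_le1.
Qed.

Lemma Ck_boxbump a b c k : Ck k (boxbump a b c).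
Proof.
apply: Ck_prod => i _; apply: CkM.
  rewrite (_ : (fun x => _) = fun x : 'rV[R]_n => smoothstep (c * x ord0 i + - (c * a ord0 i))).
    exact: Ck_smoothstep_coord.
  by apply/funext => x; rewrite mulrBr.
rewrite (_ : (fun x => _) = fun x : 'rV[R]_n => smoothstep (- c * x ord0 i + (c * b ord0 i))).
  exact: Ck_smoothstep_coord.
by apply/funext => x; rewrite mulrBr addrC mulNr.
Qed.

Lemma boxbump_cvg a b x : obox a b x -> boxbump a b j%:R x @[j --> \oo] --> (1 : R).
Proof.
move=> /oboxP ab; apply: cvg_near_cst.
have h1 : \forall j \near \oo, forall i, (x ord0 i - a ord0 i)^-1 <= j%:R.
  by apply: filter_forall => i; exact: nbhs_infty_ger.
have h2 : \forall j \near \oo, forall i, (b ord0 i - x ord0 i)^-1 <= j%:R.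
  by apply: filter_forall => i; exact: nbhs_infty_ger.
near=> j; apply: big1 => i _.
have /andP[xa xb] := ab i.
rewrite !smoothstep_ge1 ?mulr1//.
  by rewrite -ler_pdivrMr ?subr_gt0// mul1r; move: i {xa xb}; near: j.
by rewrite -ler_pdivrMr ?subr_gt0// mul1r; move: i {xa xb}; near: j.
Unshelve. all: by end_near.
Qed.

Definition cobox (a b : 'rV[R]_n) : set 'rV[R]_n :=
  [set x | forall i, a ord0 i <= x ord0 i <= b ord0 i].

Lemma obox_cobox a b : obox a b `<=` cobox a b.
Proof. by move=> x /oboxP h i; have /andP[/ltW -> /ltW ->] := h i. Qed.

Lemma compact_cobox a b : compact (cobox a b).
Proof.
have := @rV_compact R n (fun i => `[a ord0 i, b ord0 i]%classic) (fun=> @segment_compact R _ _).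
by congr compact; apply/seteqP; split => x xM i; have := xM i; rewrite /= in_itv.
Qed.

Lemma boxbump_test Omega a b c : 0 <= c -> cobox a b `<=` Omega ->
  test_function Omega (boxbump a b c).
Proof.
move=> c0 abO; apply: (test_intro _ (@compact_cobox a b) abO) => [k|x]; first exact: Ck_boxbump.
by apply: contra_neqP => xab; apply: boxbump_outside => // /obox_cobox.
Qed.

(** The functions [boxbump a b j] are test functions with values in [0, 1] that tend to 1 on the
    box; dominated convergence carries the hypothesis over to its indicator. *)
Lemma integral_obox0 Omega (g : 'rV[R]_n -> R) a b : measurable Omega -> cobox a b `<=` Omega ->
  (leb n).-integrable (obox a b) (EFin \o g) ->
  (forall phi, test_function Omega phi -> \int[leb n]_(x in Omega) (g x * phi x) = 0) ->
  (\int[leb n]_(x in obox a b) (g x)%:E = 0)%E.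
Proof.
move=> mO abO gi g0; have mab := measurable_obox a b.
have mg : measurable_fun (obox a b) g by apply/measurable_EFinP; exact: measurable_int gi.
have mb c : measurable_fun (obox a b) (boxbump a b c).
  apply: measurable_funTS; apply: continuous_measurable_fun_rV.
  exact: Ck_continuous (Ck_boxbump a b c 0).
pose f_ (j : nat) x := (g x * boxbump a b j%:R x)%:E.
have mf j : measurable_fun (obox a b) (f_ j).
  by apply/measurable_EFinP; exact: measurable_funM.
have fle j x : (`|f_ j x| <= `|(g x)%:E|)%E.
  rewrite /f_ /= lee_fin normrM (ger0_norm (boxbump_ge0 _ _ _ _)) -[leRHS]mulr1.
  by rewrite ler_wpM2l ?boxbump_le1.
have fi j : (leb n).-integrable (obox a b) (f_ j).
  by apply: (le_integrable mab (mf j) _ gi) => x _; exact: fle.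
have int0 j : (\int[leb n]_(x in obox a b) f_ j x = 0)%E.
  have := g0 _ (boxbump_test (ler0n R j) abO).
  have -> : \int[leb n]_(x in Omega) (g x * boxbump a b j%:R x) =
      fine (\int[leb n]_(x in obox a b) f_ j x).
    rewrite /Rintegral; congr fine; rewrite integral_mkcond [RHS]integral_mkcond.
    apply: eq_integral => x _; rewrite !patchE.
    have [xab|xab] := boolP (x \in obox a b).
      by rewrite ifT// inE; apply: abO; apply: obox_cobox; rewrite -inE.
    case: ifP => // _ /=; rewrite boxbump_outside ?mulr0//.
    by move: xab; rewrite notin_setE.
  move=> h; rewrite -[LHS]fineK ?h//.
  exact: integrable_fin_num.
have fcv : {ae leb n, forall x, obox a b x -> f_ j x @[j --> \oo] --> (EFin \o g) x}.
  apply: aeW => x xab; apply/cvg_EFin; first by apply: nearW => j.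
  rewrite /f_ /= -[X in _ --> X]mulr1; apply: cvgM; first exact: cvg_cst.
  exact: boxbump_cvg.
have fle' : {ae leb n, forall x, forall j, obox a b x -> (`|f_ j x| <= (abse \o (EFin \o g)) x)%E}.
  by apply: aeW => x j _; exact: fle.
have mg' : measurable_fun (obox a b) (EFin \o g) by exact/measurable_EFinP.
have [_ _ cv] := dominated_convergence mab mf mg' fcv (integrable_abse gi) fle'.
have cv0 : (fun j => \int[leb n]_(x in obox a b) f_ j x)%E @ \oo --> 0%E.
  by under eq_fun do rewrite int0; exact: cvg_cst.
exact: (cvg_unique _ cv cv0).
Qed.

(** The sets S such that [g] integrates to 0 over the part of S inside the box form a Dynkin system
    containing all boxes, hence all measurable sets. *)
Lemma ae_eq0_obox Omega (g : 'rV[R]_n -> R) a b : measurable Omega -> cobox a b `<=` Omega ->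
  (leb n).-integrable (obox a b) (EFin \o g) ->
  (forall phi, test_function Omega phi -> \int[leb n]_(x in Omega) (g x * phi x) = 0) ->
  ae_eq (leb n) (obox a b) (EFin \o g) (cst 0%E).
Proof.
move=> mO abO gi g0; have mab := measurable_obox a b.
have mg : measurable_fun (obox a b) (EFin \o g) := measurable_int _ gi.
pose P (S : set 'rV[R]_n) := (\int[leb n]_(x in S `&` obox a b) (g x)%:E = 0)%E.
have PT : P setT by rewrite /P setTI; exact: (integral_obox0 mO abO gi g0).
have PG a' b' : P (obox a' b').
  rewrite /P obox_setI; apply: (integral_obox0 mO _ _ g0).
    apply: subset_trans abO => x xab i; move: (xab i); rewrite !mxE ge_max le_min.
    by move=> /andP[/andP[_ ->] /andP[_ ->]].
  rewrite -obox_setI.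
  exact: (integrableS mab (measurableI _ _ (measurable_obox _ _) mab) (@subIsetr _ _ _) gi).
have PC S : measurable S -> P S -> P (~` S).
  move=> mS; rewrite /P => S0; move: PT.
  have mSI : measurable (S `&` obox a b) by exact: measurableI.
  have mCI : measurable (~` S `&` obox a b) by apply: measurableI => //; exact: measurableC.
  rewrite /P (_ : setT `&` _ = (S `&` obox a b) `|` (~` S `&` obox a b)).
    rewrite integral_setU//.
    - by rewrite S0 add0e.
    - by rewrite -setIUl setUv setTI.
    - by apply/disj_setPS => x [[Sx _] [nSx _]].
  by rewrite -setIUl setUv.
have PU (F : (set 'rV[R]_n)^nat) : (forall j, measurable (F j)) -> trivIset setT F ->
    (forall j, P (F j)) -> P (\bigcup_j F j).
  move=> mF tF PF; rewrite /P setI_bigcupl integral_bigcup.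
  - by rewrite eseries0// => j _ _; exact: PF.
  - by apply/trivIsetP => i j _ _ ij; rewrite setIACA; move/trivIsetP : tF => -> //; rewrite set0I.
  - by move=> j; exact: measurableI.
  - apply: (integrableS mab) gi; first by apply: bigcup_measurable => j _; exact: measurableI.
    by move=> x [j _ []].
have Pall : forall S, measurable S -> P S.
  rewrite measurable_rV_obox; apply: dynkin_induction => //.
  - exact: measurable_rV_obox.
  - exact: obox_setI_closed.
  - by move=> _ [a' [b' ->]].
apply: (integral_ae_eq mab gi) => [|E Eab mE]; first exact: measurable_cst.
have := Pall E mE; rewrite /P (_ : E `&` _ = E); last exact/setIidPl.
by move=> ->; rewrite integral0.
Qed.

(* Omega is a countable union of boxes whose closures it contains. *)
Lemma ae_eq0_test Omega (g : 'rV[R]_n -> R) : open Omega ->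
  (forall a b, cobox a b `<=` Omega -> (leb n).-integrable (obox a b) (EFin \o g)) ->
  (forall phi, test_function Omega phi -> \int[leb n]_(x in Omega) (g x * phi x) = 0) ->
  \forall x \ae leb n, Omega x -> g x = 0.
Proof.
move=> oO gi g0; have mO := open_measurable_rV oO.
pose N (q : 'rV[rat]_n * 'rV[rat]_n) := [set x | cobox (map_mx ratr q.1) (map_mx ratr q.2) `<=` Omega /\
  obox (map_mx ratr q.1) (map_mx ratr q.2) x /\ g x <> 0].
have negN q : (leb n).-negligible (N q).
  have [qO|qO] := pselect (cobox (map_mx ratr q.1) (map_mx ratr q.2) `<=` Omega); last first.
    by apply: negligibleS (negligible_set0 _) => x [].
  have h := ae_eq0_obox mO qO (gi _ _ qO) g0.
  apply: negligibleS h => x [_ [qx gx]] /= h; apply: gx.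
  by have /= := h qx => -[].
(* The pairs of rational corners are enumerated through [pickle], which turns the exceptional sets
   into a sequence. *)
have nU : (leb n).-negligible (\bigcup_k (if (pickle_inv k : option ('rV[rat]_n * 'rV[rat]_n)) is Some q then N q else set0)).
  by apply: negligible_bigcup => k; case: pickle_inv => [q|]; [exact: negN|exact: negligible_set0].
apply: negligibleS nU => x /= /not_implyP[Ox gx].
have [q [qx qO]] := open_rational_obox oO Ox.
exists (pickle q) => //; rewrite pickleK_inv; split => //.
by move=> y yq; apply: qO => i; have := yq i; rewrite !mxE.
Qed.

End test_functions.

(** * Weak gradients and the space W^{1,p}_0 *)

Section sobolev_theory.
Context {R : realType} {n : nat} (Omega : set 'rV[R]_n) (oO : open Omega) (p : R) (p1 : 1 < p).
Implicit Types (u v phi : 'rV[R]_n -> R) (g : 'rV[R]_n -> 'rV[R]_n).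
Notation mu := (leb n).
Notation q := (p / (p - 1)).

Let mO : measurable Omega. Proof. exact: open_measurable_rV. Qed.
Let p0 : 0 < p. Proof. exact: lt_trans p1. Qed.
Let p1' : 1 <= p. Proof. exact: ltW. Qed.

Lemma conjugate_gt0 : 0 < q.
Proof. by rewrite divr_gt0// subr_gt0. Qed.

Lemma conjugateE : p^-1 + q^-1 = 1.
Proof. by rewrite invf_div; field; rewrite gt_eqF. Qed.

Lemma Lp_bounded r v (B : set 'rV[R]_n) (C : R) : 0 < r -> measurable_fun Omega v ->
  measurable B -> (mu B < +oo)%E -> (forall x, `|v x| <= C) -> (forall x, ~ B x -> v x = 0) ->
  Lp r Omega v.
Proof.
move=> r0 mv mB By vC vB; apply/LpP => //; split => //.
have C0 : 0 <= C by exact: le_trans (normr_ge0 (v 0)) (vC 0).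
apply: (@le_integrable _ _ _ _ _ mO _ (fun x => (C `^ r)%:E * (\1_B x)%:E)%E).
- by apply/measurable_EFinP; exact: measurable_normr_powR.
- move=> x _; rewrite -EFinM /= lee_fin (ger0_norm (powR_ge0 _ _)).
  rewrite (@ger0_norm _ (_ * _)) ?mulr_ge0 ?powR_ge0// indicE.
  have [xB|xB] := boolP (x \in B).
    by rewrite mulr1; apply: (ge0_ler_powR (ltW r0)); rewrite ?nnegrE.
  by rewrite vB ?normr0 ?powR0 ?gt_eqF ?mulr0//; move: xB; rewrite notin_setE.
- apply: integrableZl => //; apply/integrableP; split.
    by apply/measurable_EFinP; exact: measurable_indic.
  rewrite (eq_integral (EFin \o \1_B)); last by move=> x _ /=; rewrite ger0_norm.
  rewrite integral_indic//; apply: le_lt_trans By.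
  by apply: le_measure; rewrite ?inE//; exact: measurableI.
Qed.

Lemma test_measurable phi (D : set 'rV[R]_n) : test_function Omega phi -> measurable_fun D phi.
Proof.
by move=> tp; apply: measurable_funTS; apply: continuous_measurable_fun_rV; exact: test_continuous tp.
Qed.

Lemma test_Lp r phi : 0 < r -> test_function Omega phi -> Lp r Omega phi.
Proof.
move=> r0 tp; have [M M0 pM] := test_support_bound tp.
have [C C0 pC] := continuous_bounded_support (test_continuous tp) pM.
apply: (@Lp_bounded r phi (obox (const_mx (- M)) (const_mx M)) C) => //.
- exact: test_measurable.
- exact: measurable_obox.
- exact: leb_obox_lty.
- move=> x /oboxP /existsNP[i].
  by rewrite !mxE => /negP; rewrite -ltr_norml -leNgt => /pM.
Qed.

(** |u| <= 1 + |u|^p, and the box has finite measure. *)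
Lemma Lp_locally_integrable u a b : Lp p Omega u -> cobox a b `<=` Omega ->
  mu.-integrable (obox a b) (EFin \o u).
Proof.
move=> Lu abO; have [mu' iu] := (LpP mO u p0).1 Lu; have mab := measurable_obox a b.
have sab : obox a b `<=` Omega by apply: subset_trans abO; exact: obox_cobox.
apply: (@le_integrable _ _ _ _ _ mab _ (fun x => cst 1%:E x + (`|u x| `^ p)%:E)%E).
- apply/measurable_EFinP; exact: measurable_funS mO sab mu'.
- move=> x _; rewrite -EFinD lee_fin (@ger0_norm _ (_ + _)) ?addr_ge0 ?powR_ge0//.
  have [u1|u1] := leP `|u x| 1; first by rewrite (le_trans u1)// lerDl powR_ge0.
  rewrite (@le_trans _ _ (`|u x| `^ p))// ?lerDr//.
  by rewrite -[leLHS]powRr1//; apply: ler_powR; rewrite ?ltW.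
- apply: integrableD => //; last exact: integrableS iu.
  apply/integrableP; split; first exact: measurable_cst.
  under eq_integral do rewrite /= normr1.
  by rewrite integral_cst// mul1e leb_obox_lty.
Qed.

Lemma Lp_test_integrable u phi : Lp p Omega u -> test_function Omega phi ->
  mu.-integrable Omega (EFin \o (fun x => u x * phi x)).
Proof.
move=> Lu tp.
exact: (hoelder_Lp mO p0 conjugate_gt0 conjugateE Lu (test_Lp conjugate_gt0 tp)).1.
Qed.

Lemma Lp_eq0_test u : Lp p Omega u ->
  (forall phi, test_function Omega phi -> \int[mu]_(x in Omega) (u x * phi x) = 0) ->
  \forall x \ae mu, Omega x -> u x = 0.
Proof. by move=> Lu; apply: ae_eq0_test => // a b; exact: Lp_locally_integrable. Qed.

(** Tested with any phi, both gradients return minus the integral of u times the derivative of phi,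
    so the fundamental lemma applies to their difference. This is what gives control over the
    arbitrary choice in [wgrad]. *)
Lemma weak_gradient_unique u g1 g2 : weak_gradient p Omega u g1 -> weak_gradient p Omega u g2 ->
  forall i, \forall x \ae mu, Omega x -> g1 x ord0 i = g2 x ord0 i.
Proof.
move=> [L1 h1] [L2 h2] i.
have L12 := LpB mO p1' (L1 i) (L2 i).
have : \forall x \ae mu, Omega x -> g1 x ord0 i - g2 x ord0 i = 0.
  apply: (Lp_eq0_test L12) => phi tp.
  rewrite (@eq_Rintegral _ _ _ mu Omega (fun x => g1 x ord0 i * phi x - g2 x ord0 i * phi x)); last first.
    by move=> x _; rewrite mulrBl.
  rewrite RintegralB//; [|exact: Lp_test_integrable (L1 i) tp|exact: Lp_test_integrable (L2 i) tp].
  apply/eqP; rewrite subr_eq0 -eqr_opp; apply/eqP.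
  by rewrite -h1// -h2.
by apply: filterS => x h /h /eqP; rewrite subr_eq0 => /eqP.
Qed.

Lemma W1p_wgrad u : W1p p Omega u -> weak_gradient p Omega u (wgrad p Omega u).
Proof. by move=> [_ [g ug]]; exact: (@getI _ [set g | weak_gradient p Omega u g] g ug). Qed.

(** The product of two test functions is a test function, so its derivative integrates to 0; the
    product rule splits that integral. *)
Lemma weak_gradient_test phi : test_function Omega phi -> weak_gradient p Omega phi (grad phi).
Proof.
move=> tp; split => [i|psi tpsi i].
  rewrite (_ : (fun x => _) = partial i phi); last by apply/funext => x; rewrite mxE.
  by apply: test_Lp => //; exact: test_partial.
have tm : test_function Omega (fun x => phi x * psi x).
  by apply: test_mulr tp _; case: tpsi.
have := integral_partial_test i tm.
rewrite (@eq_Rintegral _ _ _ mu Omega (fun x => phi x * partial i psi x + grad phi x ord0 i * psi x)); last first.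
  move=> x _; rewrite partialM.
  - by rewrite [in RHS]mxE [psi x * _]mulrC.
  - by case: tp => /(_ 1%N) /Ck_derivable.
  - by case: tpsi => /(_ 1%N) /Ck_derivable.
rewrite RintegralD//.
- by move/eqP; rewrite addr_eq0 => /eqP.
- by apply: Lp_test_integrable; [exact: test_Lp|exact: test_partial].
- rewrite (_ : (fun x => _) = fun x => partial i phi x * psi x); last first.
    by apply/funext => x; rewrite mxE.
  by apply: Lp_test_integrable => //; apply: test_Lp => //; exact: test_partial.
Qed.

Lemma weak_gradientB u v g1 g2 : Lp p Omega u -> Lp p Omega v ->
  weak_gradient p Omega u g1 -> weak_gradient p Omega v g2 ->
  weak_gradient p Omega (fun x => u x - v x) (fun x => g1 x - g2 x).
Proof.
move=> Lu Lv [L1 h1] [L2 h2]; split => [i|phi tp i].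
  rewrite (_ : (fun x => _) = fun x => g1 x ord0 i - g2 x ord0 i); first exact: LpB.
  by apply/funext => x; rewrite !mxE.
have tpi := test_partial i tp.
rewrite (@eq_Rintegral _ _ _ mu Omega (fun x => u x * partial i phi x - v x * partial i phi x)); last first.
  by move=> x _; rewrite mulrBl.
rewrite RintegralB//; [|exact: Lp_test_integrable|exact: Lp_test_integrable].
rewrite h1// h2// opprK addrC -opprB; congr (- _).
rewrite -RintegralB//; [|exact: Lp_test_integrable (L1 i) tp|exact: Lp_test_integrable (L2 i) tp].
by apply: eq_Rintegral => x _; rewrite !mxE mulrBl.
Qed.

Lemma W1p_test phi : test_function Omega phi -> W1p p Omega phi.
Proof.
by move=> tp; split; [exact: test_Lp|exists (grad phi); exact: weak_gradient_test].
Qed.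

Lemma wgrad_test phi i : test_function Omega phi ->
  \forall x \ae mu, Omega x -> wgrad p Omega phi x ord0 i = partial i phi x.
Proof.
move=> tp.
have := weak_gradient_unique (W1p_wgrad (W1p_test tp)) (weak_gradient_test tp) i.
by apply: filterS => x h /h ->; rewrite mxE.
Qed.

Lemma W1pB u v : W1p p Omega u -> W1p p Omega v -> W1p p Omega (fun x => u x - v x).
Proof.
move=> Wu Wv; split; first exact: LpB Wu.1 Wv.1.
exists (fun x => wgrad p Omega u x - wgrad p Omega v x).
exact: weak_gradientB Wu.1 Wv.1 (W1p_wgrad Wu) (W1p_wgrad Wv).
Qed.

Lemma Lp_norm_ae u v : Lp p Omega u -> Lp p Omega v ->
  (\forall x \ae mu, Omega x -> u x = v x) -> Lp_norm Omega p u = Lp_norm Omega p v.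
Proof.
move=> Lu Lv uv.
have : Lp_norm Omega p u `^ p = Lp_norm Omega p v `^ p.
  rewrite -(Lp_norm_pow p0 Lu) -(Lp_norm_pow p0 Lv) /Rintegral; congr fine; apply: ae_eq_integral => //.
  - by apply/measurable_EFinP; apply: measurable_normr_powR; exact: Lp_measurable Lu.
  - by apply/measurable_EFinP; apply: measurable_normr_powR; exact: Lp_measurable Lv.
  - by apply: filterS uv => x h /h ->.
move=> /(congr1 (fun r => r `^ p^-1)); rewrite -!powRrM mulfV ?gt_eqF//.
by rewrite !powRr1// Lp_norm_ge0.
Qed.

Lemma W1p_normE u : W1p p Omega u -> W1p_norm p Omega u =
  (Lp_norm Omega p u + \sum_(i < n) Lp_norm Omega p (fun x => wgrad p Omega u x ord0 i))%:E.
Proof.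
move=> Wu; have [Lg _] := W1p_wgrad Wu.
rewrite /W1p_norm Lp_normE//; last exact: Wu.1.
rewrite EFinD -sumEFin; congr (_ + _)%E; apply: eq_bigr => i _.
by rewrite Lp_normE.
Qed.

(** [phi] approximates itself, but the norm of phi - phi involves the chosen weak gradient of 0,
    which has to be shown to vanish almost everywhere. *)
Lemma W1p0_test phi : test_function Omega phi -> W1p0 p Omega phi.
Proof.
move=> tp; split; first exact: W1p_test.
move=> e e0; exists phi => //.
have t0 := @test_cst0 R n Omega.
rewrite (_ : (fun x => phi x - phi x) = fun=> 0); last by apply/funext => x; rewrite subrr.
have W0 := W1p_test t0.
have N0 : Lp_norm Omega p (fun=> 0) = 0.
  rewrite /Lp_norm (_ : EFin \o _ = cst 0%E) ?Lnorm0 ?eqe ?gt_eqF//.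
  by apply/funext => x /=; rewrite patchE; case: ifP.
rewrite W1p_normE// N0 big1 ?addr0 ?lte_fin// => i _.
rewrite -[RHS]N0; apply: Lp_norm_ae; [exact: (W1p_wgrad W0).1|exact: Lp0|].
apply: filterS (wgrad_test i t0) => x h /h ->.
by rewrite partial_cst.
Qed.

(** The norm in [W1p0] sees the gradient chosen for the difference u - phi; by uniqueness it is
    almost everywhere [wgrad] of u minus the classical gradient of phi. *)
Lemma W1p0_approx u (e : R) : W1p0 p Omega u -> 0 < e -> exists phi, [/\ test_function Omega phi,
  Lp_norm Omega p (fun x => u x - phi x) < e &
  forall i, Lp_norm Omega p (fun x => wgrad p Omega u x ord0 i - partial i phi x) < e].
Proof.
move=> [Wu /(_ e)] h e0; have [phi tp phi_eps] := h e0; exists phi.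
have Wp := W1p_test tp; have Wup := W1pB Wu Wp.
move: (phi_eps); rewrite W1p_normE// lte_fin => lt_e.
have Lg := (W1p_wgrad Wu).1.
have Lt i : Lp p Omega (partial i phi) by apply: test_Lp => //; exact: test_partial.
have gE i : Lp_norm Omega p (fun x => wgrad p Omega (fun y => u y - phi y) x ord0 i) =
    Lp_norm Omega p (fun x => wgrad p Omega u x ord0 i - partial i phi x).
  apply: Lp_norm_ae; [exact: (W1p_wgrad Wup).1|exact: LpB|].
  have := weak_gradient_unique (W1p_wgrad Wup)
    (weak_gradientB Wu.1 Wp.1 (W1p_wgrad Wu) (weak_gradient_test tp)) i.
  by apply: filterS => x hx /hx ->; rewrite !mxE.
split => //.
  by apply: le_lt_trans lt_e; rewrite lerDl sumr_ge0// => i _; exact: Lp_norm_ge0.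
move=> i; rewrite -gE; apply: le_lt_trans lt_e.
rewrite (bigD1 i)//= addrCA lerDl addr_ge0 ?Lp_norm_ge0//.
by rewrite sumr_ge0// => j _; exact: Lp_norm_ge0.
Qed.

Lemma Rintegral_sum (I : Type) (r : seq I) (F : I -> 'rV[R]_n -> R) :
  (forall i, mu.-integrable Omega (EFin \o F i)) ->
  mu.-integrable Omega (EFin \o (fun x => \sum_(i <- r) F i x)) /\
  \int[mu]_(x in Omega) (\sum_(i <- r) F i x) = \sum_(i <- r) \int[mu]_(x in Omega) F i x.
Proof.
move=> iF.
have E : EFin \o (fun x => \sum_(i <- r) F i x) = (fun x => \sum_(i <- r) (EFin \o F i) x)%E.
  by apply/funext => x /=; rewrite sumEFin.
split; first by rewrite E; apply: integrable_sum.
rewrite /Rintegral.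
rewrite (eq_integral (fun x => \sum_(i <- r) (EFin \o F i) x)%E); last by move=> x _ /=; rewrite sumEFin.
rewrite integral_sum// -sum_fine// => i _.
exact: integrable_fin_num.
Qed.

Lemma hoelder_dotp d (G v : 'rV[R]_n -> 'rV[R]_d) :
  (forall i, Lp q Omega (fun x => G x ord0 i)) -> (forall i, Lp p Omega (fun x => v x ord0 i)) ->
  mu.-integrable Omega (EFin \o (fun x => dotp (G x) (v x))) /\
  `|\int[mu]_(x in Omega) dotp (G x) (v x)| <=
   \sum_(i < d) Lp_norm Omega q (fun x => G x ord0 i) * Lp_norm Omega p (fun x => v x ord0 i).
Proof.
move=> LG Lv.
have pq : q^-1 + p^-1 = 1 by rewrite addrC conjugateE.
have ii i := (hoelder_Lp mO conjugate_gt0 p0 pq (LG i) (Lv i)).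
have [i1 E] := Rintegral_sum (index_enum 'I_d) (fun i => (ii i).1).
split => //; rewrite E; apply: le_trans (ler_norm_sum _ _ _) _; apply: ler_sum => i _.
exact: le_trans (le_normr_Rintegral mO (ii i).1) (ii i).2.
Qed.

(** Both sides are continuous in [u] for the W^{1,p} norm by Hoelder's inequality, and test
    functions are dense in [W1p0]. It is meant for the flux of (0, grad uoo) on the cylinder, whose
    equation is first obtained for test functions. *)
Lemma weak_form_W1p0 (G : 'rV[R]_n -> 'rV[R]_n) (h : 'rV[R]_n -> R) u :
  (forall i, Lp q Omega (fun x => G x ord0 i)) -> Lp q Omega h ->
  (forall phi, test_function Omega phi ->
    \int[mu]_(x in Omega) dotp (G x) (grad phi x) = \int[mu]_(x in Omega) (h x * phi x)) ->
  W1p0 p Omega u ->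
  \int[mu]_(x in Omega) dotp (G x) (wgrad p Omega u x) = \int[mu]_(x in Omega) (h x * u x).
Proof.
move=> LG Lh Gh Wu; have Wu1 := Wu.1; have Lg := (W1p_wgrad Wu1).1.
have q0 := conjugate_gt0; have pq : q^-1 + p^-1 = 1 by rewrite addrC conjugateE.
set A := \int[mu]_(x in Omega) dotp (G x) _; set B := \int[mu]_(x in Omega) _.
pose K := \sum_(i < n) Lp_norm Omega q (fun x => G x ord0 i) + Lp_norm Omega q h.
have K0 : 0 <= K by rewrite addr_ge0 ?Lp_norm_ge0// sumr_ge0// => i _; exact: Lp_norm_ge0.
suff AB e : 0 < e -> `|A - B| <= K * e.
  apply/eqP; rewrite -subr_eq0 -normr_eq0; apply/negP => /negP AB0.
  have D0 : 0 < `|A - B| by rewrite lt_neqAle eq_sym AB0 normr_ge0.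
  have K1 : 0 < K + 1 by rewrite ltr_wpDl.
  (* With this e the estimate reads (K + 1) |A - B| <= K |A - B|, which is absurd. *)
  have := AB (`|A - B| / (K + 1)) (divr_gt0 D0 K1).
  by rewrite mulrA ler_pdivlMr// mulrDr mulr1 [K * _]mulrC gerDl leNgt D0.
move=> e0; have [phi [tp phiu phig]] := W1p0_approx Wu e0.
have Lt i : Lp p Omega (partial i phi) by apply: test_Lp => //; exact: test_partial.
have Lgrad i : Lp p Omega (fun x => grad phi x ord0 i).
  by rewrite (_ : (fun x => _) = partial i phi)//; apply/funext => x; rewrite mxE.
pose v x := wgrad p Omega u x - grad phi x.
have vE i : (fun x => v x ord0 i) = fun x => wgrad p Omega u x ord0 i - partial i phi x.
  by apply/funext => x; rewrite !mxE.
have Lv i : Lp p Omega (fun x => v x ord0 i) by rewrite vE; exact: LpB.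
have [iv bv] := hoelder_dotp LG Lv.
have [iu _] := hoelder_dotp LG Lg.
have [ip _] := hoelder_dotp LG Lgrad.
have Lw : Lp p Omega (fun x => u x - phi x) by apply: LpB => //; [exact: Wu1.1|exact: test_Lp].
have [iw bw] := hoelder_Lp mO q0 p0 pq Lh Lw.
have ihu := (hoelder_Lp mO q0 p0 pq Lh Wu1.1).1.
have ihp := (hoelder_Lp mO q0 p0 pq Lh (test_Lp p0 tp)).1.
have AE : A = \int[mu]_(x in Omega) dotp (G x) (v x) + \int[mu]_(x in Omega) dotp (G x) (grad phi x).
  rewrite -RintegralD//; apply: eq_Rintegral => x _; rewrite /dotp -big_split /=.
  by apply: eq_bigr => i _; rewrite -mulrDr /v !mxE subrK.
have BE : B = \int[mu]_(x in Omega) (h x * (u x - phi x)) + \int[mu]_(x in Omega) (h x * phi x).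
  by rewrite -RintegralD//; apply: eq_Rintegral => x _; rewrite -mulrDr subrK.
rewrite AE BE Gh// opprD addrACA subrr addr0 /K mulrDl; apply: le_trans (ler_normB _ _) _; apply: lerD.
  apply: le_trans bv _; rewrite mulr_suml; apply: ler_sum => i _.
  by rewrite ler_wpM2l ?Lp_norm_ge0// vE ltW.
apply: le_trans (le_normr_Rintegral mO iw) _; apply: le_trans bw _.
by rewrite ler_wpM2l ?Lp_norm_ge0// ltW.
Qed.

(** [weak_solution] is phrased with [wgrad phi], whereas slices and competitors are differentiated
    classically. *)
Lemma wgrad_test_dotp (G : 'rV[R]_n -> 'rV[R]_n) phi :
  (forall i, Lp q Omega (fun x => G x ord0 i)) -> test_function Omega phi ->
  \int[mu]_(x in Omega) dotp (G x) (wgrad p Omega phi x) = \int[mu]_(x in Omega) dotp (G x) (grad phi x).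
Proof.
move=> LG tp.
have Lg := (W1p_wgrad (W1p_test tp)).1.
have Lgrad i : Lp p Omega (fun x => grad phi x ord0 i).
  rewrite (_ : (fun x => _) = partial i phi); last by apply/funext => x; rewrite mxE.
  by apply: test_Lp => //; exact: test_partial.
have [iu _] := hoelder_dotp LG Lg.
have [ip _] := hoelder_dotp LG Lgrad.
rewrite /Rintegral; congr fine; apply: ae_eq_integral => //.
- exact: measurable_int iu.
- exact: measurable_int ip.
have h : \forall x \ae mu, forall i, Omega x -> wgrad p Omega phi x ord0 i = partial i phi x.
  by apply: filter_forall => i; exact: wgrad_test.
apply: filterS h => x hx Ox /=; congr EFin; apply: eq_bigr => i _.
by rewrite hx// [in RHS]mxE.
Qed.
End sobolev_theory.

(** * Cutoff functions of dilated convex sets *)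

Section dilation.
Context {R : realType} {m : nat}.

Lemma dilateE (l : R) (A : set 'rV[R]_m) : l != 0 -> dilate l A = (fun x => l^-1 *: x) @^-1` A.
Proof.
move=> l0; apply/seteqP; split => x /=.
  by move=> [y By <-]; rewrite scalerA mulVf// scale1r.
by move=> Bx; exists (l^-1 *: x) => //; rewrite scalerA mulfV// scale1r.
Qed.

Lemma continuous_scaler (l : R) : continuous (fun x : 'rV[R]_m => l *: x).
Proof. exact: scaler_continuous. Qed.

Lemma open_dilate (l : R) (A : set 'rV[R]_m) : l != 0 -> open A -> open (dilate l A).
Proof. by move=> l0 oA; rewrite dilateE//; apply: open_comp oA => x _; exact: continuous_scaler. Qed.

(** s w + t y is s + t times the convex combination of w and y with weights s/(s+t) and t/(s+t). *)
Lemma convex_dilateD (A : set 'rV[R]_m) (s t : R) (x y : 'rV[R]_m) : convex_set A ->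
  0 <= s -> 0 < t -> dilate s A x -> A y -> dilate (s + t) A (x + t *: y).
Proof.
move=> cA s0 t0 [w Aw <-] Ay; have st0 : 0 < s + t by rewrite ltr_wpDl.
exists ((s / (s + t)) *: w + (t / (s + t)) *: y); last first.
  by rewrite scalerDr !scalerA ![(s + t) * _]mulrC !divfK ?gt_eqF.
have h0 : 0 <= s / (s + t) by rewrite divr_ge0// ltW.
have h1 : s / (s + t) <= 1 by rewrite ler_pdivrMr// mul1r lerDl ltW.
have := cA w y (Itv01 h0 h1) (mem_set Aw) (mem_set Ay).
rewrite inE /conv /= /unstable.onem (_ : 1 - s / (s + t) = t / (s + t))//.
by rewrite -[X in X - _](divff (lt0r_neq0 st0)) -mulrBl addrAC subrr add0r.
Qed.

Lemma dilate_le (A : set 'rV[R]_m) (s t : R) : convex_set A -> A 0 -> 0 <= s -> s <= t ->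
  dilate s A `<=` dilate t A.
Proof.
move=> cA A0 s0 st x Ax; move: st; rewrite le_eqVlt => /predU1P[<- //|st].
have := convex_dilateD cA s0 (_ : 0 < t - s) Ax A0.
by rewrite subr_gt0 scaler0 addr0 addrC subrK; apply.
Qed.
End dilation.

Section derivatives.
Context {R : realType} {n : nat}.

Lemma derive_shift_invariant (f : 'rV[R]_n -> R) (x v : 'rV[R]_n) :
  (forall h : R, f (h *: v + x) = f x) -> is_derive x v f 0.
Proof.
move=> fE.
have E : (fun h : R => h^-1 *: ((f \o shift x) (h *: v) - f x)) = fun=> 0.
  by apply/funext => h /=; rewrite fE subrr scaler0.
apply: DeriveDef; first by rewrite /derivable E; exact: is_cvg_cst.
by rewrite /derive E; exact: lim_cst.
Qed.

Lemma partial_sum (I : Type) (r : seq I) (P : pred I) (F : I -> 'rV[R]_n -> R) k x :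
  (forall i, Ck 1 (F i)) ->
  partial k (fun x => \sum_(i <- r | P i) F i x) x = \sum_(i <- r | P i) partial k (F i) x.
Proof.
move=> CF; elim: r => [|a r IH].
  rewrite big_nil (_ : (fun x => _) = fun=> 0) ?partial_cst//.
  by apply/funext => y; rewrite big_nil.
rewrite big_cons; case: ifPn => Pa; last first.
  rewrite -IH; congr (partial k _ x); apply/funext => y.
  by rewrite big_cons (negPf Pa).
rewrite (_ : (fun x => _) = fun x => F a x + \sum_(i <- r | P i) F i x).
  rewrite partialD ?IH//; first exact: Ck_derivable (CF a) _ _.
  by apply: Ck_derivable; apply: Ck_sum => i _; exact: CF.
by apply/funext => y; rewrite big_cons Pa.
Qed.

End derivatives.

(** * Partition of unity by integer translates *)

Section partition.
Context {R : realType}.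

(** A bump on [-1, 1], written as a difference of shifted steps so that its integer translates
    telescope. *)
Definition hat (t : R) : R := smoothstep (t + 1) - smoothstep t.

Lemma hat_ge0 t : 0 <= hat t.
Proof. by rewrite subr_ge0 smoothstep_homo// lerDl. Qed.

Lemma hat_support t : hat t != 0 -> `|t| <= 1.
Proof.
apply: contra_neqT; rewrite -ltNge => t1; rewrite /hat.
case: (leP 0 t) => t0.
  by rewrite !smoothstep_ge1 ?subrr//; move: t1; rewrite ger0_norm// => /ltW // ?; lra.
move: t1; rewrite ltr0_norm// => t1.
by rewrite !smoothstep_le0 ?subrr//; lra.
Qed.

Lemma sum_hat (y : R) (K : nat) :
  \sum_(a < K) hat (y - a%:R) = smoothstep (y + 1) - smoothstep (y + 1 - K%:R).
Proof.
elim: K => [|K IH]; first by rewrite big_ord0 subr0 subrr.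
rewrite big_ord_recr /= IH /hat.
have -> : y + 1 - K%:R = y - K%:R + 1 by ring.
have -> : y + 1 - K.+1%:R = y - K%:R by rewrite -natr1; ring.
by rewrite addrA subrK.
Qed.

(** The a-th term can be nonzero only for y in ]a, a + 1[; these intervals are disjoint, so at most
    one term survives. *)
Lemma sum_translates_bound (g : R -> R) (M : R) (y : R) (K : nat) : 0 <= M ->
  (forall t, `|g t| <= M) -> (forall t, t <= 0 \/ 1 <= t -> g t = 0) ->
  \sum_(a < K) `|g (y - a%:R)| <= M.
Proof.
move=> M0 gM g0; elim: K => [|K IH]; first by rewrite big_ord0.
rewrite big_ord_recr /=; have [yK|yK] := leP y K%:R.
  by rewrite (g0 (y - K%:R)) ?normr0 ?addr0//; left; rewrite subr_le0.
rewrite big1 ?add0r// => a _; rewrite g0 ?normr0//; right.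
have := ltn_ord a; rewrite -(ler_nat R) -natr1 => aK; lra.
Qed.

(** The derivative of [hat] is a difference of two translates of the derivative of [smoothstep].
    Uniformity in y and K makes the later gradient bound independent of the size of the lattice. *)
Lemma hat_derive : exists hat' : R -> R, exists2 M, 0 <= M &
  (forall t : R, is_derive t 1 hat (hat' t)) /\
  forall (y : R) (K : nat), \sum_(a < K) `|hat' (y - a%:R)| <= M.
Proof.
have [S' [cS' dS' S'0]] := @smoothstep_derive R.
have := @continuous_compact _ _ S' `[0, 1]%classic (continuous_subspaceT cS') (@segment_compact R 0 1).
move=> /compact_bounded[C [_ /(_ (`|C| + 1)) SC]].
have S'M t : `|S' t| <= `|C| + 1.
  have [/andP[t0 t1]|] := boolP (0 <= t <= 1).
    apply: SC; last by exists t => //=; rewrite in_itv /= t0 t1.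
    by rewrite (le_lt_trans (ler_norm _))// ltrDl.
  rewrite negb_and -!ltNge => h; rewrite S'0 ?normr0//.
  by case/orP : h => /ltW h; [left|right].
have C0 : 0 <= `|C| + 1 by rewrite addr_ge0.
exists (fun t => S' (t + 1) - S' t), (`|C| + 1 + (`|C| + 1)); first by rewrite addr_ge0.
split => [t|y K].
  have d1 : is_derive t 1 (fun s : R => s + 1) 1.
    have := @is_deriveD R R R id (cst 1) t 1 _ _ (is_derive_id _ _) (is_derive_cst _ _ _).
    by move/is_derive_eq; apply; rewrite addr0.
  have d2 := @is_derive1_comp _ smoothstep (fun s => s + 1) t _ _ (dS' _) d1.
  have := @is_deriveB R R R (fun s => smoothstep (s + 1)) smoothstep t 1 _ _ d2 (dS' t).
  by move/is_derive_eq; apply; rewrite mulr1.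
apply: (@le_trans _ _ (\sum_(a < K) (`|S' (y + 1 - a%:R)| + `|S' (y - a%:R)|))).
  apply: ler_sum => a _; rewrite (_ : y - a%:R + 1 = y + 1 - a%:R) ?ler_normB//; ring.
by rewrite big_split /=; apply: lerD; apply: sum_translates_bound.
Qed.

Lemma Ck_hat_coord n (a b : R) (i : 'I_n) k : Ck k (fun x : 'rV[R]_n => hat (a * x ord0 i + b)).
Proof.
rewrite (_ : (fun x => _) = fun x : 'rV[R]_n => smoothstep (a * x ord0 i + (b + 1)) +
    (-1) * smoothstep (a * x ord0 i + b)).
  apply: CkD; first exact: Ck_smoothstep_coord.
  by apply: CkM; [exact: Ck_cst|exact: Ck_smoothstep_coord].
by apply/funext => x; rewrite /hat mulN1r addrA.
Qed.
End partition.

Section cutoff.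
Context {R : realType} {m : nat} (c : R) (c0 : 0 < c) (N : nat).
Notation K := (N.*2.+1).

(* Partition of unity subordinate to the lattice c^-1 Z^m inside [-N/c, N/c]^m. *)
Definition bump (j : {ffun 'I_m -> 'I_K}) (x : 'rV[R]_m) : R :=
  \prod_(i < m) hat (c * x ord0 i + N%:R - (j i)%:R).

(** The centre of [bump j], where every [hat] is evaluated at 0; the indices 0, ..., 2N stand for
    the lattice coordinates -N, ..., N. *)
Definition node (j : {ffun 'I_m -> 'I_K}) : 'rV[R]_m := \row_i (((j i)%:R - N%:R) / c).

Lemma bump_ge0 j (x : 'rV[R]_m) : 0 <= bump j x.
Proof. by apply: prodr_ge0 => i _; exact: hat_ge0. Qed.

Lemma Ck_bump j k : Ck k (bump j).
Proof.
apply: Ck_prod => i _.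
rewrite (_ : (fun x => _) = fun x : 'rV[R]_m => hat (c * x ord0 i + (N%:R - (j i)%:R))).
  exact: Ck_hat_coord.
by apply/funext => x; rewrite addrA.
Qed.

Lemma bump_support j (x : 'rV[R]_m) : bump j x != 0 -> forall i, `|x ord0 i - node j ord0 i| <= c^-1.
Proof.
move=> /prodf_neq0 + i => /(_ i isT) /hat_support h; rewrite mxE.
rewrite -(ler_pM2l c0) mulfV ?gt_eqF// -{1}(gtr0_norm c0) -normrM.
congr (`|_| <= _) : h; field; exact: lt0r_neq0.
Qed.

(** Distributivity factors the sum over multi-indices into m one-dimensional telescoping sums. *)
Lemma sum_bump (x : 'rV[R]_m) : \sum_j bump j x =
  \prod_(i < m) (smoothstep (c * x ord0 i + N%:R + 1) - smoothstep (c * x ord0 i - N%:R)).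
Proof.
rewrite -(bigA_distr_bigA (fun i (a : 'I_K) => hat (c * x ord0 i + N%:R - a%:R))).
apply: eq_bigr => i _; rewrite sum_hat; congr (_ - smoothstep _).
by rewrite -addnn -natr1 natrD; ring.
Qed.

Lemma sum_bump1 (x : 'rV[R]_m) : (forall i, `|x ord0 i| <= N%:R / c) -> \sum_j bump j x = 1.
Proof.
move=> xN; rewrite sum_bump; apply: big1 => i _.
have : `|c * x ord0 i| <= N%:R.
  by rewrite normrM gtr0_norm// mulrC -ler_pdivlMr.
rewrite ler_norml => /andP[h1 h2].
by rewrite smoothstep_ge1 ?smoothstep_le0 ?subr0//; lra.
Qed.

Lemma sum_bump_le1 (x : 'rV[R]_m) : \sum_j bump j x <= 1.
Proof.
rewrite sum_bump; apply: prodr_ile1 => i _.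
rewrite subr_ge0 smoothstep_homo /=; last by have : 0 <= N%:R :> R by []; lra.
by rewrite (le_trans _ (smoothstep_le1 (c * x ord0 i + N%:R + 1)))// lerBlDr lerDl smoothstep_ge0.
Qed.

Lemma partial_bump (hat' : R -> R) j k (x : 'rV[R]_m) : (forall t : R, is_derive t 1 hat (hat' t)) ->
  partial k (bump j) x = \prod_(i < m)
   (if i == k then c * hat' (c * x ord0 i + N%:R - (j i)%:R) else hat (c * x ord0 i + N%:R - (j i)%:R)).
Proof.
move=> dh.
pose f1 (x : 'rV[R]_m) := hat (c * x ord0 k + N%:R - (j k)%:R).
pose f2 (x : 'rV[R]_m) := \prod_(i < m | i != k) hat (c * x ord0 i + N%:R - (j i)%:R).
have -> : bump j = fun x => f1 x * f2 x by apply/funext => y; rewrite /bump (bigD1 k).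
have d2 : is_derive x (delta_mx ord0 k) f2 0.
  apply: derive_shift_invariant => h; apply: eq_bigr => i ik.
  by rewrite !mxE eqxx (negPf ik) mulr0 add0r.
have da : is_derive (x ord0 k) 1 (fun t : R => c * t + N%:R - (j k)%:R) c.
  have dM := @is_deriveM _ _ (cst c) id (x ord0 k) 1 _ _ (is_derive_cst _ _ _) (is_derive_id _ _).
  have dD := @is_deriveD R R R _ (cst N%:R) (x ord0 k) 1 _ _ dM (is_derive_cst _ _ _).
  have := @is_deriveB R R R _ (cst (j k)%:R) (x ord0 k) 1 _ _ dD (is_derive_cst _ _ _).
  by move/is_derive_eq; apply; rewrite subr0 addr0 /GRing.scale /= mulr0 addr0 mulr1.
have d1 := @is_derive_coord R m (fun t => hat (c * t + N%:R - (j k)%:R)) k k x _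
  (@is_derive1_comp _ hat _ (x ord0 k) _ _ (dh _) da).
have := @is_deriveM _ _ f1 f2 x (delta_mx ord0 k) _ _ d1 d2.
rewrite /partial => /(@derive_val _ _ _ _ _ _ _) ->.
rewrite [RHS](bigD1 k)//= !eqxx mul1r scaler0 add0r /GRing.scale /= mulrC.
rewrite [_ * c]mulrC; congr (_ * _).
by apply: eq_bigr => i /negPf ->.
Qed.

Variable P : pred {ffun 'I_m -> 'I_K}.

Definition lattice_cutoff (x : 'rV[R]_m) : R := \sum_(j | P j) bump j x.

Lemma Ck_lattice_cutoff k : Ck k lattice_cutoff.
Proof. by apply: Ck_sum => j _; exact: Ck_bump. Qed.

Lemma lattice_cutoff_ge0 (x : 'rV[R]_m) : 0 <= lattice_cutoff x.
Proof. by apply: sumr_ge0 => j _; exact: bump_ge0. Qed.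

Lemma lattice_cutoff_le1 (x : 'rV[R]_m) : lattice_cutoff x <= 1.
Proof.
apply: le_trans (sum_bump_le1 x); rewrite [leRHS](bigID P) /= lerDl.
by apply: sumr_ge0 => j _; exact: bump_ge0.
Qed.

(** A bump that does not vanish at [x] has its node within 1/c of [x] and is therefore selected, so
    the whole partition of unity is present at [x]. *)
Lemma lattice_cutoff_eq1 (x : 'rV[R]_m) : (forall i, `|x ord0 i| <= N%:R / c) ->
  (forall j, (forall i, `|x ord0 i - node j ord0 i| <= c^-1) -> P j) -> lattice_cutoff x = 1.
Proof.
move=> xN xP; rewrite -(sum_bump1 xN) /lattice_cutoff [RHS](bigID P) /= [X in _ = _ + X]big1 ?addr0//.
by move=> j; apply: contraNeq => /bump_support; exact: xP.
Qed.

(** After passing to absolute values the sum may be enlarged from [P] to all multi-indices, and it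
    then factors: the k-th factor is at most c M, the others at most 1. The bound thus depends
    neither on [P] nor on [N]. *)
Lemma partial_lattice_cutoff (hat' : R -> R) (M : R) k (x : 'rV[R]_m) : 0 <= M ->
  (forall t : R, is_derive t 1 hat (hat' t)) ->
  (forall (y : R) (K : nat), \sum_(a < K) `|hat' (y - a%:R)| <= M) ->
  `|partial k lattice_cutoff x| <= c * M.
Proof.
move=> M0 dh hM; rewrite /lattice_cutoff partial_sum; last by move=> j; exact: Ck_bump.
apply: le_trans (ler_norm_sum _ _ _) _.
pose F i (a : 'I_K) := if i == k then c * `|hat' (c * x ord0 i + N%:R - a%:R)|
  else hat (c * x ord0 i + N%:R - a%:R).
have F0 i a : 0 <= F i a.
  by rewrite /F; case: ifP => _; rewrite ?hat_ge0// mulr_ge0// ltW.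
apply: (@le_trans _ _ (\sum_(j : {ffun 'I_m -> 'I_K}) \prod_i F i (j i))).
  rewrite [leRHS](bigID P) /= -[leLHS]addr0; apply: lerD; last first.
    by apply: sumr_ge0 => j _; apply: prodr_ge0.
  apply: ler_sum => j _; rewrite (partial_bump j k x dh) normr_prod.
  apply: ler_prod => i _; rewrite normr_ge0 /= /F; case: ifP => _.
    by rewrite normrM gtr0_norm.
  by rewrite ger0_norm ?hat_ge0.
rewrite -(bigA_distr_bigA F) (bigD1 k)//= -[leRHS]mulr1; apply: ler_pM.
- by apply: sumr_ge0.
- by apply: prodr_ge0 => i _; exact: sumr_ge0.
- by rewrite /F eqxx -mulr_sumr ler_pM2l//; exact: hM.
- apply: prodr_ile1 => i ik; rewrite sumr_ge0//= /F (negPf ik) sum_hat.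
  by rewrite (le_trans _ (smoothstep_le1 (c * x ord0 i + N%:R + 1)))// lerBlDr lerDl smoothstep_ge0.
Qed.

End cutoff.

Section convex_cutoff.
Context {R : realType} {m : nat} (A : set 'rV[R]_m).
Hypotheses (oA : open A) (bA : bounded_set A) (cA : convex_set A) (A0 : A 0).

(* The cutoff is the sum of the bumps of a fixed lattice whose nodes lie in
   (l-1) A; only boundedly many bumps overlap, so M does not depend on l. *)
Lemma convex_cutoff : exists2 M : R, 0 <= M & forall l : R, 2 < l -> exists rho : 'rV[R]_m -> R,
  [/\ test_function (dilate l A) rho, forall x, 0 <= rho x <= 1,
      forall i x, `|partial i rho x| <= M &
      forall x, dilate (l - 2) A x -> rho x = 1].
Proof.
have [hat' [M M0 [dh hM]]] := @hat_derive R.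
(* r is both the lattice spacing and the radius of a sup-norm ball inside A, so that moving by at
   most r in each coordinate costs one unit of dilation. *)
have [r r0 rA] : exists2 r : R, 0 < r & forall y : 'rV[R]_m, (forall i, `|y ord0 i| <= r) -> A y.
  move: (oA); rewrite openE => /(_ _ A0) /nbhs_ballP[e /= e0 eA].
  exists (e / 2); first by rewrite divr_gt0.
  move=> y ye; apply: eA; split => // a i; rewrite ord1 -ball_normE /= mxE sub0r normrN.
  by apply: le_lt_trans (ye i) _; rewrite ltr_pdivrMr// ltr_pMr// ltr1n.
have [B B0 AB] := bounded_rV bA.
have c0 : 0 < r^-1 by rewrite invr_gt0.
exists (r^-1 * M) => [|l l2]; first by rewrite mulr_ge0// ltW.
(* The lattice cube has half-side N r >= l B and therefore covers l A. *)
pose N := (Num.trunc (l * B / r)).+1.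
(* Nodes in (l - 1) A leave one unit of room on each side: the selected bumps stay inside l A, and
   every bump that is nonzero somewhere on (l - 2) A is selected. *)
pose P (j : {ffun 'I_m -> 'I_(N.*2.+1)}) := `[< dilate (l - 1) A (node r^-1 j) >].
have l1 : 0 < l - 1 by rewrite subr_gt0 (lt_trans _ l2)// ltr1n.
have l20 : 0 < l - 2 by rewrite subr_gt0.
have near_A s (x y : 'rV[R]_m) : 0 <= s -> dilate s A x -> (forall i, `|y ord0 i - x ord0 i| <= r) ->
    dilate (s + 1) A y.
  move=> s0 sx xy; have := convex_dilateD cA s0 ltr01 sx (rA (y - x) _).
  rewrite scale1r [x + _]addrC subrK; apply => i.
  by have := xy i; rewrite !mxE.
have near_node (x : 'rV[R]_m) j : (forall i, `|x ord0 i - node r^-1 j ord0 i| <= r^-1^-1) -> P j -> dilate l A x.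
  rewrite invrK => xj /asboolP Aj; rewrite -[l](subrK 1).
  by apply: near_A xj => //; exact: ltW.
exists (lattice_cutoff r^-1 P); split.
- pose Q := \bigcup_(j in [set j | P j]) cobox (node r^-1 j - const_mx r) (node r^-1 j + const_mx r).
  have jQ j (x : 'rV[R]_m) : cobox (node r^-1 j - const_mx r) (node r^-1 j + const_mx r) x <->
      forall i, `|x ord0 i - node r^-1 j ord0 i| <= r^-1^-1.
    by rewrite invrK; split => h i; move: (h i); rewrite !mxE ler_distl.
  apply: (@test_intro _ _ _ Q) => //.
  + by move=> k; exact: Ck_lattice_cutoff.
  + rewrite (_ : Q = \big[setU/set0]_(j <- index_enum {ffun 'I_m -> 'I_(N.*2.+1)} | P j)
        cobox (node r^-1 j - const_mx r) (node r^-1 j + const_mx r)).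
      by apply: bigsetU_compact => j _; exact: compact_cobox.
    rewrite -bigcup_seq_cond; congr (\bigcup_(_ in _) _); apply/funext => j /=.
    by rewrite mem_index_enum.
  + by move=> x [j /= Pj /jQ xj]; exact: near_node xj Pj.
  + move=> x; rewrite /lattice_cutoff => /eqP h.
    have [j [Pj jx]] : exists j, P j /\ bump r^-1 j x != 0.
      apply: contrapT => nj; apply: h; apply: big1 => j Pj; apply/eqP; apply: contrapT => /negP jx.
      by apply: nj; exists j.
    by exists j => //; apply/jQ; exact: bump_support jx.
- by move=> x; rewrite lattice_cutoff_ge0 lattice_cutoff_le1.
- by move=> i x; exact: partial_lattice_cutoff.
- move=> x Ax; apply: lattice_cutoff_eq1 => //.
    move=> i; rewrite invrK; case: Ax => w Aw <-; rewrite mxE normrM gtr0_norm//.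
    rewrite -ler_pdivrMr//; apply/ltW; apply: le_lt_trans (truncnS_gt _).
    rewrite ler_wpM2r ?invr_ge0 ?(ltW r0)//; apply: ler_pM => //; first exact: ltW.
      by rewrite gerBl.
    by apply/ltW; exact: AB.
  move=> j; rewrite invrK => xj; apply/asboolP.
  have -> : l - 1 = l - 2 + 1 by ring.
  by apply: near_A Ax _ => [|i]; [exact: ltW|rewrite distrC].
Qed.

End convex_cutoff.

(** * Finsler norms *)

Section dotp_theory.
Context {R : realType} {n : nat}.
Implicit Types u v w : 'rV[R]_n.

Lemma dotp0l v : dotp 0 v = 0.
Proof. by rewrite /dotp big1// => i _; rewrite mxE mul0r. Qed.

Lemma dotpZl (a : R) u v : dotp (a *: u) v = a * dotp u v.
Proof. by rewrite /dotp mulr_sumr; apply: eq_bigr => i _; rewrite mxE mulrA. Qed.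

Lemma dotpBr u v w : dotp u (v - w) = dotp u v - dotp u w.
Proof. by rewrite /dotp -sumrB; apply: eq_bigr => i _; rewrite !mxE mulrBr. Qed.

Lemma measurable_rV_comp (D : set 'rV[R]_n) N (g : 'rV[R]_n -> 'rV[R]_N) (h : 'rV[R]_N -> R) :
  measurable D -> measurable_fun setT h -> (forall i, measurable_fun D (fun x => g x ord0 i)) ->
  measurable_fun D (h \o g).
Proof.
move=> mD mh mg.
have mgD : measurable_fun setT (g \_ D).
  apply: measurable_fun_rVP => i.
  rewrite (_ : (fun x => _) = (fun x => g x ord0 i) \_ D).
    exact: (measurable_restrictT _ mD).1 (mg i).
  by apply/funext => x; rewrite !patchE; case: ifP => // _; rewrite mxE.
apply: (@eq_measurable_fun _ _ _ _ _ (h \o (g \_ D))).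
  by move=> x; rewrite inE => Dx; rewrite /= patchE mem_set.
by apply: measurable_funTS; exact: measurableT_comp.
Qed.
End dotp_theory.

Section finsler_theory.
Context {R : realType} {n : nat} (H : 'rV[R]_n -> R) (HN : finsler_norm H).
Implicit Types v w z : 'rV[R]_n.

Lemma finsler0 : H 0 = 0.
Proof. by have := finsler_homogeneous HN 0 0; rewrite scale0r normr0 mul0r. Qed.

Lemma finsler_conv (t : R) v w : 0 <= t -> t <= 1 ->
  H (t *: v + (1 - t) *: w) <= t * H v + (1 - t) * H w.
Proof.
move=> t0 t1.
exact: (finsler_convex HN (Itv01 t0 t1) (mem_set (I : setT v)) (mem_set (I : setT w))).
Qed.

(** Convexity at the midpoint of 2 v and 2 w, combined with homogeneity. *)
Lemma finslerD v w : H (v + w) <= H v + H w.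
Proof.
have h1 : (2^-1 : R) <= 1 by rewrite invf_le1 ?ler1n.
have := finsler_conv (2 *: v) (2 *: w) (_ : 0 <= 2^-1) h1.
rewrite (_ : 1 - 2^-1 = 2^-1); last by field.
rewrite !scalerA mulVf// !scale1r !(finsler_homogeneous HN) ger0_norm//.
by rewrite !mulrA mulVf// !mul1r; apply.
Qed.

(** A Lipschitz constant of H for the sup norm. *)
Definition finsler_bound : R := \sum_(i < n) H (delta_mx ord0 i).

Lemma finsler_le_sum v : H v <= \sum_(i < n) `|v ord0 i| * H (delta_mx ord0 i).
Proof.
rewrite {1}(row_sum_delta v).
elim/big_ind2 : _ => [|x1 x2 y1 y2 h1 h2|i _]; first by rewrite finsler0.
  by apply: le_trans (finslerD _ _) _; exact: lerD.
by rewrite (finsler_homogeneous HN).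
Qed.

Lemma finsler_bound_ge0 : 0 <= finsler_bound.
Proof. by apply: sumr_ge0 => i _; exact: finsler_ge0. Qed.

Lemma finsler_le_norm v : H v <= finsler_bound * `|v|.
Proof.
apply: le_trans (finsler_le_sum v) _; rewrite /finsler_bound mulr_suml; apply: ler_sum => i _.
by rewrite mulrC ler_wpM2l ?(finsler_ge0 HN)// ler_coord.
Qed.

Lemma finslerN v : H (- v) = H v.
Proof. by rewrite -scaleN1r (finsler_homogeneous HN) normrN1 mul1r. Qed.

Lemma finsler_dist v w : `|H v - H w| <= H (v - w).
Proof.
rewrite ler_norml; apply/andP; split.
  rewrite lerNl opprB lerBlDr -(opprB w v) finslerN.
  by rewrite -{1}(subrK v w); exact: finslerD.
by rewrite lerBlDr -{1}(subrK w v); exact: finslerD.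
Qed.

Lemma continuous_finsler : continuous H.
Proof.
move=> v B /nbhs_ballP[e /= e0 eB].
have b0 : 0 < finsler_bound + 1 by rewrite ltr_wpDl// finsler_bound_ge0.
have hb := @nbhsx_ballx R _ v (e / (finsler_bound + 1)) (divr_gt0 e0 b0).
have sB : ball v (e / (finsler_bound + 1)) `<=` H @^-1` B.
  move=> w; rewrite -ball_normE /= ltr_pdivlMr// => vw; apply: eB; rewrite -ball_normE /=.
  apply: le_lt_trans vw; apply: le_trans (finsler_dist _ _) _.
  by apply: le_trans (finsler_le_norm _) _; rewrite mulrC ler_wpM2l// lerDl.
exact: (@filterS _ (nbhs v) (nbhs_filter v) _ _ sB hb).
Qed.

(** Total differentiability makes the directional derivative linear in the direction. *)
Lemma dotp_grad w v : w != 0 -> dotp (grad H w) v = 'D_v H w.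
Proof.
move=> w0; have dH := finsler_differentiable HN w0.
rewrite [in RHS](row_sum_delta v) deriveE// linear_sum /dotp; apply: eq_bigr => i _.
by rewrite linearZ /= -deriveE// mxE mulrC.
Qed.

(* Convexity bounds the difference quotients of H along [w, w + v]. *)
Lemma finsler_tangent w v : w != 0 -> 'D_v H w <= H (w + v) - H w.
Proof.
move=> w0; have dH : derivable H w v by apply: diff_derivable; exact: finsler_differentiable.
have cv := cvg_dnbhs_at_right dH.
rewrite leNgt; apply/negP => lt.
have near_gt := @cvgr_gt _ _ _ _ _ _ cv _ lt.
suff : \forall h \near (0 : R)^'+, False by move=> /filter_ex[].
near=> h.
  have h0 : 0 < h by near: h; exact: nbhs_right_gt.
  have h1 : h <= 1 by near: h; apply: nbhs_right_le.
  have : H (w + v) - H w < h^-1 *: ((H \o shift w) (h *: v) - H w) by near: h; exact: near_gt.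
  rewrite -[X in _ < X]/(h^-1 * (H (h *: v + w) - H w)) ltr_pdivlMl// ltNge => /negP; apply.
  have := finsler_conv (w + v) w (ltW h0) h1.
  rewrite scalerDr addrAC -scalerDl [h + _]addrC subrK scale1r [w + h *: v]addrC => hc.
  rewrite lerBlDr; apply: le_trans hc _; lra.
Unshelve. all: by end_near.
Qed.

(** The tangent inequality and subadditivity bound the derivative along v by H(v); this is applied
    to both signs of the basis vector. *)
Lemma finsler_grad_le w i : w != 0 -> `|grad H w ord0 i| <= H (delta_mx ord0 i).
Proof.
move=> w0; have h v : 'D_v H w <= H v.
  apply: le_trans (finsler_tangent v w0) _.
  by rewrite lerBlDr addrC; exact: finslerD.
have gE : grad H w ord0 i = 'D_(delta_mx ord0 i) H w by rewrite mxE.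
rewrite ler_norml gE h andbT lerNl -gE.
have -> : - grad H w ord0 i = dotp (grad H w) (- delta_mx ord0 i).
  by rewrite -[X in dotp _ X]sub0r dotpBr !dotp_grad// derive0 gE sub0r.
by rewrite dotp_grad//; apply: le_trans (h _) _; rewrite finslerN.
Qed.

Variables (p : R) (p1 : 1 < p).
Let p0 : 0 < p. Proof. exact: lt_trans p1. Qed.
Let pm1 : 0 < p - 1. Proof. by rewrite subr_gt0. Qed.

(** The tangent inequality of H at [w] is multiplied by H(w)^(p-1), and H(z) H(w)^(p-1) is then
    split by Young's inequality with exponents p and p/(p-1). At w = 0 the left-hand side is 0. *)
Lemma flux_tangent w z :
  H w `^ p / p + dotp (flux p H w) (z - w) <= H z `^ p / p.
Proof.
rewrite /flux; case: eqP => [->|/eqP w0].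
  rewrite dotp0l addr0 finsler0 powR0 ?gt_eqF// mul0r divr_ge0 ?powR_ge0//; exact: ltW.
have Hw := finsler_gt0 HN w0; have Hz := finsler_ge0 HN z.
rewrite dotpZl dotp_grad//.
have h1 := finsler_tangent (z - w) w0; rewrite [w + _]addrC subrK in h1.
have P0 : 0 <= H w `^ (p - 1) by exact: powR_ge0.
have h2 : H w `^ (p - 1) * 'D_(z - w) H w <= H w `^ (p - 1) * (H z - H w) by rewrite ler_wpM2l.
have := conjugate_powR Hz P0 p0 (conjugate_gt0 p1) (conjugateE p1).
rewrite -powRrM (_ : (p - 1) * (p / (p - 1)) = p); last by field; rewrite gt_eqF.
have HwE : H w `^ (p - 1) * H w = H w `^ p.
  by rewrite -{2}[H w]powRr1 ?ltW// -powRD ?subrK//; apply/implyP => _; rewrite gt_eqF.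
rewrite invf_div => h3.
have h4 : H w `^ p * ((p - 1) / p) = H w `^ p - H w `^ p / p by field; rewrite gt_eqF.
rewrite h4 in h3; move: h2; rewrite mulrBr HwE => h2.
by move: h2 h3; rewrite [H z * _]mulrC; lra.
Qed.

Lemma flux_le z i : `|flux p H z ord0 i| <= H z `^ (p - 1) * H (delta_mx ord0 i).
Proof.
rewrite /flux; case: eqP => [_|/eqP z0].
  by rewrite mxE normr0 mulr_ge0 ?powR_ge0 ?(finsler_ge0 HN).
by rewrite mxE normrM ger0_norm ?powR_ge0// ler_wpM2l ?powR_ge0 ?finsler_grad_le.
Qed.

Lemma measurable_finsler : measurable_fun setT H.
Proof. by apply: continuous_measurable_fun_rV; exact: continuous_finsler. Qed.

(** The flux is continuous on the open set of nonzero vectors and is 0 at the origin. *)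
Lemma measurable_flux i : measurable_fun setT (fun z => flux p H z ord0 i).
Proof.
have oN : open [set z : 'rV[R]_n | z != 0].
  rewrite (_ : [set _ | _] = ~` [set 0]); last by apply/seteqP; split => z /= /eqP.
  by apply: closed_openC; apply: compact_closed; [exact: rV_hausdorff|exact: compact_set1].
have mN := open_measurable_rV oN.
rewrite (_ : (fun z => _) = (fun z => H z `^ (p - 1) * grad H z ord0 i) \_ [set z | z != 0]).
  apply/(measurable_restrictT _ mN); apply: measurable_funM.
    apply: measurable_funTS; apply: (measurableT_comp (measurable_powR _)) => //.
    exact: measurable_finsler.
  apply: continuous_in_measurable_fun_rV => // z z0.
  apply: (@continuous_comp _ _ _ (grad H) (fun x : 'rV[R]_n => x ord0 i)).
    exact: finsler_grad_continuous.
  exact: coord_continuous.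
apply/funext => z; rewrite patchE /flux; case: eqP => [->|/eqP z0].
  by rewrite mxE memNset//= eqxx.
by rewrite mem_set//= mxE.
Qed.

Section composition.
Context {N : nat} (D : set 'rV[R]_N) (mD : measurable D) (g : 'rV[R]_N -> 'rV[R]_n).
Hypothesis Lg : forall i, Lp p D (fun x => g x ord0 i).

Let mg i : measurable_fun D (fun x => g x ord0 i).
Proof. exact: Lp_measurable (Lg i). Qed.

Lemma Lp_finsler : Lp p D (H \o g) /\
  Lp_norm D p (H \o g) <= \sum_(i < n) Lp_norm D p (fun x => H (delta_mx ord0 i) * g x ord0 i).
Proof.
have p1' := ltW p1.
have LF i : Lp p D (fun x => H (delta_mx ord0 i) * g x ord0 i) by apply: LpZ.
have LFn i := Lp_normr mD p0 (LF i).
have [L1 L2] := Lp_sum mD (index_enum 'I_n) p1' (fun i => (LFn i).1).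
have mH : measurable_fun D (H \o g) by apply: measurable_rV_comp => //; exact: measurable_finsler.
have Hle x : D x -> `|(H \o g) x| <= `|\sum_(i < n) `|H (delta_mx ord0 i) * g x ord0 i| |.
  move=> _; rewrite /= ger0_norm ?(finsler_ge0 HN)//.
  rewrite ger0_norm; last by apply: sumr_ge0.
  apply: le_trans (finsler_le_sum _) _; apply: ler_sum => i _.
  by rewrite normrM (ger0_norm (finsler_ge0 HN _)) mulrC.
have [h1 h2] := Lp_le mD p0 mH L1 Hle; split => //.
apply: le_trans h2 _; apply: le_trans L2 _; apply: ler_sum => i _.
by rewrite (LFn i).2.
Qed.

(** Each component is at most a constant times H^(p-1), whose power p/(p-1) is H^p. *)
Lemma Lq_flux i : Lp (p / (p - 1)) D (fun x => flux p H (g x) ord0 i).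
Proof.
have q0 := conjugate_gt0 p1.
have [LH _] := Lp_finsler; have [mH iH] := (LpP mD (H \o g) p0).1 LH.
have LHq : Lp (p / (p - 1)) D (fun x => H (g x) `^ (p - 1)).
  apply/LpP => //; split.
    by apply: (measurableT_comp (measurable_powR _)).
  rewrite (_ : (fun x => _) = fun x => (`|(H \o g) x| `^ p)%:E)//.
  apply/funext => x; congr EFin; rewrite ger0_norm ?powR_ge0//= ger0_norm ?(finsler_ge0 HN)//.
  by rewrite -powRrM; congr (_ `^ _); field; rewrite gt_eqF.
have mF : measurable_fun D (fun x => flux p H (g x) ord0 i).
  by apply: (@measurable_rV_comp _ _ D _ g (fun z => flux p H z ord0 i)) => //; exact: measurable_flux.
have le x : D x -> `|flux p H (g x) ord0 i| <= `|H (delta_mx ord0 i) * H (g x) `^ (p - 1)|.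
  move=> _; rewrite normrM (ger0_norm (finsler_ge0 HN _)) (ger0_norm (powR_ge0 _ _)) mulrC.
  exact: flux_le.
exact: (Lp_le mD q0 mF (LpZ mD (H (delta_mx ord0 i)) q0 LHq) le).1.
Qed.

End composition.
End finsler_theory.

(** * Cylinders *)

Section cylinders.
Context {R : realType} {m k : nat}.
Implicit Types (W : set 'rV[R]_m) (D : set 'rV[R]_k).

(** The base is arbitrary because, besides dilates of omega1, the difference of two dilates occurs
    as well; [cylinder] unfolds to an instance. *)
Definition cyl W D : set 'rV[R]_(m + k) := [set x | W (lsubmx x) /\ D (rsubmx x)].

Lemma cyl_row_mx W D x y : cyl W D (row_mx x y) <-> W x /\ D y.
Proof. by rewrite /cyl /= row_mxKl row_mxKr. Qed.

Lemma open_cyl W D : open W -> open D -> open (cyl W D).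
Proof.
move=> oW oD; apply: openI.
- by apply: open_comp oW => x _; exact: continuous_lsubmx.
- by apply: open_comp oD => x _; exact: continuous_rsubmx.
Qed.

Lemma measurable_lsubmx : measurable_fun setT (fun x : 'rV[R]_(m + k) => lsubmx x).
Proof.
apply: measurable_fun_rVP => i.
rewrite (_ : (fun x => _) = fun x : 'rV[R]_(m + k) => x ord0 (lshift k i)).
  exact: measurable_rV_coord.
by apply/funext => x; rewrite mxE.
Qed.

Lemma measurable_rsubmx : measurable_fun setT (fun x : 'rV[R]_(m + k) => rsubmx x).
Proof.
apply: measurable_fun_rVP => i.
rewrite (_ : (fun x => _) = fun x : 'rV[R]_(m + k) => x ord0 (rshift m i)).
  exact: measurable_rV_coord.
by apply/funext => x; rewrite mxE.
Qed.

Lemma measurable_cyl W D : measurable W -> measurable D -> measurable (cyl W D).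
Proof.
move=> mW mD; apply: measurableI.
- by rewrite -[X in measurable X]setTI; exact: measurable_lsubmx.
- by rewrite -[X in measurable X]setTI; exact: measurable_rsubmx.
Qed.

Lemma patch_cyl W D (F : 'rV[R]_(m + k) -> R) x y :
  (F \_ (cyl W D)) (row_mx x y) = ((fun x => ((fun y => F (row_mx x y)) \_ D) y) \_ W) x.
Proof.
rewrite !patchE; have [Wx|Wx] := boolP (x \in W); last first.
  by rewrite memNset// => /cyl_row_mx[Wx' _]; move: Wx; rewrite notin_setE.
have [Dy|Dy] := boolP (y \in D).
  by rewrite mem_set//; apply/cyl_row_mx; split; exact/set_mem.
by rewrite memNset// => /cyl_row_mx[_ Dy']; move: Dy; rewrite notin_setE.
Qed.

Lemma integral_cyl_l0 W D (F : 'rV[R]_(m + k) -> R) : measurable W -> measurable D ->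
  (leb (m + k)).-integrable (cyl W D) (EFin \o F) ->
  (forall x, W x -> (\int[leb k]_(y in D) (F (row_mx x y))%:E = 0)%E) ->
  \int[leb (m + k)]_(x in cyl W D) F x = 0.
Proof.
move=> mW mD iF F0; rewrite Rintegral_mkcond /Rintegral.
have iF' : (leb (m + k)).-integrable setT (EFin \o (F \_ (cyl W D))).
  by rewrite -restrict_EFin; apply: (integrable_mkcond _ (measurable_cyl mW mD)).1.
have [-> _ _] := integral_prod_image (measurable_row_mx (m := m) (k := k)) (@leb_row_mxE R m k) iF'.
rewrite integral0_eq// => x _.
rewrite (eq_integral (fun y => (((fun x => ((fun y => F (row_mx x y)) \_ D) y) \_ W) x)%:E)); last first.
  by move=> y _; rewrite /= patch_cyl.
have [Wx|Wx] := boolP (x \in W).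
  rewrite -[RHS](F0 x (set_mem Wx)) [RHS]integral_mkcond; apply: eq_integral => y _.
  by rewrite patchE Wx !patchE; case: ifP.
by apply: integral0_eq => y _; rewrite patchE (negPf Wx).
Qed.

Lemma integral_cyl_r0 W D (F : 'rV[R]_(m + k) -> R) : measurable W -> measurable D ->
  (leb (m + k)).-integrable (cyl W D) (EFin \o F) ->
  (forall y, D y -> (\int[leb m]_(x in W) (F (row_mx x y))%:E = 0)%E) ->
  \int[leb (m + k)]_(x in cyl W D) F x = 0.
Proof.
move=> mW mD iF F0; rewrite Rintegral_mkcond /Rintegral.
have iF' : (leb (m + k)).-integrable setT (EFin \o (F \_ (cyl W D))).
  by rewrite -restrict_EFin; apply: (integrable_mkcond _ (measurable_cyl mW mD)).1.
have [_ -> _] := integral_prod_image (measurable_row_mx (m := m) (k := k)) (@leb_row_mxE R m k) iF'.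
rewrite integral0_eq// => y _.
rewrite (eq_integral (fun x => (((fun x => ((fun y => F (row_mx x y)) \_ D) y) \_ W) x)%:E)); last first.
  by move=> x _; rewrite /= patch_cyl.
have [Dy|Dy] := boolP (y \in D).
  rewrite -[RHS](F0 y (set_mem Dy)) [RHS]integral_mkcond; apply: eq_integral => x _.
  by rewrite !patchE Dy; case: ifP.
by apply: integral0_eq => x _; rewrite !patchE (negPf Dy); case: ifP.
Qed.

(** Tonelli and the finite measure of the base give integrability on the cylinder; Fubini then
    factors the integral. *)
Lemma integral_cyl W D (h : 'rV[R]_k -> R) : measurable W -> measurable D ->
  (leb m W < +oo)%E -> (leb k).-integrable D (EFin \o h) ->
  (leb (m + k)).-integrable (cyl W D) (EFin \o (fun x => h (rsubmx x))) /\
  \int[leb (m + k)]_(x in cyl W D) h (rsubmx x) = fine (leb m W) * \int[leb k]_(y in D) h y.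
Proof.
move=> mW mD Wy ih.
have mC := measurable_cyl mW mD.
have WE : (leb m W = (fine (leb m W))%:E)%E by rewrite fineK// ge0_fin_numE.
have mh : measurable_fun D h by apply/measurable_EFinP; exact: measurable_int ih.
pose F := (fun x => h (rsubmx x)) \_ (cyl W D).
have FE x y : F (row_mx x y) = \1_W x * (h \_ D) y.
  rewrite /F patch_cyl patchE indicE; case: ifP => _; last by rewrite mul0r.
  by rewrite mul1r !patchE; case: ifP => //; rewrite row_mxKr.
have mF : measurable_fun setT F.
  apply/(measurable_restrictT _ mC).
  apply: (@eq_measurable_fun _ _ _ _ _ ((h \_ D) \o (fun x : 'rV[R]_(m + k) => rsubmx x))).
    by move=> x; rewrite inE => -[_ Dx]; rewrite /= patchE mem_set.
  apply: measurable_funTS; apply: measurableT_comp; last exact: measurable_rsubmx.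
  exact/(measurable_restrictT _ mD).
have mhD : measurable_fun setT (h \_ D) by exact/(measurable_restrictT _ mD).
have ihD : (leb k).-integrable setT (EFin \o (h \_ D)).
  by rewrite -restrict_EFin; apply: (integrable_mkcond _ mD).1.
have iF : (leb (m + k)).-integrable setT (EFin \o F).
  apply/integrableP; split; first exact/measurable_EFinP.
  rewrite (ge0_integral_prod_image (measurable_row_mx (m := m) (k := k)) (@leb_row_mxE R m k))//; last first.
    by apply: measurableT_comp => //; exact/measurable_EFinP.
  pose I := (\int[leb k]_y (`|(h \_ D) y|)%:E)%E.
  have Iy : (I < +oo)%E by have /integrableP[] := ihD.
  have I0 : (0 <= I)%E by apply: integral_ge0 => y _; rewrite lee_fin.
  rewrite (eq_integral (fun x => (I * (\1_W x)%:E)%E)); last first.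
    move=> x _; rewrite muleC -ge0_integralZl//; last by apply/measurable_EFinP; exact: measurableT_comp.
    by apply: eq_integral => y _; rewrite /= FE normrM EFinM ger0_norm.
  rewrite ge0_integralZl//; last by apply/measurable_EFinP; exact: measurable_indic.
  rewrite integral_indic// setIT.
  have -> : (I = (fine I)%:E)%E by rewrite fineK// ge0_fin_numE.
  by rewrite WE -EFinM ltry.
split.
  by apply: (integrable_mkcond _ mC).2; rewrite restrict_EFin.
rewrite Rintegral_mkcond -/F [in RHS]Rintegral_mkcond /Rintegral.
have [-> _ _] := integral_prod_image (measurable_row_mx (m := m) (k := k)) (@leb_row_mxE R m k) iF.
have fI : (\int[leb k]_y ((h \_ D) y)%:E)%E \is a fin_num by exact: integrable_fin_num ihD.
rewrite (eq_integral (fun x => ((\int[leb k]_y ((h \_ D) y)%:E) * (\1_W x)%:E)%E)); last first.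
  move=> x _; rewrite muleC -integralZl//.
  by apply: eq_integral => y _; rewrite /= FE EFinM.
rewrite -[X in fine (\int[_]_x (X * _))%E](fineK fI).
rewrite integralZl//.
  by rewrite integral_indic// setIT [in LHS]WE -EFinM /= mulrC.
apply/integrableP; split; first by apply/measurable_EFinP; exact: measurable_indic.
rewrite (eq_integral (EFin \o \1_W)); last by move=> x _ /=; rewrite ger0_norm.
by rewrite integral_indic// setIT.
Qed.

Lemma Lp_cyl W D (r : R) (h : 'rV[R]_k -> R) : 0 < r -> measurable W -> measurable D ->
  (leb m W < +oo)%E -> Lp r D h -> Lp r (cyl W D) (fun x => h (rsubmx x)).
Proof.
move=> r0 mW mD Wy Lh; have [mh ih] := (LpP mD h r0).1 Lh.
apply/LpP => //; first exact: measurable_cyl.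
split; last exact: (integral_cyl mW mD Wy ih).1.
apply: (@eq_measurable_fun _ _ _ _ _ ((h \_ D) \o (fun x : 'rV[R]_(m + k) => rsubmx x))).
  by move=> x; rewrite inE => -[_ Dx]; rewrite /= patchE mem_set.
apply: measurable_funTS; apply: measurableT_comp; last exact: measurable_rsubmx.
exact/(measurable_restrictT _ mD).
Qed.

End cylinders.

(** * Slices and tensor products of test functions *)

Section cylinder_tests.
Context {R : realType} {m k : nat}.
Implicit Types (W : set 'rV[R]_m) (D : set 'rV[R]_k) (phi : 'rV[R]_(m + k) -> R).

Lemma partial_row_mxr phi x j :
  partial j (fun y : 'rV[R]_k => phi (row_mx x y)) = fun y => partial (rshift m j) phi (row_mx x y).
Proof.
apply/funext => y.
exact: (@derive_affine R 'rV[R]_k 'rV[R]_(m + k) phi (fun y => row_mx x y) _ _ y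
  (fun h => row_mx_shiftr h x y j)).1.
Qed.

Lemma partial_row_mxl phi y j :
  partial j (fun x : 'rV[R]_m => phi (row_mx x y)) = fun x => partial (lshift k j) phi (row_mx x y).
Proof.
apply/funext => x.
exact: (@derive_affine R 'rV[R]_m 'rV[R]_(m + k) phi (fun x => row_mx x y) _ _ x
  (fun h => row_mx_shiftl h x y j)).1.
Qed.

Lemma Ck_row_mxr N phi x : Ck N phi -> Ck N (fun y : 'rV[R]_k => phi (row_mx x y)).
Proof.
elim: N phi => [|N IH] phi Cp; split => //; try by
  move=> y; apply: (@continuous_comp _ _ _ (fun y : 'rV[R]_k => row_mx x y) phi);
    [exact: continuous_row_mxr|exact: (Ck_continuous Cp)].
move=> j; split => [y|]; last by rewrite partial_row_mxr; apply: IH; exact: Ck_partial.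
have [_] := @derive_affine R 'rV[R]_k 'rV[R]_(m + k) phi (fun y => row_mx x y) _ _ y
  (fun h => row_mx_shiftr h x y j).
by apply; exact: Ck_derivable Cp _ _.
Qed.

Lemma Ck_row_mxl N phi y : Ck N phi -> Ck N (fun x : 'rV[R]_m => phi (row_mx x y)).
Proof.
elim: N phi => [|N IH] phi Cp; split => //; try by
  move=> x; apply: (@continuous_comp _ _ _ (fun x : 'rV[R]_m => row_mx x y) phi);
    [exact: continuous_row_mxl|exact: (Ck_continuous Cp)].
move=> j; split => [x|]; last by rewrite partial_row_mxl; apply: IH; exact: Ck_partial.
have [_] := @derive_affine R 'rV[R]_m 'rV[R]_(m + k) phi (fun x => row_mx x y) _ _ x
  (fun h => row_mx_shiftl h x y j).
by apply; exact: Ck_derivable Cp _ _.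
Qed.

(** The slice vanishes outside the projection of the support of [phi], which is compact and
    contained in [D]. *)
Lemma test_row_mxr W D phi x : test_function (cyl W D) phi ->
  test_function D (fun y => phi (row_mx x y)).
Proof.
move=> [Cp cK KO]; set K := closure _ in cK KO.
apply: (@test_intro _ _ D [set rsubmx z | z in K]).
- by move=> N; exact: Ck_row_mxr.
- by apply: continuous_compact => //; apply: continuous_subspaceT; exact: continuous_rsubmx.
- by move=> _ [z /KO[_ Dz] <-].
- move=> y py; exists (row_mx x y); last by rewrite row_mxKr.
  exact: subset_closure.
Qed.

Lemma test_row_mxl W D phi y : test_function (cyl W D) phi ->
  test_function W (fun x => phi (row_mx x y)).
Proof.
move=> [Cp cK KO]; set K := closure _ in cK KO.
apply: (@test_intro _ _ W [set lsubmx z | z in K]).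
- by move=> N; exact: Ck_row_mxl.
- by apply: continuous_compact => //; apply: continuous_subspaceT; exact: continuous_lsubmx.
- by move=> _ [z /KO[Wz _] <-].
- move=> x px; exists (row_mx x y); last by rewrite row_mxKl.
  exact: subset_closure.
Qed.

Section weak_form.
Variables (W : set 'rV[R]_m) (D : set 'rV[R]_k) (oW : open W) (oD : open D).
Hypothesis Wy : (leb m W < +oo)%E.
Variables (p : R) (p1 : 1 < p).
Notation q := (p / (p - 1)).

Let mW := open_measurable_rV oW.
Let mD := open_measurable_rV oD.
Let oC := open_cyl oW oD.
Let mC := measurable_cyl mW mD.

(** [fine] also sends infinite values to 0; integrability rules them out. *)
Lemma Rintegral0E d (T : measurableType d) (mu : {measure set T -> \bar R}) (A : set T) (F : T -> R) :
  measurable A -> mu.-integrable A (EFin \o F) -> \int[mu]_(x in A) F x = 0 ->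
  (\int[mu]_(x in A) (F x)%:E = 0)%E.
Proof. by move=> mA iF F0; rewrite -[LHS]fineK ?integrable_fin_num// -[fine _]/(Rintegral _ _ _) F0. Qed.

(* A flux depending on X2 only stays weakly solvable on the cylinder: its first
   components are integrated against X1-derivatives of compactly supported
   functions, and its last ones slice by slice. *)
Lemma weak_form_cyl (G : 'rV[R]_k -> 'rV[R]_(m + k)) (f : 'rV[R]_k -> R) phi :
  (forall i, Lp q D (fun y => G y ord0 i)) -> Lp q D f ->
  (forall psi, test_function D psi ->
    \int[leb k]_(y in D) dotp (rsubmx (G y)) (grad psi y) = \int[leb k]_(y in D) (f y * psi y)) ->
  test_function (cyl W D) phi ->
  \int[leb (m + k)]_(x in cyl W D) dotp (G (rsubmx x)) (grad phi x) =
  \int[leb (m + k)]_(x in cyl W D) (f (rsubmx x) * phi x).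
Proof.
move=> LG Lf Gf tp.
have p0 : 0 < p := lt_trans ltr01 p1.
have q0 : 0 < q := conjugate_gt0 p1; have pq := conjugateE p1.
have qp : q^-1 + p^-1 = 1 by rewrite addrC.
have LGC i : Lp q (cyl W D) (fun x => G (rsubmx x) ord0 i).
  by apply: (Lp_cyl q0 mW mD Wy (h := fun y => G y ord0 i)).
have LfC : Lp q (cyl W D) (fun x => f (rsubmx x)) by exact: Lp_cyl.
have iG i : (leb (m + k)).-integrable (cyl W D)
    (EFin \o (fun x => G (rsubmx x) ord0 i * partial i phi x)).
  by apply: (hoelder_Lp mC q0 p0 qp (LGC i) _).1; apply: (test_Lp oC p0); exact: test_partial.
have if_ : (leb (m + k)).-integrable (cyl W D) (EFin \o (fun x => f (rsubmx x) * phi x)).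
  by apply: (hoelder_Lp mC q0 p0 qp LfC _).1; exact: (test_Lp oC p0).
have split x : dotp (G (rsubmx x)) (grad phi x) =
    \sum_(i < m) G (rsubmx x) ord0 (lshift k i) * partial (lshift k i) phi x +
    \sum_(j < k) G (rsubmx x) ord0 (rshift m j) * partial (rshift m j) phi x.
  by rewrite /dotp big_split_ord /=; congr (_ + _); apply: eq_bigr => i _; rewrite [in LHS]mxE.
have [i1 e1] := Rintegral_sum oC (index_enum 'I_m) (fun i => iG (lshift k i)).
have [i2 e2] := Rintegral_sum oC (index_enum 'I_k) (fun i => iG (rshift m i)).
have z1 i : \int[leb (m + k)]_(x in cyl W D)
    (G (rsubmx x) ord0 (lshift k i) * partial (lshift k i) phi x) = 0.
  apply: (integral_cyl_r0 mW mD (iG _)) => y Dy.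
  have ty := test_row_mxl y tp.
  have ti := test_integrable (test_partial i ty).
  have ti' : (leb m).-integrable W (EFin \o partial i (fun x => phi (row_mx x y))).
    by apply: integrableS ti.
  rewrite (eq_integral (fun x => ((G y ord0 (lshift k i))%:E *
      (partial i (fun x => phi (row_mx x y)) x)%:E)%E)); last first.
    by move=> x _; rewrite row_mxKr partial_row_mxl EFinM.
  rewrite integralZl// (Rintegral0E mW ti' (integral_partial_test i ty)).
  by rewrite mule0.
rewrite (@eq_Rintegral _ _ _ _ _ (fun x =>
  \sum_(i < m) G (rsubmx x) ord0 (lshift k i) * partial (lshift k i) phi x +
  \sum_(j < k) G (rsubmx x) ord0 (rshift m j) * partial (rshift m j) phi x)); last first.
  by move=> x _; rewrite split.
rewrite RintegralD// e1 big1 ?add0r//.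
apply/eqP; rewrite -subr_eq0 -RintegralB//; apply/eqP.
apply: integral_cyl_l0 => // [|x Wx].
  exact: (integrableB mC i2 if_).
have tx := test_row_mxr x tp.
have LG2 j : Lp q D (fun y => rsubmx (G y) ord0 j).
  rewrite (_ : (fun y => _) = fun y => G y ord0 (rshift m j)); first exact: LG.
  by apply/funext => y; rewrite mxE.
have Lgrad j : Lp p D (fun y => grad (fun y => phi (row_mx x y)) y ord0 j).
  rewrite (_ : (fun y => _) = partial j (fun y => phi (row_mx x y))).
    by apply: (test_Lp oD p0); exact: test_partial.
  by apply/funext => y; rewrite mxE.
have [j1 _] := hoelder_dotp oD p1 LG2 Lgrad.
have j2 := (hoelder_Lp mD q0 p0 qp Lf (test_Lp oD p0 tx)).1.
rewrite (eq_integral (fun y => (dotp (rsubmx (G y)) (grad (fun y => phi (row_mx x y)) y) -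
   f y * phi (row_mx x y))%:E)); last first.
  move=> y _; congr (_ - _)%:E; rewrite ?row_mxKr//.
  by rewrite /dotp; apply: eq_bigr => j _; rewrite [RHS]mulrC ![in RHS]mxE mulrC partial_row_mxr.
apply: Rintegral0E => //.
  exact: (integrableB mD j1 j2).
by rewrite RintegralB// Gf// subrr.
Qed.

End weak_form.

Lemma lsubmx_shiftl (h : R) (x : 'rV[R]_(m + k)) i :
  lsubmx (h *: delta_mx ord0 (lshift k i) + x) = h *: delta_mx ord0 i + lsubmx x.
Proof. by apply/rowP => j; rewrite !mxE (inj_eq (@lshift_inj _ _)). Qed.

Lemma lsubmx_shiftr (h : R) (x : 'rV[R]_(m + k)) j :
  lsubmx (h *: delta_mx ord0 (rshift m j) + x) = lsubmx x.
Proof. by apply/rowP => i; rewrite !mxE eq_lrshift andbF mulr0 add0r. Qed.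

Lemma rsubmx_shiftr (h : R) (x : 'rV[R]_(m + k)) j :
  rsubmx (h *: delta_mx ord0 (rshift m j) + x) = h *: delta_mx ord0 j + rsubmx x.
Proof. by apply/rowP => i; rewrite !mxE (inj_eq (@rshift_inj _ _)). Qed.

Lemma rsubmx_shiftl (h : R) (x : 'rV[R]_(m + k)) i :
  rsubmx (h *: delta_mx ord0 (lshift k i) + x) = rsubmx x.
Proof. by apply/rowP => j; rewrite !mxE eq_rlshift andbF mulr0 add0r. Qed.

Lemma partial_lsubmx_l (rho : 'rV[R]_m -> R) i :
  partial (lshift k i) (fun x : 'rV[R]_(m + k) => rho (lsubmx x)) = fun x => partial i rho (lsubmx x).
Proof.
apply/funext => x.
exact: (@derive_affine R 'rV[R]_(m + k) 'rV[R]_m rho (fun x => lsubmx x) _ _ x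
  (fun h => lsubmx_shiftl h x i)).1.
Qed.

Lemma is_partial_lsubmx_r (rho : 'rV[R]_m -> R) j (x : 'rV[R]_(m + k)) :
  is_derive x (delta_mx ord0 (rshift m j)) (fun x : 'rV[R]_(m + k) => rho (lsubmx x)) 0.
Proof. by apply: derive_shift_invariant => h; rewrite lsubmx_shiftr. Qed.

Lemma partial_rsubmx_r (phi : 'rV[R]_k -> R) j :
  partial (rshift m j) (fun x : 'rV[R]_(m + k) => phi (rsubmx x)) = fun x => partial j phi (rsubmx x).
Proof.
apply/funext => x.
exact: (@derive_affine R 'rV[R]_(m + k) 'rV[R]_k phi (fun x => rsubmx x) _ _ x
  (fun h => rsubmx_shiftr h x j)).1.
Qed.

Lemma is_partial_rsubmx_l (phi : 'rV[R]_k -> R) i (x : 'rV[R]_(m + k)) :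
  is_derive x (delta_mx ord0 (lshift k i)) (fun x : 'rV[R]_(m + k) => phi (rsubmx x)) 0.
Proof. by apply: derive_shift_invariant => h; rewrite rsubmx_shiftl. Qed.

Lemma Ck_lsubmx N (rho : 'rV[R]_m -> R) : Ck N rho -> Ck N (fun x : 'rV[R]_(m + k) => rho (lsubmx x)).
Proof.
elim: N rho => [|N IH] rho Cp; split => //; try by
  move=> x; apply: (@continuous_comp _ _ _ (fun x : 'rV[R]_(m + k) => lsubmx x) rho);
    [exact: continuous_lsubmx|exact: (Ck_continuous Cp)].
move=> i; case: (split_ordP i) => j ->; split.
- move=> x; apply: (@derive_affine R 'rV[R]_(m + k) 'rV[R]_m rho (fun x => lsubmx x) _ _ x
    (fun h => lsubmx_shiftl h x j)).2.
  exact: Ck_derivable Cp _ _.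
- by rewrite partial_lsubmx_l; apply: IH; exact: Ck_partial.
- by move=> x; exact: (@ex_derive _ _ _ _ _ _ _ (is_partial_lsubmx_r rho j x)).
- rewrite (_ : partial _ _ = fun=> 0); first exact: Ck_cst.
  by apply/funext => x; exact: (@derive_val _ _ _ _ _ _ _ (is_partial_lsubmx_r rho j x)).
Qed.

Lemma Ck_rsubmx N (phi : 'rV[R]_k -> R) : Ck N phi -> Ck N (fun x : 'rV[R]_(m + k) => phi (rsubmx x)).
Proof.
elim: N phi => [|N IH] phi Cp; split => //; try by
  move=> x; apply: (@continuous_comp _ _ _ (fun x : 'rV[R]_(m + k) => rsubmx x) phi);
    [exact: continuous_rsubmx|exact: (Ck_continuous Cp)].
move=> i; case: (split_ordP i) => j ->; split.
- by move=> x; exact: (@ex_derive _ _ _ _ _ _ _ (is_partial_rsubmx_l phi j x)).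
- rewrite (_ : partial _ _ = fun=> 0); first exact: Ck_cst.
  by apply/funext => x; exact: (@derive_val _ _ _ _ _ _ _ (is_partial_rsubmx_l phi j x)).
- move=> x; apply: (@derive_affine R 'rV[R]_(m + k) 'rV[R]_k phi (fun x => rsubmx x) _ _ x
    (fun h => rsubmx_shiftr h x j)).2.
  exact: Ck_derivable Cp _ _.
- by rewrite partial_rsubmx_r; apply: IH; exact: Ck_partial.
Qed.

Definition tensor (rho : 'rV[R]_m -> R) (phi : 'rV[R]_k -> R) (x : 'rV[R]_(m + k)) : R :=
  rho (lsubmx x) * phi (rsubmx x).

Lemma grad_tensor (rho : 'rV[R]_m -> R) (phi : 'rV[R]_k -> R) x : Ck 1 rho -> Ck 1 phi ->
  grad (tensor rho phi) x =
  row_mx (phi (rsubmx x) *: grad rho (lsubmx x)) (rho (lsubmx x) *: grad phi (rsubmx x)).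
Proof.
move=> Cr Cp; apply/rowP => i; rewrite [LHS]mxE.
rewrite partialM; [|exact: Ck_derivable (Ck_lsubmx Cr) _ _|exact: Ck_derivable (Ck_rsubmx Cp) _ _].
case: (split_ordP i) => j ->.
  rewrite row_mxEl mxE [grad _ _ _ _]mxE partial_lsubmx_l.
  rewrite [X in _ * X + _](@derive_val _ _ _ _ _ _ _ (is_partial_rsubmx_l phi j x)).
  by rewrite mulr0 add0r.
rewrite row_mxEr mxE [grad _ _ _ _]mxE partial_rsubmx_r.
rewrite [X in _ + _ * X](@derive_val _ _ _ _ _ _ _ (is_partial_lsubmx_r rho j x)).
by rewrite mulr0 addr0.
Qed.

(** The product of the two supports is closed and lies in a cube, hence is compact. *)
Lemma test_tensor W D (rho : 'rV[R]_m -> R) (phi : 'rV[R]_k -> R) :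
  test_function W rho -> test_function D phi -> test_function (cyl W D) (tensor rho phi).
Proof.
move=> [Cr cK1 K1W] [Cp cK2 K2D]; set K1 := closure _ in cK1 K1W; set K2 := closure _ in cK2 K2D.
have [M1 _ KM1] := bounded_rV (compact_bounded cK1).
have [M2 _ KM2] := bounded_rV (compact_bounded cK2).
have cK : compact (cyl K1 K2).
  apply: (subclosed_compact _ (@compact_cbox R (m + k) (Num.max M1 M2))).
    apply: closedI.
      by apply: (continuous_closedP _).1; [exact: continuous_lsubmx|exact: closed_closure].
    by apply: (continuous_closedP _).1; [exact: continuous_rsubmx|exact: closed_closure].
  move=> x [x1 x2] i; rewrite -ler_norml; case: (split_ordP i) => j ->.
    by have := KM1 _ x1 j; rewrite mxE => /ltW h; rewrite le_max h.
  by have := KM2 _ x2 j; rewrite mxE => /ltW h; rewrite le_max h orbT.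
apply: (test_intro _ cK).
- by move=> N; apply: CkM; [exact: Ck_lsubmx|exact: Ck_rsubmx].
- by move=> x [x1 x2]; split; [exact: K1W|exact: K2D].
- by move=> x; rewrite mulf_eq0 negb_or => /andP[x1 x2]; split; exact: subset_closure.
Qed.

End cylinder_tests.

(** * Energies and the lower bound *)

(** Turns each integral into a variable, so that [lra] meets purely linear relations. *)
Ltac generalize_integrals := repeat match goal with
  |- context [Rintegral ?mu ?D ?f] => move: (Rintegral mu D f) => ? end.

Section energies.
Context {R : realType} {n N : nat} (Omega : set 'rV[R]_N) (oO : open Omega) (p : R) (p1 : 1 < p).
Variables (H : 'rV[R]_n -> R) (HN : finsler_norm H).
Notation mu := (leb N).

Let mO := open_measurable_rV oO.
Let p0 : 0 < p := lt_trans ltr01 p1.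

Lemma integrable_finsler_pow (g : 'rV[R]_N -> 'rV[R]_n) :
  (forall i, Lp p Omega (fun x => g x ord0 i)) ->
  mu.-integrable Omega (EFin \o (fun x => H (g x) `^ p / p)) /\
  \int[mu]_(x in Omega) (H (g x) `^ p / p) = Lp_norm Omega p (H \o g) `^ p / p.
Proof.
move=> Lg; have [LH _] := Lp_finsler HN p1 mO Lg; have [_ iH] := (LpP mO (H \o g) p0).1 LH.
have E : (fun x => (`|(H \o g) x| `^ p)%:E) = EFin \o (fun x => H (g x) `^ p).
  by apply/funext => x /=; rewrite ger0_norm ?(finsler_ge0 HN).
have iH' : mu.-integrable Omega (EFin \o (fun x => H (g x) `^ p)) by rewrite -E.
split; last first.
  rewrite (RintegralZr _ mO iH'); congr (_ / _); apply: etrans (Lp_norm_pow p0 LH).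
  apply: eq_Rintegral => x _ /=.
  by rewrite ger0_norm ?(finsler_ge0 HN).
rewrite (_ : EFin \o _ = (fun x => (p^-1)%:E * (EFin \o (fun x => (H (g x) `^ p)%R)) x)%E).
  exact: integrableZl.
by apply/funext => x /=; rewrite mulrC EFinM.
Qed.

(** The integrated form of [flux_tangent], for arbitrary fields: it serves minimality, with a weak
    gradient and a classical one, and the lower bound, with (0, grad uoo). *)
Lemma convex_energy (g1 g2 : 'rV[R]_N -> 'rV[R]_n) :
  (forall i, Lp p Omega (fun x => g1 x ord0 i)) -> (forall i, Lp p Omega (fun x => g2 x ord0 i)) ->
  mu.-integrable Omega (EFin \o (fun x => dotp (flux p H (g1 x)) (g2 x))) ->
  mu.-integrable Omega (EFin \o (fun x => dotp (flux p H (g1 x)) (g1 x))) ->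
  \int[mu]_(x in Omega) (H (g1 x) `^ p / p) +
   (\int[mu]_(x in Omega) dotp (flux p H (g1 x)) (g2 x) -
    \int[mu]_(x in Omega) dotp (flux p H (g1 x)) (g1 x)) <=
  \int[mu]_(x in Omega) (H (g2 x) `^ p / p).
Proof.
move=> L1 L2 i12 i11.
have [iH1 _] := integrable_finsler_pow L1; have [iH2 _] := integrable_finsler_pow L2.
have iB := integrableB mO i12 i11.
rewrite -RintegralB// -RintegralD//; apply: le_Rintegral => //; first exact: (integrableD mO iH1 iB).
by move=> x _; rewrite -dotpBr; exact: flux_tangent.
Qed.
End energies.

(** * Minimality of weak solutions among test functions *)

Section minimality.
Context {R : realType} {n : nat} (Omega : set 'rV[R]_n) (oO : open Omega) (p : R) (p1 : 1 < p).
Variables (H : 'rV[R]_n -> R) (HN : finsler_norm H) (f u : 'rV[R]_n -> R).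
Hypotheses (Lf : Lp (p / (p - 1)) Omega f) (us : weak_solution p Omega (flux p H) f u).
Notation mu := (leb n).

Let mO := open_measurable_rV oO.
Let p0 : 0 < p := lt_trans ltr01 p1.
Let q0 := conjugate_gt0 p1.
Let pq := conjugateE p1.
Let qp : (p / (p - 1))^-1 + p^-1 = 1. Proof. by rewrite addrC. Qed.

Lemma Lp_grad_test (v : 'rV[R]_n -> R) i : test_function Omega v -> Lp p Omega (fun x => grad v x ord0 i).
Proof.
move=> tv; rewrite (_ : (fun x => _) = partial i v); first by apply: (test_Lp oO p0); exact: test_partial.
by apply/funext => x; rewrite mxE.
Qed.

Lemma energyE : W1p p Omega u -> energy p Omega H f u =
  \int[mu]_(x in Omega) (H (wgrad p Omega u x) `^ p / p) - \int[mu]_(x in Omega) (f x * u x).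
Proof.
move=> Wu; rewrite /energy RintegralB//.
  exact: (integrable_finsler_pow oO p1 HN (W1p_wgrad Wu).1).1.
exact: (hoelder_Lp mO q0 p0 qp Lf Wu.1).1.
Qed.

(** Tangent inequality from the gradient of [u] towards that of [v]; the weak equation, tested with
    [v] and with [u], converts the two flux integrals into the forcing terms. *)
Lemma energy_le_test (v : 'rV[R]_n -> R) : test_function Omega v ->
  energy p Omega H f u <= \int[mu]_(x in Omega) (H (grad v x) `^ p / p - f x * v x).
Proof.
move=> tv; have [Wu ws] := us; rewrite energyE; last exact: Wu.1.
have Lu := (W1p_wgrad Wu.1).1; have Lv i := Lp_grad_test i tv.
have LF i := Lq_flux HN p1 mO Lu i.
have [iHv _] := integrable_finsler_pow oO p1 HN Lv.
have [i12 _] := hoelder_dotp oO p1 LF Lv; have [i11 _] := hoelder_dotp oO p1 LF Lu.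
rewrite RintegralB//; last exact: (hoelder_Lp mO q0 p0 qp Lf (test_Lp oO p0 tv)).1.
have := convex_energy oO p1 HN Lu Lv i12 i11.
rewrite -(wgrad_test_dotp oO p1 LF tv) (ws v (W1p0_test oO p1 tv)) (ws u Wu).
generalize_integrals; lra.
Qed.

(** Comparison with the competitor 0, whose energy is 0. *)
Lemma energy_le0 : energy p Omega H f u <= 0.
Proof.
apply: le_trans (energy_le_test (test_cst0 Omega)) _.
rewrite (_ : \int[mu]_(x in Omega) _ = 0)// -[RHS](Rintegral_set0 mu (fun=> 0)).
rewrite Rintegral_mkcond [RHS]Rintegral_mkcond; apply: eq_Rintegral => x _.
rewrite !patchE; case: ifP => _; case: ifP => // _; rewrite mulr0 subr0;
by rewrite (_ : grad _ x = 0) ?(finsler0 HN) ?powR0 ?mul0r ?gt_eqF//;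
  apply/rowP => i; rewrite !mxE partial_cst.
Qed.
End minimality.

Section lower_bound.
Context {R : realType} {m k : nat} (W : set 'rV[R]_m) (D : set 'rV[R]_k) (oW : open W) (oD : open D).
Hypothesis Wy : (leb m W < +oo)%E.
Variables (p : R) (p1 : 1 < p) (H : 'rV[R]_(m + k) -> R) (HN : finsler_norm H).
Variables (f : 'rV[R]_k -> R) (Lf : Lp (p / (p - 1)) D f).
Variables (uoo : 'rV[R]_k -> R) (uoos : weak_solution p D (cross_flux p H) f uoo).

Let mW := open_measurable_rV oW.
Let mD := open_measurable_rV oD.
Let oC := open_cyl oW oD.
Let p0 : 0 < p := lt_trans ltr01 p1.
Let q0 := conjugate_gt0 p1.
Let pq := conjugateE p1.
Let qp : (p / (p - 1))^-1 + p^-1 = 1. Proof. by rewrite addrC. Qed.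

(** It identifies the pairing of the full flux with (0, grad uoo) and the pairing of [cross_flux]
    with grad uoo. *)
Lemma dotp_row_mx0 (a : 'rV[R]_(m + k)) (b : 'rV[R]_k) : dotp a (row_mx 0 b) = dotp (rsubmx a) b.
Proof.
rewrite /dotp big_split_ord /= big1 ?add0r.
  by apply: eq_bigr => j _; rewrite row_mxEr mxE.
by move=> i _; rewrite row_mxEl mxE mulr0.
Qed.

Lemma Lp_row_mx0 r (g : 'rV[R]_k -> 'rV[R]_k) (i : 'I_(m + k)) : 0 < r ->
  (forall i, Lp r D (fun y => g y ord0 i)) -> Lp r D (fun y => (row_mx 0 (g y) : 'rV[R]_(m + k)) ord0 i).
Proof.
move=> r0 Lg; case: (split_ordP i) => j ->.
  rewrite (_ : (fun y => _) = fun=> 0); first exact: Lp0.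
  by apply/funext => y; rewrite row_mxEl mxE.
rewrite (_ : (fun y => _) = fun y => g y ord0 j); first exact: Lg.
by apply/funext => y; rewrite row_mxEr.
Qed.

Lemma cross_energyE : energy p D (crossH H) f uoo =
  \int[leb k]_(y in D) (H (row_mx 0 (wgrad p D uoo y)) `^ p / p) - \int[leb k]_(y in D) (f y * uoo y).
Proof.
have [Wu _] := uoos.
rewrite /energy RintegralB//.
  apply: (integrable_finsler_pow oD p1 HN (g := fun y => row_mx 0 (wgrad p D uoo y)) _).1 => i.
  by apply: Lp_row_mx0 => //; exact: (W1p_wgrad Wu.1).1.
exact: (hoelder_Lp mD q0 p0 qp Lf Wu.1.1).1.
Qed.

(* The field (0, grad uoo) need not be a gradient vanishing on the boundary of the
   cylinder, but its flux can be tested with u, so the tangent inequality at it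
   bounds the energy of u from below. *)
Lemma energy_lower_bound (u : 'rV[R]_(m + k) -> R) : W1p0 p (cyl W D) u ->
  fine (leb m W) * energy p D (crossH H) f uoo <=
  energy p (cyl W D) H (fun x => f (rsubmx x)) u.
Proof.
move=> Wu; have [Woo ws] := uoos.
have LfC : Lp (p / (p - 1)) (cyl W D) (fun x => f (rsubmx x)) by exact: Lp_cyl.
pose g y : 'rV[R]_(m + k) := row_mx 0 (wgrad p D uoo y).
have Lg i : Lp p D (fun y => g y ord0 i).
  by apply: Lp_row_mx0 => //; exact: (W1p_wgrad Woo.1).1.
have LG i := Lq_flux HN p1 mD Lg i.
have LG2 j : Lp (p / (p - 1)) D (fun y => cross_flux p H (wgrad p D uoo y) ord0 j).
  rewrite (_ : (fun y => _) = fun y => flux p H (g y) ord0 (rshift m j)); first exact: LG.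
  by apply/funext => y; rewrite mxE.
have wf phi : test_function (cyl W D) phi ->
    \int[leb (m + k)]_(x in cyl W D) dotp (flux p H (g (rsubmx x))) (grad phi x) =
    \int[leb (m + k)]_(x in cyl W D) (f (rsubmx x) * phi x).
  apply: (weak_form_cyl oW oD Wy p1 (G := fun y => flux p H (g y)) LG Lf) => psi tpsi.
  by rewrite -(ws psi (W1p0_test oD p1 tpsi)) -(wgrad_test_dotp oD p1 LG2 tpsi).
have LgC i : Lp p (cyl W D) (fun x => g (rsubmx x) ord0 i).
  exact: (Lp_cyl p0 mW mD Wy (Lg i)).
have LGC i : Lp (p / (p - 1)) (cyl W D) (fun x => flux p H (g (rsubmx x)) ord0 i).
  exact: (Lp_cyl q0 mW mD Wy (LG i)).
have Lu := (W1p_wgrad Wu.1).1.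
have wfu := weak_form_W1p0 oC p1 (G := fun x => flux p H (g (rsubmx x))) LGC LfC wf Wu.
have [i12 _] := hoelder_dotp oC p1 LGC Lu; have [i11 _] := hoelder_dotp oC p1 LGC LgC.
have := convex_energy oC p1 HN LgC Lu i12 i11.
rewrite (energyE oC p1 HN LfC Wu.1) wfu.
have [_ e1] := integral_cyl mW mD Wy (integrable_finsler_pow oD p1 HN Lg).1.
have [_ e2] := integral_cyl mW mD Wy (hoelder_dotp oD p1 LG Lg).1.
rewrite e1 e2 cross_energyE mulrBr.
(* The limit equation is tested with [uoo] itself; the linear part of the tangent inequality then
   consists exactly of the forcing terms of the two energies. *)
have -> : \int[leb k]_(y in D) dotp (flux p H (g y)) (g y) = \int[leb k]_(y in D) (f y * uoo y).
  by rewrite -(ws uoo Woo); apply: eq_Rintegral => y _; rewrite /g dotp_row_mx0.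
rewrite /energy; generalize_integrals; lra.
Qed.
End lower_bound.

(** * Upper bound *)

Section power_inequalities.
Context {R : realType} (p : R) (p1 : 1 < p).
Let p0 : 0 < p := lt_trans ltr01 p1.

(** Young's inequality for b t^(p-1). With t = b + L e it makes the growth of b^p/p linear in e. *)
Lemma powR_tangent (b t : R) : 0 <= b -> 0 < t -> t `^ p / p <= b `^ p / p + t `^ (p - 1) * (t - b).
Proof.
move=> b0 t0; have P0 : 0 <= t `^ (p - 1) by exact: powR_ge0.
have := conjugate_powR b0 P0 p0 (conjugate_gt0 p1) (conjugateE p1).
rewrite -powRrM (_ : (p - 1) * (p / (p - 1)) = p); last by field; rewrite gt_eqF// subr_gt0.
have tE : t `^ (p - 1) * t = t `^ p.
  by rewrite -{2}[t]powRr1 ?ltW// -powRD ?subrK//; apply/implyP => _; rewrite gt_eqF.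
rewrite invf_div => h.
have e : t `^ p * ((p - 1) / p) = t `^ p - t `^ p / p by field; rewrite gt_eqF.
by rewrite e in h; rewrite mulrBr tE; move: h; rewrite [b * _]mulrC; lra.
Qed.

(** a + b is at most twice the larger of the two. *)
Lemma powRD_le (a b : R) : 0 <= a -> 0 <= b -> (a + b) `^ p <= 2 `^ p * (a `^ p + b `^ p).
Proof.
move=> a0 b0.
wlog ab : a b a0 b0 / a <= b.
  move=> h; have [/h|/ltW /h] := leP a b; first exact.
  by rewrite [b + a]addrC [b `^ p + _]addrC; exact.
apply: (@le_trans _ _ ((2 * b) `^ p)).
  by apply: ge0_ler_powR; rewrite ?nnegrE ?addr_ge0 ?mulr_ge0// ?(ltW p0)//; lra.
by rewrite powRM// ler_wpM2l ?powR_ge0// lerDr powR_ge0.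
Qed.
End power_inequalities.

Section upper_bound.
Context {R : realType} {m k : nat} (D : set 'rV[R]_k) (oD : open D).
Variables (p : R) (p1 : 1 < p) (H : 'rV[R]_(m + k) -> R) (HN : finsler_norm H).
Variables (f : 'rV[R]_k -> R) (Lf : Lp (p / (p - 1)) D f).

Let mD := open_measurable_rV oD.
Let p0 : 0 < p := lt_trans ltr01 p1.
Let q0 := conjugate_gt0 p1.
Let pq := conjugateE p1.
Let qp : (p / (p - 1))^-1 + p^-1 = 1. Proof. by rewrite addrC. Qed.

Lemma Lp_normZ u (c : R) : Lp p D u -> Lp_norm D p (fun y => c * u y) <= `|c| * Lp_norm D p u.
Proof.
move=> Lu; have [_ iu] := (LpP mD u p0).1 Lu.
have e : Lp_norm D p (fun y => c * u y) `^ p = (`|c| * Lp_norm D p u) `^ p.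
  rewrite -Lp_norm_pow//; last exact: LpZ.
  rewrite powRM ?Lp_norm_ge0// -Lp_norm_pow// -RintegralZl//.
  by apply: eq_Rintegral => y _; rewrite normrM powRM.
rewrite leNgt; apply/negP => lt; have := gt0_ltr_powR p0 _ _ lt.
by rewrite !nnegrE mulr_ge0 ?Lp_norm_ge0// e ltxx => /(_ isT isT).
Qed.

Definition cross_density (phi : 'rV[R]_k -> R) (y : 'rV[R]_k) : R :=
  H (row_mx 0 (grad phi y)) `^ p / p - f y * phi y.

(* Bounds the energy density of rho(X1) phi(X2) where 0 <= rho <= 1 and
   H(grad rho, 0) <= K. *)
Definition layer_density (K : R) (phi : 'rV[R]_k -> R) (y : 'rV[R]_k) : R :=
  2 `^ p / p * (K `^ p * `|phi y| `^ p + H (row_mx 0 (grad phi y)) `^ p) + `|f y * phi y|.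

Lemma cross_density_integrable phi : test_function D phi ->
  (leb k).-integrable D (EFin \o cross_density phi).
Proof.
move=> tp.
have Lg (i : 'I_(m + k)) : Lp p D (fun y => (row_mx 0 (grad phi y) : 'rV[R]_(m + k)) ord0 i).
  by apply: Lp_row_mx0 => // j; exact: Lp_grad_test.
exact: (integrableB mD (integrable_finsler_pow oD p1 HN Lg).1
  (hoelder_Lp mD q0 p0 qp Lf (test_Lp oD p0 tp)).1).
Qed.

Lemma layer_density_integrable K phi : test_function D phi ->
  (leb k).-integrable D (EFin \o layer_density K phi) /\
  \int[leb k]_(y in D) layer_density K phi y =
   2 `^ p / p * (K `^ p * Lp_norm D p phi `^ p +
     Lp_norm D p (fun y => H (row_mx 0 (grad phi y))) `^ p) +
   \int[leb k]_(y in D) `|f y * phi y|.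
Proof.
move=> tp.
have Lg (i : 'I_(m + k)) : Lp p D (fun y => (row_mx 0 (grad phi y) : 'rV[R]_(m + k)) ord0 i).
  by apply: Lp_row_mx0 => // j; exact: Lp_grad_test.
have [LH _] := Lp_finsler HN p1 mD Lg.
have Lphi := test_Lp oD p0 tp.
have i1 := ((LpP mD _ p0).1 Lphi).2; have i2 := ((LpP mD _ p0).1 LH).2.
have i2' : (leb k).-integrable D (EFin \o (fun y => H (row_mx 0 (grad phi y)) `^ p)).
  rewrite (_ : EFin \o _ = (fun y => (`|(H \o (fun y => row_mx 0 (grad phi y))) y| `^ p)%:E))//.
  by apply/funext => y /=; rewrite ger0_norm ?(finsler_ge0 HN).
have i3 := (hoelder_Lp mD q0 p0 qp Lf Lphi).1.
have i3' : (leb k).-integrable D (EFin \o (fun y => `|f y * phi y|)).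
  exact: (integrable_abse i3).
have i1' : (leb k).-integrable D (EFin \o (fun y => K `^ p * `|phi y| `^ p)).
  exact: (integrableZl mD (K `^ p) i1).
have i12 : (leb k).-integrable D (EFin \o (fun y => K `^ p * `|phi y| `^ p + H (row_mx 0 (grad phi y)) `^ p)).
  exact: (integrableD mD i1' i2').
have i12' : (leb k).-integrable D (EFin \o (fun y => 2 `^ p / p * (K `^ p * `|phi y| `^ p + H (row_mx 0 (grad phi y)) `^ p))).
  exact: (integrableZl mD (2 `^ p / p) i12).
split; first exact: (integrableD mD i12' i3').
rewrite /layer_density RintegralD// RintegralZl// RintegralD// RintegralZl//.
congr (_ * (_ * _ + _) + _); first exact: Lp_norm_pow p0 Lphi.
apply: etrans (Lp_norm_pow p0 LH).
by apply: eq_Rintegral => y _; rewrite /= ger0_norm ?(finsler_ge0 HN).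
Qed.

Section competitor.
Variables (W B : set 'rV[R]_m) (oW : open W) (oB : open B) (BW : B `<=` W).
Hypothesis Wy : (leb m W < +oo)%E.
Variables (rho : 'rV[R]_m -> R) (M : R).
Hypotheses (trho : test_function W rho) (rho01 : forall x, 0 <= rho x <= 1)
  (drho : forall i x, `|partial i rho x| <= M) (rho1 : forall x, B x -> rho x = 1) (M0 : 0 <= M).

Let mW := open_measurable_rV oW.
Let mB := open_measurable_rV oB.
Let oC := open_cyl oW oD.
Let mC := measurable_cyl mW mD.
Let K := M * finsler_bound H.

Let density phi x := H (grad (tensor rho phi) x) `^ p / p - f (rsubmx x) * tensor rho phi x.

(** [B] is open, so rho is constantly 1 near the point and its gradient vanishes there. *)
Lemma tensor_density_core phi x : test_function D phi -> B (lsubmx x) ->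
  density phi x = cross_density phi (rsubmx x).
Proof.
move=> tp Bx; rewrite /density /cross_density grad_tensor; [|by case: trho|by case: tp].
rewrite rho1// scale1r (_ : grad rho (lsubmx x) = 0) ?scaler0 /tensor ?rho1 ?mul1r//.
apply/rowP => i; rewrite !mxE /partial (@near_eq_derive _ _ _ rho (cst 1) (lsubmx x)).
  by rewrite derive_cst.
have nB : nbhs (lsubmx x) B by apply: open_nbhs_nbhs.
by apply: (@filterS _ (nbhs (lsubmx x)) (nbhs_filter _) _ _ _ nB) => y By; rewrite /= rho1.
Qed.

(** The gradient is phi (grad rho, 0) + rho (0, grad phi). By the triangle inequality H of it is at
    most K |phi| + H(0, grad phi), and [powRD_le] separates the two powers. *)
Lemma tensor_density_layer phi x : test_function D phi ->
  density phi x <= layer_density K phi (rsubmx x).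
Proof.
move=> tp; rewrite /density /layer_density grad_tensor; [|by case: trho|by case: tp].
set y := rsubmx x; set z := lsubmx x; have /andP[r0 r1] := rho01 z.
have K0 : 0 <= K by rewrite mulr_ge0 ?(finsler_bound_ge0 HN).
have Ha : H (row_mx (grad rho z) 0) <= K.
  apply: le_trans (finsler_le_sum HN _) _; rewrite /K /finsler_bound mulr_sumr.
  apply: ler_sum => i _; rewrite ler_wpM2r ?(finsler_ge0 HN)//.
  by case: (split_ordP i) => j ->; [rewrite row_mxEl mxE|rewrite row_mxEr mxE normr0].
have Hle : H (row_mx (phi y *: grad rho z) (rho z *: grad phi y)) <=
    K * `|phi y| + H (row_mx 0 (grad phi y)).
  have -> : row_mx (phi y *: grad rho z) (rho z *: grad phi y) =
      phi y *: row_mx (grad rho z) 0 + rho z *: row_mx 0 (grad phi y).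
    by rewrite !scale_row_mx add_row_mx !scaler0 addr0 add0r.
  apply: le_trans (finslerD HN _ _) _; rewrite !(finsler_homogeneous HN).
  apply: lerD; first by rewrite mulrC ler_wpM2r.
  by rewrite ger0_norm// ler_piMl ?(finsler_ge0 HN).
apply: lerD.
  rewrite mulrAC ler_wpM2r ?invr_ge0 ?(ltW p0)//.
  apply: (@le_trans _ _ ((K * `|phi y| + H (row_mx 0 (grad phi y))) `^ p)).
    apply: (ge0_ler_powR (ltW p0)) Hle; rewrite nnegrE ?(finsler_ge0 HN)//.
    by apply: addr_ge0; [exact: mulr_ge0|exact: (finsler_ge0 HN)].
  have Kphi : 0 <= K * `|phi y| by exact: mulr_ge0.
  apply: le_trans (powRD_le p1 Kphi (finsler_ge0 HN _)) _.
  by rewrite powRM.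
rewrite /tensor -/y -/z; apply: le_trans (ler_norm _) _.
by rewrite normrN !normrM (ger0_norm r0) ler_wpM2l// ler_piMl.
Qed.

(** Over [B] the density is the cross density; over the rest it is at most the layer density.
    Charging the cross density to all of [W] leaves the area of the layer times the excess. *)
Lemma energy_tensor_le phi (u : 'rV[R]_(m + k) -> R) : test_function D phi ->
  weak_solution p (cyl W D) (flux p H) (fun x => f (rsubmx x)) u ->
  energy p (cyl W D) H (fun x => f (rsubmx x)) u <=
  fine (leb m W) * \int[leb k]_(y in D) cross_density phi y +
  (fine (leb m W) - fine (leb m B)) *
   (\int[leb k]_(y in D) layer_density K phi y - \int[leb k]_(y in D) cross_density phi y).
Proof.
move=> tp us.
have LfC : Lp (p / (p - 1)) (cyl W D) (fun x => f (rsubmx x)) by exact: Lp_cyl.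
have tt := test_tensor trho tp.
apply: le_trans (energy_le_test oC p1 HN LfC us tt) _.
have iE : (leb (m + k)).-integrable (cyl W D) (EFin \o density phi).
  exact: (integrableB mC (integrable_finsler_pow oC p1 HN (fun i => Lp_grad_test oC p1 i tt)).1
    (hoelder_Lp mC q0 p0 qp LfC (test_Lp oC p0 tt)).1).
have mWB : measurable (W `\` B) by exact: measurableD.
have cU : cyl W D = cyl B D `|` cyl (W `\` B) D.
  apply/seteqP; split => x.
    by move=> [Wx Dx]; have [Bx|Bx] := pselect (B (lsubmx x)); [left|right].
  by move=> [[Bx Dx]|[[Wx _] Dx]]; split => //; exact: BW.
have mcB := measurable_cyl mB mD; have mcWB := measurable_cyl mWB mD.
have leB : (leb m B <= leb m W)%E by apply: le_measure; rewrite ?inE.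
have leWB : (leb m (W `\` B) <= leb m W)%E by apply: le_measure; rewrite ?inE//; exact: subDsetl.
have By := le_lt_trans leB Wy; have WBy := le_lt_trans leWB Wy.
have areaE : fine (leb m W) = fine (leb m B) + fine (leb m (W `\` B)).
  rewrite -fineD ?ge0_fin_numE// -measureU//.
    by rewrite setDUK.
  by rewrite setDE setICA setICr setI0.
have [iL1 eL1] := integral_cyl mB mD By (cross_density_integrable tp).
have [iL2 eL2] := integral_cyl mWB mD WBy (layer_density_integrable K tp).1.
rewrite -[X in X <= _]/(\int[leb (m + k)]_(x in cyl W D) density phi x).
rewrite cU Rintegral_setU//; last first.
- by apply/disj_setPS => x [[Bx _] [[_ nBx] _]].
- by rewrite -cU.
have h1 : \int[leb (m + k)]_(x in cyl B D) density phi x =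
    fine (leb m B) * \int[leb k]_(y in D) cross_density phi y.
  rewrite -eL1; apply: eq_Rintegral => x; rewrite inE => -[Bx _].
  exact: tensor_density_core.
have h2 : \int[leb (m + k)]_(x in cyl (W `\` B) D) density phi x <=
    fine (leb m (W `\` B)) * \int[leb k]_(y in D) layer_density K phi y.
  rewrite -eL2; apply: le_Rintegral => //; last by move=> x _; exact: tensor_density_layer.
  by apply: integrableS iE => //; rewrite cU; exact: subsetUr.
rewrite h1 areaE; apply: le_trans (lerD (lexx _) h2) _.
rewrite le_eqVlt; apply/orP; left; apply/eqP; ring.
Qed.
End competitor.

(** What matters is that C1 and C2 precede e: letting e tend to 0 at fixed l does not worsen the
    constant of the layer. *)
Lemma cross_density_approx (K : R) (uoo : 'rV[R]_k -> R) : 0 <= K ->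
  weak_solution p D (cross_flux p H) f uoo ->
  exists C1 C2 : R, [/\ 0 <= C1, 0 <= C2 & forall e, 0 < e -> e <= 1 ->
    exists phi, [/\ test_function D phi,
      \int[leb k]_(y in D) cross_density phi y <= energy p D (crossH H) f uoo + C2 * e &
      0 <= \int[leb k]_(y in D) layer_density K phi y - \int[leb k]_(y in D) cross_density phi y <= C1]].
Proof.
(* The two closing estimates are settled over abstract reals first, so that [lra] does not have to
   handle powers and integrals. *)
have core_arith (t b N X Y Z I J : R) : t <= b + Y -> N <= t -> Y <= X -> J - I <= Z ->
    N - I <= b - J + (X + Z) by lra.
have layer_arith (A B F I N Z : R) : A <= B -> F <= Z -> I <= F -> 0 <= N ->
    A + F - (N - I) <= B + 2 * Z by lra.
move=> K0 uoos; have [Woo _] := uoos; have Lgu := (W1p_wgrad Woo.1).1.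
pose g0 y : 'rV[R]_(m + k) := row_mx 0 (wgrad p D uoo y).
have Lg0 i : Lp p D (fun y => g0 y ord0 i) by apply: Lp_row_mx0.
have [LHg0 _] := Lp_finsler HN p1 mD Lg0.
(* The added 1 makes b + L e positive even if b is 0, as [powR_tangent] requires. *)
pose b := Lp_norm D p (H \o g0); pose L := finsler_bound H + 1.
pose Nf := Lp_norm D (p / (p - 1)) f; pose U := Lp_norm D p uoo.
have b0 : 0 <= b by exact: Lp_norm_ge0.
have L1 : 0 < L by rewrite ltr_wpDl// (finsler_bound_ge0 HN).
have Nf0 : 0 <= Nf by exact: Lp_norm_ge0.
have U0 : 0 <= U by exact: Lp_norm_ge0.
(* For e <= 1, the norms of phi and of H(0, grad phi) are at most U + 1 and b + L, which bounds the
   layer integral; the two forcing terms cost Nf (U + 1) each. In the second constant, (b + L)^(p-1)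
   L comes from [powR_tangent], and Nf from replacing uoo by phi in the forcing term. *)
exists (2 `^ p / p * (K `^ p * (U + 1) `^ p + (b + L) `^ p) + 2 * (Nf * (U + 1))),
  ((b + L) `^ (p - 1) * L + Nf); split.
- apply: addr_ge0; last by rewrite !mulr_ge0// addr_ge0.
  by rewrite mulr_ge0 ?divr_ge0 ?powR_ge0 ?(ltW p0)// addr_ge0 ?mulr_ge0 ?powR_ge0.
- by rewrite addr_ge0// mulr_ge0 ?powR_ge0// ltW.
move=> e e0 e1; have [phi [tp phiu phig]] := W1p0_approx oD p1 Woo e0.
have Lphi := test_Lp oD p0 tp.
have Lgp j := Lp_grad_test oD p1 j tp.
pose g y : 'rV[R]_(m + k) := row_mx 0 (grad phi y).
have Lg i : Lp p D (fun y => g y ord0 i) by apply: Lp_row_mx0.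
have [LHg _] := Lp_finsler HN p1 mD Lg.
pose w y := wgrad p D uoo y - grad phi y.
have wE j : (fun y => w y ord0 j) = fun y => wgrad p D uoo y ord0 j - partial j phi y.
  by apply/funext => y; rewrite !mxE.
have Lw j : Lp p D (fun y => w y ord0 j).
  by rewrite wE; apply: (LpB mD (ltW p1) (Lgu j)); apply: (test_Lp oD p0); exact: test_partial.
pose gw y : 'rV[R]_(m + k) := row_mx 0 (w y).
have Lgw i : Lp p D (fun y => gw y ord0 i) by apply: Lp_row_mx0.
have [LHgw nHgw] := Lp_finsler HN p1 mD Lgw.
have nw : Lp_norm D p (H \o gw) <= finsler_bound H * e.
  apply: le_trans nHgw _; rewrite /finsler_bound mulr_suml; apply: ler_sum => i _.
  apply: le_trans (Lp_normZ _ (Lgw i)) _; rewrite (ger0_norm (finsler_ge0 HN _)).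
  rewrite ler_wpM2l ?(finsler_ge0 HN)//; case: (split_ordP i) => j ->.
    rewrite (_ : (fun y => _) = fun=> 0); last by apply/funext => y; rewrite /gw row_mxEl mxE.
    rewrite /Lp_norm (_ : EFin \o _ = cst 0%E) ?Lnorm0 ?eqe ?gt_eqF//= ?ltW//.
    by apply/funext => y /=; rewrite patchE; case: ifP.
  rewrite (_ : (fun y => _) = fun y => w y ord0 j); first by rewrite wE ltW.
  by apply/funext => y; rewrite /gw row_mxEr.
have nb : Lp_norm D p (H \o g) <= b + L * e.
  have [Ls ns] := LpD mD (ltW p1) LHg0 LHgw.
  have mHg : measurable_fun D (H \o g) := Lp_measurable mD LHg.
  have le y : D y -> `|(H \o g) y| <= `|(H \o g0) y + (H \o gw) y|.
    move=> _; rewrite /= !ger0_norm ?addr_ge0 ?(finsler_ge0 HN)//.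
    rewrite -(finslerN HN (gw y)) (_ : g y = g0 y + - gw y) ?(finslerD HN)//.
    by rewrite /g /g0 /gw opp_row_mx add_row_mx oppr0 addr0 opprB addrC subrK.
  apply: le_trans (Lp_le mD p0 mHg Ls le).2 _; apply: le_trans ns _.
  rewrite lerD2l; apply: le_trans nw _.
  by rewrite /L mulrDl mul1r lerDl ltW.
have t0 : 0 < b + L * e by rewrite ltr_wpDl// mulr_gt0.
have tL : b + L * e <= b + L by rewrite lerD2l ler_piMr// ltW.
have nbp : Lp_norm D p (H \o g) `^ p <= (b + L * e) `^ p.
  by apply: (ge0_ler_powR (ltW p0)); rewrite ?nnegrE ?Lp_norm_ge0// ltW.
have tp_le : (b + L * e) `^ p <= (b + L) `^ p.
  by apply: (ge0_ler_powR (ltW p0)) => //; rewrite nnegrE; [exact: ltW|exact: le_trans (ltW t0) tL].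
have tp1_le : (b + L * e) `^ (p - 1) <= (b + L) `^ (p - 1).
  apply: ge0_ler_powR => //; rewrite ?nnegrE; first by rewrite subr_ge0 ltW.
    exact: ltW.
  exact: le_trans (ltW t0) tL.
have Lup : Lp p D (fun y => uoo y - phi y) by exact: (LpB mD (ltW p1) Woo.1.1 Lphi).
have nphi : Lp_norm D p phi <= U + 1.
  have [_] := LpD mD (ltW p1) Woo.1.1 (LpZ mD (-1) p0 Lup).
  rewrite (_ : (fun y => _) = phi); last by apply/funext => y; rewrite mulN1r opprB addrC subrK.
  move/le_trans; apply; rewrite lerD2l; apply: le_trans (Lp_normZ _ Lup) _.
  by rewrite normrN1 mul1r (le_trans (ltW phiu)).
have nphip : Lp_norm D p phi `^ p <= (U + 1) `^ p.
  by apply: (ge0_ler_powR (ltW p0)); rewrite ?nnegrE ?Lp_norm_ge0// addr_ge0.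
have [if1 nf1] := hoelder_Lp mD q0 p0 qp Lf Lphi.
have [if2 nf2] := hoelder_Lp mD q0 p0 qp Lf Lup.
have [if3 _] := hoelder_Lp mD q0 p0 qp Lf Woo.1.1.
have F1 : \int[leb k]_(y in D) `|f y * phi y| <= Nf * (U + 1).
  by apply: le_trans nf1 _; rewrite ler_wpM2l.
have F2 : \int[leb k]_(y in D) (f y * phi y) <= \int[leb k]_(y in D) `|f y * phi y|.
  exact: le_trans (ler_norm _) (le_normr_Rintegral mD if1).
have F3 : \int[leb k]_(y in D) (f y * uoo y) - \int[leb k]_(y in D) (f y * phi y) <= Nf * e.
  rewrite -RintegralB// (_ : \int[leb k]_(y in D) _ = \int[leb k]_(y in D) (f y * (uoo y - phi y))).
    apply: le_trans (ler_norm _) _; apply: le_trans (le_normr_Rintegral mD if2) _.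
    by apply: le_trans nf2 _; rewrite ler_wpM2l// ltW.
  by apply: eq_Rintegral => y _; rewrite mulrBr.
have [iHg eHg] := integrable_finsler_pow oD p1 HN Lg.
have [iHg0 eHg0] := integrable_finsler_pow oD p1 HN Lg0.
have crossE : \int[leb k]_(y in D) cross_density phi y =
    Lp_norm D p (H \o g) `^ p / p - \int[leb k]_(y in D) (f y * phi y).
  by rewrite -eHg -RintegralB.
have ooE : energy p D (crossH H) f uoo = b `^ p / p - \int[leb k]_(y in D) (f y * uoo y).
  by rewrite (cross_energyE oD p1 HN Lf uoos) -eHg0.
have [iL eL] := layer_density_integrable K tp.
have eL' : \int[leb k]_(y in D) layer_density K phi y =
  2 `^ p / p * (K `^ p * Lp_norm D p phi `^ p + Lp_norm D p (H \o g) `^ p) +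
   \int[leb k]_(y in D) `|f y * phi y| := eL.
have ip0 : 0 <= p^-1 by rewrite invr_ge0 ltW.
exists phi; split => //.
  rewrite crossE ooE; have := powR_tangent p1 b0 t0.
  have : Lp_norm D p (H \o g) `^ p / p <= (b + L * e) `^ p / p by rewrite ler_wpM2r.
  have : (b + L * e) `^ (p - 1) * (b + L * e - b) <= (b + L) `^ (p - 1) * (L * e).
    by rewrite addrAC subrr add0r ler_wpM2r// mulr_ge0 ?ltW.
  have -> : ((b + L) `^ (p - 1) * L + Nf) * e = (b + L) `^ (p - 1) * (L * e) + Nf * e by ring.
  by move=> h1 h2 h3; exact: core_arith h3 h2 h1 F3.
apply/andP; split.
  rewrite subr_ge0; apply: le_Rintegral => //; first exact: cross_density_integrable.
  move=> y _; rewrite /cross_density /layer_density; apply: lerD; last first.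
    by rewrite -normrN ler_norm.
  rewrite mulrAC ler_wpM2r//.
  have two1 : 1 <= 2 `^ p :> R.
    by rewrite -[leLHS](powRr0 2); apply: ler_powR; rewrite ?ler1n ?(ltW p0).
  rewrite -[leLHS]mul1r; apply: ler_pM => //; first exact: powR_ge0.
  by rewrite lerDr mulr_ge0 ?powR_ge0.
rewrite eL' crossE.
have c0 : 0 <= 2 `^ p / p :> R by rewrite mulr_ge0 ?powR_ge0.
have h1 : 2 `^ p / p * (K `^ p * Lp_norm D p phi `^ p + Lp_norm D p (H \o g) `^ p) <=
    2 `^ p / p * (K `^ p * (U + 1) `^ p + (b + L) `^ p).
  rewrite ler_wpM2l//; apply: lerD; last exact: le_trans nbp tp_le.
  by rewrite ler_wpM2l ?powR_ge0.
have h2 : 0 <= Lp_norm D p (H \o g) `^ p / p by rewrite mulr_ge0 ?powR_ge0.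
exact: layer_arith h1 F1 F2 h2.
Qed.
End upper_bound.

(** * The theorem *)

(** Bernoulli's inequality, to be applied with s = (l - 2)/l. *)
Lemma subr1_exp_le (R : realDomainType) (s : R) n : 0 <= s -> s <= 1 -> 1 - s ^+ n <= n%:R * (1 - s).
Proof.
move=> s0 s1; elim: n => [|n IH]; first by rewrite expr0 subrr mul0r.
have h : s * (1 - s ^+ n) <= n%:R * (1 - s).
  by apply: le_trans IH; rewrite ler_piMl// subr_ge0 exprn_ile1.
by rewrite exprS -natr1 mulrDl mul1r; move: h; rewrite mulrBr mulr1; lra.
Qed.

Section area.
Context {R : realType} {m : nat} (A : set 'rV[R]_m) (oA : open A) (bA : bounded_set A).

Lemma leb_bounded_lty : (leb m A < +oo)%E.
Proof.
have [M M0 hM] := bounded_rV bA.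
apply: le_lt_trans (leb_obox_lty (const_mx (- M)) (const_mx M)).
apply: le_measure; rewrite ?inE; [exact: open_measurable_rV|exact: measurable_obox|].
by move=> x /hM xM; apply/oboxP => i; rewrite !mxE -ltr_norml.
Qed.

(** The set contains a small box around 0. Positivity allows the division of energies by the
    area. *)
Lemma leb_open_gt0 : A 0 -> (0 < leb m A)%E.
Proof.
move=> A0; have : nbhs (0 : 'rV[R]_m) A by apply: open_nbhs_nbhs; split.
move=> /nbhs_ballP[e /= e0 eA].
apply: (@lt_le_trans _ _ (leb m (obox (const_mx (- e)) (const_mx e)))).
  rewrite leb_obox lte_fin prodr_gt0// => i _.
  by rewrite !mxE opprK lt_max addr_gt0// orbT.
apply: le_measure; rewrite ?inE; [exact: measurable_obox|exact: open_measurable_rV|].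
move=> x /oboxP xe; apply: eA; split => // i j; rewrite (ord1 i) mxE /ball/= sub0r normrN ltr_norml.
by have := xe j; rewrite !mxE.
Qed.

Lemma dilate_lty l : 0 < l -> (leb m (dilate l A) < +oo)%E.
Proof.
move=> l0; rewrite leb_dilate//; last exact: open_measurable_rV.
by rewrite lte_mul_pinfty// ?leb_bounded_lty// lee_fin exprn_ge0// ltW.
Qed.

Lemma fine_leb_dilate l : 0 < l -> fine (leb m (dilate l A)) = l ^+ m * fine (leb m A).
Proof.
move=> l0; rewrite leb_dilate ?fineM//; last exact: open_measurable_rV.
by rewrite ge0_fin_numE// leb_bounded_lty.
Qed.
End area.

Theorem theorem1p5 (R : realType) (m k : nat) (hm : (1 <= m)%N) (hk : (1 <= k)%N)
    (omega1 : set 'rV[R]_m)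
    (omega1_open : open omega1) (omega1_bounded : bounded_set omega1)
    (omega1_convex : convex_set omega1) (omega1_0 : omega1 0)
    (omega2 : set 'rV[R]_k)
    (omega2_open : open omega2) (omega2_bounded : bounded_set omega2)
    (p : R) (p_gt1 : 1 < p)
    (H : 'rV[R]_(m + k) -> R) (H_norm : finsler_norm H)
    (H_flux : flux_bounds p H)
    (f : 'rV[R]_k -> R) (f_Lq : Lp (p / (p - 1)) omega2 f)
    (u : R -> 'rV[R]_(m + k) -> R)
    (u_sol : forall l : R, 0 < l ->
      weak_solution p (cylinder l omega1 omega2) (flux p H)
        (fun x => f (rsubmx x)) (u l))
    (uoo : 'rV[R]_k -> R)
    (uoo_sol : weak_solution p omega2 (cross_flux p H) f uoo) :
  let J l := energy p (cylinder l omega1 omega2) H (fun x => f (rsubmx x)) in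
  let Joo := energy p omega2 (crossH H) f in
  let area l := fine (leb m (dilate l omega1)) in
  (J l (u l) / area l @[l --> +oo] --> Joo uoo) /\
  exists2 C : R, 0 < C & forall l : R, 0 < l ->
    Joo uoo <= J l (u l) / area l <= Joo uoo + C / l.
Proof.
move=> J Joo area.
have areaE l : 0 < l -> area l = l ^+ m * fine (leb m omega1) by exact: fine_leb_dilate.
have area0 l : 0 < l -> 0 < area l.
  move=> l0; rewrite areaE// mulr_gt0 ?exprn_gt0// fine_gt0//.
  by rewrite leb_open_gt0// leb_bounded_lty.
have oW l : 0 < l -> open (dilate l omega1) by move=> l0; apply: open_dilate; rewrite ?gt_eqF.
have Wy l : 0 < l -> (leb m (dilate l omega1) < +oo)%E by exact: dilate_lty.
have mD := open_measurable_rV omega2_open.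
(* The two-sided estimate puts the quotient within C/l of the limit, so it yields the
   convergence. *)
suff [C C0 hC] : exists2 C : R, 0 < C & forall l : R, 0 < l ->
    Joo uoo <= J l (u l) / area l <= Joo uoo + C / l.
  split; last by exists C.
  apply/cvgrPdist_le => e e0; near=> l.
  have l0 : 0 < l by near: l; exact: nbhs_pinfty_gt.
  have Cl : C / l <= e.
    rewrite ler_pdivrMr// mulrC -ler_pdivrMr//; near: l; exact: nbhs_pinfty_ge.
  by have /andP[h1 h2] := hC _ l0; rewrite ler_norml; apply/andP; split; move: h1 h2 Cl; lra.
have [M M0 cut] := convex_cutoff omega1_open omega1_bounded omega1_convex omega1_0.
have K0 : 0 <= M * finsler_bound H by rewrite mulr_ge0 ?(finsler_bound_ge0 H_norm).
have [C1 [C2 [C10 C20 approx]]] := cross_density_approx omega2_open p_gt1 H_norm f_Lq K0 uoo_sol.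
(* 2 m C1 pays for the layer, whose share of the area is at most 2 m / l; 2 |Joo| settles l <= 2;
   the 1 makes C positive. *)
pose C := 2 * m%:R * C1 + 2 * `|Joo uoo| + 1.
have mC1 : 0 <= 2 * m%:R * C1 by rewrite !mulr_ge0.
have C0 : 0 < C by rewrite /C; have := normr_ge0 (Joo uoo); move: mC1; lra.
exists C => // l l0; apply/andP; split.
  rewrite ler_pdivlMr ?area0// mulrC.
  exact: (energy_lower_bound (oW l l0) omega2_open (Wy l l0) p_gt1 H_norm f_Lq uoo_sol (u_sol l l0).1).
(* For l <= 2 no inner dilate remains, but C/l >= |Joo| makes the right-hand side nonnegative. *)
have [l2|l2] := leP l 2.
  have J0 : J l (u l) <= 0.
    apply: (energy_le0 _ p_gt1 H_norm _ (u_sol l l0)); first exact: (open_cyl (oW l l0) omega2_open).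
    apply: (Lp_cyl _ _ mD (Wy l l0) f_Lq); first exact: conjugate_gt0.
    exact: open_measurable_rV (oW l l0).
  have JC : `|Joo uoo| <= C / l.
    rewrite ler_pdivlMr// /C; have : `|Joo uoo| * l <= `|Joo uoo| * 2 by rewrite ler_wpM2l.
    by move: mC1; lra.
  apply: (@le_trans _ _ 0); first by rewrite pmulr_lle0 ?invr_gt0 ?area0.
  by have := ler_norm (- Joo uoo); rewrite normrN; move: JC; lra.
have [rho [trho rho01 drho rho1]] := cut l l2.
have l20 : 0 < l - 2 by rewrite subr_gt0.
have BW : dilate (l - 2) omega1 `<=` dilate l omega1.
  by apply: dilate_le => //; [exact: ltW|rewrite gerBl].
(* The inner area is (1 - 2/l)^m times the full one. *)
have layer_area : area l - area (l - 2) <= m%:R * (2 / l) * area l.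
  have -> : area (l - 2) = ((l - 2) / l) ^+ m * area l.
    rewrite !areaE// exprMn mulrA; congr (_ * _).
    by rewrite -mulrA -exprMn mulVf ?gt_eqF// expr1n mulr1.
  rewrite -[X in X - _]mul1r -mulrBl ler_wpM2r ?(ltW (area0 _ l0))//.
  have -> : 2 / l = 1 - (l - 2) / l by field; rewrite gt_eqF.
  by apply: subr1_exp_le; [rewrite divr_ge0// ltW|rewrite ler_pdivrMr// mul1r gerBl].
(* With l fixed, an arbitrary slack e is allowed; e' rescales it so that e' <= 1 and C2 e' <= e. *)
apply/ler_addgt0Pr => e e0.
pose e' := Num.min 1 (e / (C2 + 1)).
have C21 : 0 < C2 + 1 by rewrite ltr_wpDl.
have e'0 : 0 < e' by rewrite lt_min ltr01 divr_gt0.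
have e'1 : e' <= 1 by rewrite ge_min lexx.
have e'e : C2 * e' <= e.
  have : e' * (C2 + 1) <= e by rewrite -ler_pdivlMr// ge_min lexx orbT.
  by rewrite mulrDr mulr1 mulrC; move: e'0; lra.
have [phi [tphi cross_le /andP[_ layer_le]]] := approx e' e'0 e'1.
have := energy_tensor_le omega2_open p_gt1 H_norm f_Lq (oW l l0) (oW _ l20) BW (Wy l l0)
  trho rho01 drho rho1 M0 tphi (u_sol l l0).
rewrite -/(area l) -/(area (l - 2)) -/(J l (u l)) => JE.
rewrite ler_pdivrMr ?area0//; apply: le_trans JE _.
have layer0 : 0 <= area l - area (l - 2).
  rewrite subr_ge0 fine_le ?ge0_fin_numE ?Wy//.
  by apply: le_measure; rewrite ?inE; [exact: open_measurable_rV (oW _ l20)|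
    exact: open_measurable_rV (oW _ l0)|].
have h1 : area l * \int[leb k]_(y in omega2) cross_density p H f phi y <=
    area l * (Joo uoo + e).
  by rewrite ler_wpM2l ?(ltW (area0 _ l0))//; apply: le_trans cross_le _; rewrite lerD2l.
have h2 := ler_wpM2l layer0 layer_le.
have h3 : (area l - area (l - 2)) * C1 <= C / l * area l.
  apply: (@le_trans _ _ (m%:R * (2 / l) * area l * C1)); first exact: ler_wpM2r.
  rewrite mulrAC ler_wpM2r ?(ltW (area0 _ l0))//.
  have -> : m%:R * (2 / l) * C1 = 2 * m%:R * C1 / l by ring.
  by rewrite ler_wpM2r ?invr_ge0 ?(ltW l0)// /C -addrA lerDl addr_ge0 ?mulr_ge0.
by move: h1 h2 h3; rewrite !mulrDr !mulrDl ![area l * _]mulrC; lra.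
Unshelve. all: by end_near.
Qed.
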